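(* Let $U\subseteq\mathbb{R}^d$ be open and convex. For every convex function $f:U\to\mathbb{R}$ and every $\varepsilon>0$ there exists a $C^\infty$ convex function $g:U\to\mathbb{R}$ such that $f-\varepsilon\leq g\leq f$ on $U$. Moreover, $g$ can be taken so as to preserve local Lipschitz constants of $f$, meaning that $\mathrm{Lip}(g_{|_B})\leq\mathrm{Lip}(f_{|_{(1+\varepsilon)B}})$ for every ball $B\subset U$. And if $f$ is strictly (or strongly) convex, then $g$ can be chosen to be strictly (respectively strongly) convex as well.
   Context: $\mathrm{Lip}(h_{|_S})$ denotes the Lipschitz constant of $h$ restricted to $S$ (possibly $+\infty$). $(1+\varepsilon)B$ denotes the ball concentric with $B$ whose radius is $(1+\varepsilon)$ times that of $B$, and $f_{|_{(1+\varepsilon)B}}$ is the restriction of $f$ to the part of this ball lying in $U$. $f$ is strictly convex if $f((1-t)x+ty)<(1-t)f(x)+tf(y)$ for all $x\neq y$ in $U$ and $0<t<1$. A $C^2$ function $\varphi$ on an open set is strongly convex if its second derivative along every nonconstant straight line is strictly positive at every point. A not necessarily smooth function $f:U\to\mathbb{R}$ is strongly convex if every $p\in U$ has an open neighbourhood $V$ for which there is a strongly convex $\varphi\in C^2(V)$ such that $f-\varphi$ is convex on $V$. *)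

(* Defs.v *)
From HB Require Import structures.
From mathcomp Require Import all_boot all_order all_algebra.
From mathcomp Require Import all_classical all_reals all_analysis.
Set Implicit Arguments.
Unset Strict Implicit.
Unset Printing Implicit Defensive.
Import Order.TTheory GRing.Theory Num.Theory.
Import numFieldNormedType.Exports.
Local Open Scope classical_set_scope.
Local Open Scope ring_scope.

(* A function U -> R is represented by a total function on 'rV[R]_d; every
   notion below only depends on its values on U (for the differential notions,
   provided U is open). *)

(* The norm `|x| of 'rV[R]_d is the sup norm, which induces the right topology
   and notion of differentiability, but not the right balls nor the right
   Lipschitz constants. *)
Definition enorm (R : realType) (d : nat) (x : 'rV[R]_d) : R :=
  Num.sqrt (\sum_(i < d) x ord0 i ^+ 2).

Definition eball (R : realType) (d : nat) (x : 'rV[R]_d) (r : R) :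
  set 'rV[R]_d := [set y | enorm (y - x) < r].

Definition closed_eball (R : realType) (d : nat) (x : 'rV[R]_d) (r : R) :
  set 'rV[R]_d := [set y | enorm (y - x) <= r].

(* The infimum is +oo when h is not Lipschitz on S. *)
Definition Lip (R : realType) (d : nat) (S : set 'rV[R]_d)
    (h : 'rV[R]_d -> R) : \bar R :=
  ereal_inf [set L%:E | L in
    [set L : R | 0 <= L /\
      forall x y, S x -> S y -> `|h x - h y| <= L * enorm (x - y)]].

(* f is of class C^k on the open set U *)
Fixpoint Ck_on (R : realType) (d k : nat) (U : set 'rV[R]_d)
    (f : 'rV[R]_d -> R) : Prop :=
  match k with
  | 0 => forall x, U x -> {for x, continuous f}
  | k'.+1 => (forall x, U x -> differentiable f x) /\
             forall v, Ck_on k' U ('D_v f)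
  end.

Definition smooth_on (R : realType) (d : nat) (U : set 'rV[R]_d)
    (f : 'rV[R]_d -> R) : Prop := forall k, Ck_on k U f.

Definition strictly_convex_on (R : realType) (d : nat) (U : set 'rV[R]_d)
    (f : 'rV[R]_d -> R) : Prop :=
  forall (x y : 'rV[R]_d) (t : R), U x -> U y -> x <> y -> 0 < t < 1 ->
    f ((1 - t) *: x + t *: y) < (1 - t) * f x + t * f y.

Definition strongly_convex_C2_on (R : realType) (d : nat) (V : set 'rV[R]_d)
    (phi : 'rV[R]_d -> R) : Prop :=
  Ck_on 2 V phi /\
  forall (x v : 'rV[R]_d) (t : R), v <> 0 -> V (x + t *: v) ->
    0 < derive1n 2 (fun s : R => phi (x + s *: v)) t.

(* V is required to be convex so that convexity of f - phi on V makes sense;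
   this loses nothing, since V may be shrunk to a ball. *)
Definition strongly_convex_on (R : realType) (d : nat) (U : set 'rV[R]_d)
    (f : 'rV[R]_d -> R) : Prop :=
  forall p, U p -> exists V : set 'rV[R]_d,
    [/\ open V, V p, V `<=` U, convex_set V &
      exists2 phi : 'rV[R]_d -> R, strongly_convex_C2_on V phi &
        convex_function V (fun x => f x - phi x)].

(* Main.v *)
Require Import Defs.
From HB Require Import structures.
From mathcomp Require Import all_boot all_order all_algebra.
From mathcomp Require Import all_classical all_reals all_analysis.
From mathcomp Require Import ring lra.
Import Order.TTheory GRing.Theory Num.Theory.
Import numFieldNormedType.Exports.
Local Open Scope classical_set_scope.
Local Open Scope ring_scope.

(* Call q a support of f at x if f x + <q, y - x> <= f y for all y in U. By the
   mean value theorem, a smooth g such that |grad g x| <= |q| for every support q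
   of f at every x preserves the local Lipschitz constants. Such a g is a locally
   finite smooth maximum of slightly modified affine minorants of f.

   Let r0 be the infimum of the lengths of the slopes of the affine minorants. A
   minorant a of slope length nu > r0 is replaced by
     (1 - lam U(nu)) a + lam t(nu) - phi(nu),
   where t(nu) is a combination, of total weight U(nu), of minorants with slopes
   shorter than nu, and phi is a small increasing function. This shortens the
   slopes, by a definite amount as long as nu stays away from r0, and lowers a
   minorant more than the supports of f of shorter slope. Therefore a modified
   minorant that is nearly maximal at x is not steeper than the supports of f at
   x, and this is not affected by the small errors made when the supremum is
   replaced by smooth maxima over finite nets on the sets of an exhaustion of U.
   A second gluing over lam -> 0 makes up for the fact that f - a is only locally
   bounded.

   For strictly convex f, the difference of f and one of its supports grows
   linearly, which leaves room for strongly convex perturbations of the pieces. A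
   support of length r0 then can only be 0; in this case f has a minimum, where a
   sufficiently flat smooth strictly convex well is used as an additional piece. *)

(** * Euclidean norm *)

(** The slope of g at x must not exceed that of any support of f at x, but the pieces of g are
    selected on compact sets, without knowledge of x. Exact comparisons of slopes would not survive
    smoothing, so the aim is a uniform margin mu: for every x and every support q at x, a selected
    piece is either shorter than q by mu or lower than the supremum by mu. Slopes near r0 leave no
    room for this, whence the cases. If no affine minorant has slope length r0, the values at x of
    those of slope near r0 tend to minus infinity. If one has, but no support does, mixing it with a
    little of a support wins: the gain is linear in the weight, the increase of phi only quadratic.
    If a support has length r0, the least minorant, or a well in the strict case, is kept as a
    separate piece. Strong convexity is carried by [locally_sconvex], a chord inequality that passes
    through smooth maxima; second derivatives enter only when f is read and when g is returned. The
    factor 1 + eps makes the larger ball a neighbourhood of the closed ball, which bounds the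
    supports at boundary points. *)

Definition dot {R : realType} {d : nat} (x y : 'rV[R]_d) : R :=
  \sum_(i < d) x ord0 i * y ord0 i.

Section euclidean.
Context {R : realType} {d : nat}.
Local Notation V := 'rV[R]_d.
Implicit Types (x y z p v : V) (a : R).

Lemma dotC x y : dot x y = dot y x.
Proof. by apply: eq_bigr => i _; rewrite mulrC. Qed.

Lemma dotDl x y z : dot (x + y) z = dot x z + dot y z.
Proof. by rewrite -big_split; apply: eq_bigr => i _; rewrite mxE mulrDl. Qed.

Lemma dotDr x y z : dot z (x + y) = dot z x + dot z y.
Proof. by rewrite !(dotC z) dotDl. Qed.

Lemma dotZl a x y : dot (a *: x) y = a * dot x y.
Proof. by rewrite mulr_sumr; apply: eq_bigr => i _; rewrite mxE mulrA. Qed.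

Lemma dotZr a x y : dot y (a *: x) = a * dot y x.
Proof. by rewrite !(dotC y) dotZl. Qed.

Lemma dotNl x y : dot (- x) y = - dot x y.
Proof. by rewrite -scaleN1r dotZl mulN1r. Qed.

Lemma dotNr x y : dot y (- x) = - dot y x.
Proof. by rewrite !(dotC y) dotNl. Qed.

Lemma dot0l y : dot 0 y = 0.
Proof. by rewrite -(scale0r 0) dotZl mul0r. Qed.

Lemma dotxx_ge0 x : 0 <= dot x x.
Proof. by apply: sumr_ge0 => i _; rewrite -expr2 sqr_ge0. Qed.

Lemma dotxx_eq0 x : dot x x = 0 -> x = 0.
Proof.
move/eqP; rewrite psumr_eq0; last by move=> i _; rewrite -expr2 sqr_ge0.
move=> /allP x0; apply/rowP => i; have := x0 i (mem_index_enum i).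
by rewrite -expr2 sqrf_eq0 mxE => /eqP.
Qed.

Lemma enormE x : enorm x = Num.sqrt (dot x x).
Proof. by congr Num.sqrt; apply: eq_bigr => i _; rewrite expr2. Qed.

Lemma enorm_sq x : enorm x ^+ 2 = dot x x.
Proof. by rewrite enormE sqr_sqrtr// dotxx_ge0. Qed.

Lemma enorm_ge0 x : 0 <= enorm x.
Proof. exact: sqrtr_ge0. Qed.

Lemma enorm0 : enorm (0 : V) = 0.
Proof. by rewrite enormE dot0l sqrtr0. Qed.

Lemma enorm_eq0 x : enorm x = 0 -> x = 0.
Proof. by move=> x0; apply: dotxx_eq0; rewrite -enorm_sq x0 expr0n. Qed.

Lemma enorm_gt0 x : x <> 0 -> 0 < enorm x.
Proof.
move=> x0; rewrite lt_neqAle enorm_ge0 andbT eq_sym.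
by apply/eqP => /enorm_eq0.
Qed.

Lemma enormZ a x : enorm (a *: x) = `|a| * enorm x.
Proof.
by rewrite !enormE dotZl dotZr mulrA -expr2 sqrtrM ?sqr_ge0// sqrtr_sqr.
Qed.

Lemma enormN x : enorm (- x) = enorm x.
Proof. by rewrite -scaleN1r enormZ normrN1 mul1r. Qed.

Lemma enormB x y : enorm (x - y) = enorm (y - x).
Proof. by rewrite -enormN opprB. Qed.

Lemma dot_enorm x y : dot x y <= enorm x * enorm y.
Proof.
have [y0|y0] := eqVneq (dot y y) 0.
  by rewrite (dotxx_eq0 _ y0) dotC dot0l enorm0 mulr0.
have {}y0 : 0 < dot y y by rewrite lt_neqAle eq_sym y0 dotxx_ge0.
have := dotxx_ge0 (dot y y *: x - dot x y *: y).
rewrite !(dotDl, dotDr, dotNl, dotNr, dotZl, dotZr) (dotC y x).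
rewrite [X in 0 <= X](_ : _ = dot y y * (dot x x * dot y y - dot x y ^+ 2)); last by ring.
rewrite pmulr_rge0// subr_ge0 -!enorm_sq -exprMn => h.
have e0 : 0 <= enorm x * enorm y by rewrite mulr_ge0 ?enorm_ge0.
rewrite leNgt; apply/negP => lt.
have : (enorm x * enorm y) ^+ 2 < dot x y ^+ 2 by rewrite ltr_pXn2r ?nnegrE// ltW// (le_lt_trans e0).
by rewrite ltNge h.
Qed.

Lemma normr_dot_enorm x y : `|dot x y| <= enorm x * enorm y.
Proof.
rewrite ler_norml dot_enorm andbT lerNl -dotNl.
by rewrite (le_trans (dot_enorm _ _))// enormN.
Qed.

Lemma ler_enormD x y : enorm (x + y) <= enorm x + enorm y.
Proof.
have e0 : 0 <= enorm x + enorm y by rewrite addr_ge0 ?enorm_ge0.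
rewrite -(@ler_pXn2r _ 2)// ?nnegrE ?enorm_ge0//.
rewrite enorm_sq sqrrD !enorm_sq !(dotDl, dotDr) (dotC y x).
have := dot_enorm x y; lra.
Qed.

Lemma ler_coord_enorm x i : `|x ord0 i| <= enorm x.
Proof.
rewrite -(@ler_pXn2r _ 2)// ?nnegrE ?enorm_ge0// enorm_sq -normrX ger0_norm ?sqr_ge0//.
by rewrite /dot (bigD1 i)//= -expr2 lerDl sumr_ge0// => j _; rewrite -expr2 sqr_ge0.
Qed.

Lemma ler_coord_norm x i : `|x ord0 i| <= `|x|.
Proof.
rewrite [leRHS]/Num.norm /= mx_normrE.
by apply/bigmax_geP; right => /=; exists (ord0, i).
Qed.

Lemma ler_norm_enorm x : `|x| <= enorm x.
Proof.
rewrite [leLHS]/Num.norm /= mx_normrE; apply/bigmax_leP; split; first exact: enorm_ge0.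
by case=> i j _ /=; rewrite ord1 ler_coord_enorm.
Qed.

Lemma enorm_le_sum x : enorm x <= \sum_(i < d) `|x ord0 i|.
Proof.
rewrite -(@ler_pXn2r _ 2)// ?nnegrE ?enorm_ge0 ?sumr_ge0//.
rewrite enorm_sq expr2 mulr_suml; apply: ler_sum => i _.
rewrite -expr2 -[leLHS]ger0_norm ?sqr_ge0// normrX expr2 ler_wpM2l//.
by rewrite (bigD1 i)//= lerDl sumr_ge0.
Qed.

Lemma enorm_le_norm x : enorm x <= d%:R * `|x|.
Proof.
apply: (le_trans (enorm_le_sum x)).
apply: (@le_trans _ _ (\sum_(i < d) `|x|)).
  by apply: ler_sum => i _; exact: ler_coord_norm.
by rewrite sumr_const card_ord mulr_natl.
Qed.

Lemma ler_dist_enorm x y : `|enorm x - enorm y| <= enorm (x - y).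
Proof.
rewrite ler_norml lerNl opprB !lerBlDr.
have := ler_enormD (x - y) y; rewrite subrK => h1.
have := ler_enormD (y - x) x; rewrite subrK (enormB y x) => h2.
by apply/andP; split.
Qed.

Lemma continuous_of_lip (f : V -> R) x (L : R) :
  (\forall y \near x, `|f x - f y| <= L * enorm (x - y)) -> {for x, continuous f}.
Proof.
move=> fL; apply/(@cvgrPdist_le _ R^o V (nbhs x)) => e e0.
pose M := `|L| * d%:R + 1.
have M0 : 0 < M by rewrite ltr_wpDl// mulr_ge0.
have yM : \forall y \near x, `|x - y| <= e / M.
  apply/nbhs_normP; exists (e / M); first by rewrite /= divr_gt0.
  by move=> z /ltW.
apply: filterS2 fL yM => y yL yx.
apply: (le_trans yL); apply: (@le_trans _ _ (`|L| * (d%:R * `|x - y|))).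
  apply: (@le_trans _ _ (`|L| * enorm (x - y))).
    by rewrite ler_wpM2r ?enorm_ge0 ?ler_norm.
  by rewrite ler_wpM2l ?enorm_le_norm.
rewrite mulrA; apply: (@le_trans _ _ (M * (e / M))).
  by rewrite ler_pM ?mulr_ge0// lerDl.
by rewrite mulrCA divff ?gt_eqF// mulr1.
Qed.

Lemma continuous_enorm : continuous (@enorm R d).
Proof.
move=> x; apply: (@continuous_of_lip _ _ 1); apply: filterE => y.
by rewrite mul1r ler_dist_enorm.
Qed.

Lemma continuous_dotr p : continuous (dot p).
Proof.
move=> x; apply: (@continuous_of_lip _ _ (enorm p)); apply: filterE => y.
by rewrite -dotNr -dotDr normr_dot_enorm.
Qed.

(** Near-covering compactness is applied to the filter of right neighbourhoods of 0; monotonicity in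
    [e] lets a constant found at one point serve for all smaller ones. *)
Lemma compact_unif (K : set V) (P : R -> V -> Prop) : compact K ->
  (forall e e' x, 0 < e' -> e' <= e -> P e x -> P e' x) ->
  (forall x, K x -> exists2 e, 0 < e & \forall y \near x, P e y) ->
  exists2 e, 0 < e & forall x, K x -> P e x.
Proof.
move=> /compact_near_coveringP cK mono loc.
have /filter_ex : \forall e \near at_right (0 : R), 0 < e /\ K `<=` P e.
  apply: filterI; first exact: nbhs_right_gt.
  apply: (cK R (at_right 0) P _) => x /loc[e e0 xe]; exists (P e, [set e' | 0 < e' <= e]) => /=.
    split=> //; near=> e' => /=; apply/andP; split=> //.
    by near: e'; exact: nbhs_right_le.
  by move=> [y e'] /= [Pey /andP[e'0 e'e]]; exact: mono Pey.
by move=> [e [e0 KP]]; exists e.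
Unshelve. all: by end_near. Qed.

End euclidean.

(** * Functions of class C^k *)

Section Ck.
Context {R : realType} {d : nat}.
Local Notation V := 'rV[R]_d.
Implicit Types (U W : set V) (f g h : V -> R) (k : nat).

(** The difference [g - f] vanishes near x, so it is differentiable there with differential 0, and
    [g = f + (g - f)]. *)
Lemma differentiable_near_eq f g (x : V) :
  (\forall y \near x, f y = g y) -> differentiable f x -> differentiable g x.
Proof.
move=> fg df.
have e0 : \forall h \near (0 : V), (g - f) (h + x) = 0.
  rewrite (near_shift x) /=; apply: filterS fg => y fgy /=.
  by rewrite !fctE /= sub0r addrNK fgy subrr.
have lin0 : (g - f) \o shift x = cst ((g - f) x) + (0 : V -> R) +o_ (0 : V) id.
  apply/eqaddoP => _/posnumP[e]; apply: filterS e0 => h /= he.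
  have e1 : (g - f) x = 0 by rewrite !fctE (nbhs_singleton fg) subrr.
  rewrite (_ : _ h = 0) ?normr0 ?mulr_ge0//.
  transitivity ((g - f) (h + x) - ((g - f) x + 0)); first by [].
  by rewrite he e1 addr0 subrr.
have d0 : differentiable (g - f) x.
  apply/diff_locallyP.
  have -> : 'd (g - f) x = 0 :> (V -> R) by apply: diff_unique lin0 => ?; exact: cst_continuous.
  by split=> // ?; exact: cst_continuous.
have -> : g = f + (g - f) by apply/funext => y; rewrite !fctE addrC subrK.
exact: differentiableD.
Qed.

(** Derivatives depend only on germs. A glued function coincides near each point with some finite
    stage, but the stage varies with the point. *)
Lemma Ck_on_local k U g :
  (forall x, U x -> exists W h, [/\ open W, W x, forall y, W y -> h y = g y
     & Ck_on k W h]) -> Ck_on k U g.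
Proof.
elim: k U g => [|k IH] U g loc.
  move=> x Ux; have [W [h [oW Wx hg Ch]]] := loc x Ux.
  have nhg : \forall y \near x, h y = g y.
    by apply: (filterS hg); exact: open_nbhs_nbhs.
  have hx : h x = g x := nbhs_singleton nhg.
  have : h @ x --> h x by exact: Ch.
  rewrite hx => ch; suff : g @ x --> g x by [].
  by apply: cvg_trans ch; exact: (near_eq_cvg nhg).
split.
  move=> x /loc[W [h [oO Ox hg [dh _]]]].
  apply: differentiable_near_eq (dh x Ox).
  by apply: (filterS hg); exact: open_nbhs_nbhs.
move=> v; apply: IH => x /loc[W [h [oO Ox hg [_ Dh]]]].
exists W, ('D_v h); split=> [||y Oy|]; [by []|by []| |exact: Dh]; apply: near_eq_derive.
by apply: (filterS hg); exact: open_nbhs_nbhs.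
Qed.

Lemma Ck_on_eq k U f g : open U -> (forall x, U x -> f x = g x) ->
  Ck_on k U f -> Ck_on k U g.
Proof. by move=> oU fg Cf; apply: Ck_on_local => x Ux; exists U, f. Qed.

Lemma Ck_on_sub k U W f : W `<=` U -> Ck_on k U f -> Ck_on k W f.
Proof.
elim: k f => [|k IH] f OU; first by move=> Cf x /OU; exact: Cf.
by move=> [df Df]; split=> [x /OU|v]; [exact: df|apply: IH => //; exact: Df].
Qed.

Lemma Ck_on_cst k U (a : R) : Ck_on k U (cst a).
Proof.
elim: k a => [|k IH] a; first by move=> x _; exact: cst_continuous.
split=> [x _|v]; first exact: differentiable_cst.
have -> : 'D_v (cst a) = cst 0 :> (V -> R) by apply/funext => x; exact: derive_cst.
exact: IH.
Qed.

Lemma Ck_onS k U f : Ck_on k.+1 U f -> Ck_on k U f.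
Proof.
elim: k f => [|k IH] f [df Df]; last first.
  by split=> // v; apply: IH; exact: Df.
by move=> x Ux; apply: differentiable_continuous; exact: df.
Qed.

Lemma Ck_on_add k U f g : open U -> Ck_on k U f -> Ck_on k U g ->
  Ck_on k U (fun x => f x + g x).
Proof.
move=> oU; elim: k f g => [|k IH] f g.
  by move=> Cf Cg x Ux; apply: continuousD; [exact: Cf|exact: Cg].
move=> [df Df] [dg Dg]; split=> [x Ux|v].
  by apply: differentiableD; [exact: df|exact: dg].
apply: (@Ck_on_eq _ _ (fun x => 'D_v f x + 'D_v g x)) => //; last by apply: IH; [exact: Df|exact: Dg].
move=> x Ux; apply/esym/deriveD; apply: diff_derivable; [exact: df|exact: dg].
Qed.

Lemma Ck_on_mul k U f g : open U -> Ck_on k U f -> Ck_on k U g ->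
  Ck_on k U (fun x => f x * g x).
Proof.
move=> oU; elim: k f g => [|k IH] f g.
  by move=> Cf Cg x Ux; apply: continuousM; [exact: Cf|exact: Cg].
move=> Cf Cg; have [df Df] := Cf; have [dg Dg] := Cg; split=> [x Ux|v].
  by apply: differentiableM; [exact: df|exact: dg].
apply: (@Ck_on_eq _ _ (fun x => f x * 'D_v g x + g x * 'D_v f x)) => //.
  move=> x Ux; apply/esym/deriveM; apply: diff_derivable; [exact: df|exact: dg].
apply: Ck_on_add => //; apply: IH; try exact: Ck_onS; [exact: Dg|exact: Df].
Qed.

Lemma smooth_on_add U f g : open U -> smooth_on U f -> smooth_on U g ->
  smooth_on U (fun x => f x + g x).
Proof. by move=> oU sf sg k; exact: Ck_on_add. Qed.

Lemma smooth_on_mul U f g : open U -> smooth_on U f -> smooth_on U g ->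
  smooth_on U (fun x => f x * g x).
Proof. by move=> oU sf sg k; exact: Ck_on_mul. Qed.

Lemma smooth_on_cst U (a : R) : smooth_on U (cst a).
Proof. by move=> k; exact: Ck_on_cst. Qed.

Lemma smooth_on_scale U a f : open U -> smooth_on U f ->
  smooth_on U (fun x => a * f x).
Proof. by move=> oU sf; apply: smooth_on_mul => //; exact: smooth_on_cst. Qed.

Lemma smooth_on_sum U n (F : 'I_n -> V -> R) : open U ->
  (forall i, smooth_on U (F i)) -> smooth_on U (fun x => \sum_(i < n) F i x).
Proof.
move=> oU; elim: n F => [|n IH] F sF.
  by rewrite (_ : (fun _ => _) = cst 0); [exact: smooth_on_cst|
    apply/funext => x; rewrite big_ord0].
rewrite (_ : (fun _ => _) =
  (fun x => \sum_(i < n) F (widen_ord (leqnSn n) i) x + F ord_max x)).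
  by apply: smooth_on_add => //; exact: IH.
by apply/funext => x; rewrite big_ord_recr.
Qed.

Let dot_diff (p x : V) :
  differentiable (dot p) x /\ forall v, 'D_v (dot p) x = dot p v.
Proof.
have lin : linear (dot p) by move=> a y z; rewrite dotDr dotZr.
pose L : {linear V -> R} := HB.pack (dot p) (GRing.isLinear.Build _ _ _ _ _ lin).
have dL : differentiable (dot p) x.
  by apply: (@linear_differentiable _ _ _ L); exact: continuous_dotr.
split=> // v; rewrite deriveE//.
by rewrite (@diff_lin _ _ _ L)//; exact: continuous_dotr.
Qed.

Lemma differentiable_dot (p x : V) : differentiable (dot p) x.
Proof. exact: (dot_diff p x).1. Qed.

Lemma derive_dot (p x v : V) : 'D_v (dot p) x = dot p v.
Proof. exact: (dot_diff p x).2. Qed.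

Lemma smooth_on_dot U (p : V) : smooth_on U (dot p).
Proof.
case=> [|k]; first by move=> x _; exact: continuous_dotr.
split=> [x _|v]; first exact: differentiable_dot.
rewrite (_ : 'D_v _ = cst (dot p v)); first exact: Ck_on_cst.
by apply/funext => x; exact: derive_dot.
Qed.

End Ck.

(** The derivative is an existential witness, so that closed formulas such as [flat (flat_deriv p)],
    or sums of series, can be supplied directly. *)
Fixpoint Ck1 {R : realType} (k : nat) (F : R -> R) : Prop :=
  match k with
  | 0 => continuous F
  | k'.+1 => exists2 F' : R -> R, (forall t : R, is_derive t (1 : R) F (F' t)) & Ck1 k' F'
  end.

Definition smooth1 {R : realType} (F : R -> R) := forall k, Ck1 k F.

Section Ck1.
Context {R : realType}.
Implicit Types (F G : R -> R) (k : nat).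

Lemma is_derive1_continuous F F' : (forall t : R, is_derive t (1 : R) F (F' t)) ->
  continuous F.
Proof.
by move=> dF t; apply/differentiable_continuous/derivable1_diffP; have [] := dF t.
Qed.

Lemma Ck1S k F : Ck1 k.+1 F -> Ck1 k F.
Proof.
elim: k F => [|k IH] F [F' dF CF']; first exact: is_derive1_continuous dF.
by exists F' => //; exact: IH.
Qed.

Lemma Ck1_cst k (a : R) : Ck1 k (cst a).
Proof.
elim: k a => [|k IH] a; first exact: cst_continuous.
by exists (cst 0) => // t; exact: is_derive_cst.
Qed.

Lemma Ck1_add k F G : Ck1 k F -> Ck1 k G -> Ck1 k (fun t => F t + G t).
Proof.
elim: k F G => [|k IH] F G.
  by move=> cF cG t; apply: continuousD; [exact: cF|exact: cG].
move=> [F' dF CF] [G' dG CG]; exists (fun t => F' t + G' t); last exact: IH.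
by move=> t; have := dF t; have := dG t => dG' dF'; exact: is_deriveD.
Qed.

Lemma Ck1_mul k F G : Ck1 k F -> Ck1 k G -> Ck1 k (fun t => F t * G t).
Proof.
elim: k F G => [|k IH] F G.
  by move=> cF cG t; apply: continuousM; [exact: cF|exact: cG].
move=> CF1 CG1; have [F' dF CF] := CF1; have [G' dG CG] := CG1.
exists (fun t => F t * G' t + G t * F' t).
  by move=> t; have dF' := dF t; have dG' := dG t; exact: is_deriveM.
by apply: Ck1_add; apply: IH => //; exact: Ck1S.
Qed.

Lemma Ck1_inv k F : (forall t, F t != 0) -> Ck1 k F -> Ck1 k (fun t => (F t)^-1).
Proof.
move=> F0; elim: k F F0 => [|k IH] F F0.
  by move=> cF t; apply: cvgV => //; exact: cF.
move=> CF1; have [F' dF CF] := CF1.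
exists (fun t => - 1 * (F' t * ((F t)^-1 * (F t)^-1))).
  move=> t; have [DF <-] := dF t; apply: DeriveDef; first exact: derivableV.
  by rewrite deriveV// mulN1r scaleNr /GRing.scale/= expr2 invfM mulrC.
apply: Ck1_mul; first exact: Ck1_cst.
apply: Ck1_mul => //; apply: Ck1_mul; apply: IH => //; exact: Ck1S.
Qed.

Lemma is_derive_affine F (F' a b t : R) : is_derive (a * t + b) (1 : R) F F' ->
  is_derive t (1 : R) (fun s => F (a * s + b)) (a * F').
Proof.
move=> dF.
have dA : is_derive t (1 : R) (fun s => a * s + b) a.
  have -> : (fun s => a * s + b) = (a *: id + cst b) by [].
  by apply: is_derive_eq; rewrite /GRing.scale /= mulr1 addr0.
by rewrite [a * F']mulrC; exact: (@is_derive1_comp R F (fun s => a * s + b)).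
Qed.

Lemma Ck1_affine k F (a b : R) : Ck1 k F -> Ck1 k (fun t => F (a * t + b)).
Proof.
elim: k F => [|k IH] F.
  move=> cF t; apply: (@continuous_comp _ _ _ (fun s => a * s + b) F).
    by apply: continuousD; [apply: continuousM; [exact: cst_continuous|exact: cvg_id]
      |exact: cst_continuous].
  exact: cF.
move=> [F' dF CF]; exists (fun t => a * F' (a * t + b)).
  by move=> t; apply: is_derive_affine; exact: dF.
apply: Ck1_mul; [exact: Ck1_cst|exact: IH].
Qed.

Lemma Ck1_scale k F (a : R) : Ck1 k F -> Ck1 k (fun t => a * F t).
Proof. by apply: Ck1_mul; exact: Ck1_cst. Qed.

End Ck1.

Section Ck_comp.
Context {R : realType} {d : nat}.
Implicit Types (U : set 'rV[R]_d) (f : 'rV[R]_d -> R).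

Lemma is_derive_comp1 (F : R -> R) f (F' : R) x v : differentiable f x ->
  is_derive (f x) (1 : R) F F' -> is_derive x v (fun y => F (f y)) (F' * 'D_v f x).
Proof.
move=> df [DF <-].
have dF : differentiable F (f x) by exact/derivable1_diffP.
have dc : differentiable (F \o f) x by exact: differentiable_comp.
apply: DeriveDef; first exact: diff_derivable.
rewrite (_ : (fun _ => _) = F \o f)// deriveE// diff_comp//= deriv1E//.
rewrite derive1E [in RHS](@deriveE _ _ _ f x v)//. by rewrite /GRing.scale/= mulrC.
Qed.

Lemma Ck_on_comp k U F f : open U -> Ck1 k F -> Ck_on k U f ->
  Ck_on k U (fun x => F (f x)).
Proof.
move=> oU; elim: k F f => [|k IH] F f.
  move=> cF cf x Ux; apply: (@continuous_comp _ _ _ f F); first exact: cf.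
  exact: cF.
move=> CF1 Cf1; have [F' dF CF] := CF1; have [df Df] := Cf1; split=> [x Ux|v].
  apply: (@differentiable_comp _ _ _ _ f F); first exact: df.
  by apply/derivable1_diffP; have [] := dF (f x).
apply: (@Ck_on_eq _ _ _ _ (fun x => F' (f x) * 'D_v f x)) => //.
  by move=> x Ux; have [_ ->] := is_derive_comp1 F f _ _ v (df x Ux) (dF (f x)).
apply: Ck_on_mul => //; last exact: Df.
by apply: IH => //; exact: Ck_onS.
Qed.

Lemma smooth_on_comp U F f : open U -> smooth1 F -> smooth_on U f ->
  smooth_on U (fun x => F (f x)).
Proof. by move=> oU sF sf k; apply: Ck_on_comp. Qed.

End Ck_comp.

(** * Smooth functions of one variable *)

(** [flat 1] is the classical exp(-1/t); polynomial factors in 1/t close the family under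
    differentiation, so that smoothness follows by a single induction. *)
Definition flat {R : realType} (p : {poly R}) (t : R) : R :=
  if t <= 0 then 0 else p.[t^-1] * expR (- t^-1).

Lemma is_derive_of_sq {R : realType} (F : R -> R) (t D C : R) :
  (forall h, `|F (t + h) - F t - h * D| <= C * h ^+ 2) ->
  is_derive t (1 : R) F D.
Proof.
move=> FC.
have cv : (fun h => h^-1 *: (F (h *: 1 + t) - F t)) @ (0 : R)^' --> D.
  apply/cvgrPdist_le => e e0; near=> h.
  have h0 : h != 0 by near: h; exact: nbhs_dnbhs_neq.
  have hC : `|h| <= e / (`|C| + 1).
    by near: h; apply: dnbhs0_le; rewrite divr_gt0// ltr_wpDl.
  rewrite /GRing.scale/= mulr1 (addrC h).
  rewrite (_ : D - _ = - h^-1 * (F (t + h) - F t - h * D)); last by field.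
  rewrite normrM normrN normfV ler_pdivrMl ?normr_gt0//.
  apply: (le_trans (FC h)).
  apply: (@le_trans _ _ (`|h| * ((`|C| + 1) * `|h|))).
    rewrite [leRHS](_ : _ = (`|C| + 1) * `|h| ^+ 2); last by ring.
    rewrite -normrX [`|h ^+ 2|]ger0_norm ?sqr_ge0//.
    by rewrite ler_wpM2r ?sqr_ge0// (le_trans (ler_norm _))// lerDl.
  by rewrite ler_wpM2l// mulrC -ler_pdivlMr// ltr_wpDl.
apply: DeriveDef; first by apply/cvg_ex; exists D.
by rewrite /derive; apply/cvg_lim.
Unshelve. all: by end_near. Qed.

Section flat.
Context {R : realType}.
Implicit Types (p : {poly R}) (t : R).

Lemma poly_expR_bounded p :
  exists2 B : R, 0 <= B & forall y : R, 0 <= y -> `|p.[y]| * expR (- y) <= B.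
Proof.
have mono n (y : R) : 0 <= y -> y ^+ n * expR (- y) <= n`!%:R.
  move=> y0; rewrite expRN ler_pdivrMr ?expR_gt0//.
  case: n => [|n]; first by rewrite fact0 mul1r expr0 -(expR0 R) ler_expR.
  have := expR_ge1Dxn n y0; have := fact_gt0 n.+1 => f0 h.
  have : y ^+ n.+1 / n.+1`!%:R <= expR y by apply: le_trans h; rewrite lerDr.
  by rewrite ler_pdivrMr ?ltr0n// mulrC.
exists (\sum_(i < size p) `|p`_i| * i`!%:R).
  by apply: sumr_ge0 => i _; rewrite mulr_ge0.
move=> y y0; rewrite horner_coef.
apply: (@le_trans _ _ ((\sum_(i < size p) `|p`_i * y ^+ i|) * expR (- y))).
  by rewrite ler_wpM2r ?expR_ge0// ler_norm_sum.
rewrite mulr_suml; apply: ler_sum => i _.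
by rewrite normrM normrX (ger0_norm y0) -mulrA ler_wpM2l// mono.
Qed.

Lemma flat_bounded p : exists2 B : R, 0 <= B & forall t, `|flat p t| <= B.
Proof.
have [B B0 pB] := poly_expR_bounded p; exists B => // t.
rewrite /flat; case: (leP t 0) => t0; first by rewrite normr0.
by rewrite normrM (ger0_norm (expR_ge0 _)) pB// invr_ge0 ltW.
Qed.

(** For positive t, dividing [flat p t] by [t ^+ 2] gives [flat ('X^2 * p) t], which is bounded
    again. This settles the derivative at 0. *)
Lemma flat_sq p : exists2 B : R, 0 <= B & forall t, `|flat p t| <= B * t ^+ 2.
Proof.
have [B B0 pB] := flat_bounded ('X^2 * p); exists B => // t.
have := pB t; rewrite /flat; case: (leP t 0) => t0.
  by rewrite normr0 mulr_ge0// sqr_ge0.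
rewrite hornerM hornerXn -mulrA normrM exprVn normfV [`|t ^+ 2|]ger0_norm ?sqr_ge0//.
by rewrite ler_pdivrMl ?exprn_gt0// [B * _]mulrC.
Qed.

Definition flat_deriv p := 'X^2 * (p - p^`()).

Lemma is_derive_flat p (t : R) :
  is_derive t (1 : R) (flat p) (flat (flat_deriv p) t).
Proof.
have [t0|t0|->] := ltgtP t 0.
- have n0 : \near t, (cst 0 : R -> R) t = flat p t.
    near=> s; rewrite /flat ifT// ltW//; near: s; exact: lt_nbhsl.
  by apply: (near_eq_is_derive n0); rewrite /flat ltW//; exact: is_derive_cst.
- have n0 : \near t, ((horner p \o GRing.inv) * (expR \o (fun s : R => - s^-1))) t = flat p t.
    near=> s; rewrite /flat ifF//; apply/negbTE; rewrite -ltNge; near: s.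
    exact: lt_nbhsr.
  apply: (near_eq_is_derive n0).
  have tn0 : t != 0 by rewrite gt_eqF.
  have dI : is_derive t (1 : R) (fun s : R => s^-1) (- t ^- 2).
    apply: DeriveDef; first by apply: derivableV => //; exact: derivable_id.
    by rewrite deriveV// ?derive_id /GRing.scale/= ?mulr1//; exact: derivable_id.
  have dN : is_derive t (1 : R) (fun s : R => - s^-1) (t ^- 2).
    by rewrite -[t ^- 2]opprK; exact: is_deriveN.
  have d1 := is_derive1_comp (is_derive_poly p t^-1) dI.
  have d2 := @is_derive1_comp R expR (fun s : R => - s^-1) t _ _ (is_derive_expR (- t^-1)) dN.
  have d3 := is_deriveM d1 d2; apply: is_derive_eq.
  rewrite /flat leNgt t0/= /flat_deriv hornerM hornerXn hornerD hornerN /GRing.scale /=.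
  by rewrite exprVn; ring.
- have [B B0 pB] := flat_sq p.
  have f0 q : flat q 0 = 0 by rewrite /flat lexx.
  apply: (@is_derive_of_sq _ _ _ _ B) => h.
  by rewrite !f0 mulr0 !subr0 add0r.
Unshelve. all: by end_near. Qed.

Lemma flat_smooth p : smooth1 (flat p).
Proof.
move=> k; elim: k p => [|k IH] p.
  exact: is_derive1_continuous (is_derive_flat p).
by exists (flat (flat_deriv p)); [exact: is_derive_flat|exact: IH].
Qed.

Lemma flat1E t : flat 1 t = if t <= 0 then 0 else expR (- t^-1).
Proof. by rewrite /flat hornerC mul1r. Qed.

Lemma flat1_ge0 t : 0 <= flat 1 t.
Proof. by rewrite flat1E; case: ifP => // _; exact: expR_ge0. Qed.

Lemma flat1_gt0 t : 0 < t -> 0 < flat 1 t.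
Proof. by move=> t0; rewrite flat1E leNgt t0/= expR_gt0. Qed.

Lemma flat1_le0 t : t <= 0 -> flat 1 t = 0.
Proof. by move=> t0; rewrite flat1E t0. Qed.

Lemma flat1_homo : {homo (flat 1 : R -> R) : s t / s <= t}.
Proof.
move=> s t st; have [s0|s0] := leP s 0; first by rewrite flat1_le0 ?flat1_ge0.
have t0 := lt_le_trans s0 st.
by rewrite !flat1E (lt_geF s0) (lt_geF t0) ler_expR lerN2 lef_pV2.
Qed.

End flat.

Section antiderivative.
Context {R : realType}.
Local Notation mu := (@lebesgue_measure R).

Lemma antiderivative_ex (s : R -> R) : continuous s ->
  (forall t, t <= 0 -> s t = 0) ->
  exists2 m : R -> R, (forall t : R, is_derive t (1 : R) m (s t)) &
    forall t, t <= 0 -> m t = 0.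
Proof.
move=> cs s0.
(* Starting the integral at -1 puts the point 0 strictly to the right of the base point, where the
   fundamental theorem applies; the values do not change, since [s] vanishes up to 0. *)
pose m (t : R) := (\int[mu]_(x in [set` `[-1, t]]) (s x))%R.
have m0 t : t <= 0 -> m t = 0.
  move=> t0; rewrite /m (@eq_Rintegral _ _ _ mu _ (cst 0)).
    by rewrite Rintegral_cst//= ?mul0r//; exact: measurable_itv.
  by move=> x; rewrite inE/= in_itv/= => /andP[_ xt]; rewrite s0// (le_trans xt).
exists m => // t; have [t0|t0] := ltP t 0.
  have n0 : \near t, (cst 0 : R -> R) t = m t.
    by near=> x; rewrite m0// ltW//; near: x; exact: lt_nbhsl.
  by apply: (near_eq_is_derive n0); rewrite s0 ?ltW//; exact: is_derive_cst.
have [] := @continuous_FTC1_closed R s (-1) t (t + 1).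
- by rewrite ltrDl.
- apply: continuous_compact_integrable; first exact: segment_compact.
  by apply: continuous_subspaceT.
- by rewrite (lt_le_trans _ t0)// ltrN10.
- exact: cs.
by move=> dm mE; apply: DeriveDef => //; rewrite -derive1E.
Unshelve. all: by end_near. Qed.

End antiderivative.

(** * Tangent and chord inequalities for functions of one variable *)

Section tangent.
Context {R : realType}.
Implicit Types (F : R -> R) (s t : R).

Lemma MVT1_in F F' s t : (forall u : R, s <= u <= t -> is_derive u (1 : R) F (F' u)) ->
  s <= t -> exists2 u, s <= u <= t & F t - F s = F' u * (t - s).
Proof.
move=> dF st.
have [x||u + ->] := @MVT_segment R F F' s t st.
- by rewrite in_itv/= => /andP[/ltW sx /ltW xt]; apply: dF; rewrite sx.
- apply: derivable_within_continuous => x; rewrite in_itv/= => /dF[].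
  exact.
by rewrite in_itv/= => u_; exists u.
Qed.

Lemma MVT1 F F' s t : (forall u : R, is_derive u (1 : R) F (F' u)) -> s <= t ->
  exists2 u, s <= u <= t & F t - F s = F' u * (t - s).
Proof. by move=> dF; apply: MVT1_in. Qed.

Lemma tangent_le F F' (a b s t : R) :
  (forall u : R, a <= u <= b -> is_derive u (1 : R) F (F' u)) ->
  (forall u v, a <= u -> u <= v -> v <= b -> F' u <= F' v) ->
  a <= s <= b -> a <= t <= b -> F s + F' s * (t - s) <= F t.
Proof.
move=> dF mF /andP[as_ sb] /andP[at_ tb].
have [st|/ltW ts] := leP s t.
  have [|u /andP[su ut] e] := MVT1_in F F' s t _ st.
    by move=> u /andP[su ut]; apply: dF; rewrite (le_trans as_)// (le_trans ut).
  rewrite addrC -lerBrDr e ler_wpM2r ?subr_ge0//.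
  by apply: mF => //; exact: le_trans ut tb.
have [|u /andP[tu us] e] := MVT1_in F F' t s _ ts.
  by move=> u /andP[tu us]; apply: dF; rewrite (le_trans at_)// (le_trans us).
rewrite -[leRHS](subrK (F s)) addrC lerD2r -[leRHS]opprB e -[leLHS]opprK.
rewrite -mulrN opprB lerN2 ler_wpM2r ?subr_ge0//.
by apply: mF => //; exact: le_trans tu.
Qed.

Lemma ge0_derive_homo F F' : (forall u : R, is_derive u (1 : R) F (F' u)) ->
  (forall u, 0 <= F' u) -> {homo F : s t / s <= t}.
Proof.
move=> dF F0 s t st; have [u _ e] := MVT1 _ _ _ _ dF st.
by rewrite -subr_ge0 e mulr_ge0// subr_ge0.
Qed.

Lemma homo_tangent F F' s t : (forall u : R, is_derive u (1 : R) F (F' u)) ->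
  {homo F' : u v / u <= v} -> F s + F' s * (t - s) <= F t.
Proof.
move=> dF mF; pose A := `|s| + `|t|.
have sA : - A <= s <= A by rewrite -ler_norml lerDl.
have tA : - A <= t <= A by rewrite -ler_norml lerDr.
by apply: (tangent_le F F' (- A) A s t (fun u _ => dF u) _ sA tA) => u v _ uv _; exact: mF.
Qed.

Lemma homo_convex F F' s t a : (forall u : R, is_derive u (1 : R) F (F' u)) ->
  {homo F' : u v / u <= v} -> 0 <= a <= 1 ->
  F (a * s + (1 - a) * t) <= a * F s + (1 - a) * F t.
Proof.
move=> dF mF /andP[a0 a1]; set w := a * s + _.
have h1 : a * (F w + F' w * (s - w)) <= a * F s.
  by rewrite ler_wpM2l// homo_tangent.
have h2 : (1 - a) * (F w + F' w * (t - w)) <= (1 - a) * F t.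
  by rewrite ler_wpM2l ?subr_ge0// homo_tangent.
have e : a * (F' w * (s - w)) + (1 - a) * (F' w * (t - w)) = 0 by rewrite /w; ring.
lra.
Qed.

Lemma homo_strictly_convex F F' s t a : (forall u : R, is_derive u (1 : R) F (F' u)) ->
  {homo F' : u v / u < v} -> s <> t -> 0 < a < 1 ->
  F (a * s + (1 - a) * t) < a * F s + (1 - a) * F t.
Proof.
move=> dF mF st /andP[a0 a1].
have mF' : {homo F' : u v / u <= v}.
  by move=> u v; rewrite le_eqVlt => /predU1P[->//|/mF/ltW].
(* An equality at w would propagate to the midpoint of w and s. *)
set w := a * s + _; pose m := (w + s) / 2.
have h2 : F w + F' w * (t - w) <= F t by exact: homo_tangent.
have h1 : F w + F' w * (s - w) < F s.
  have ws : w <> s by rewrite /w => e; apply: st; nra.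
  have hm : F m + F' m * (s - m) <= F s by exact: homo_tangent.
  have hw : F w + F' w * (m - w) <= F m by exact: homo_tangent.
  have ms : s - m = (s - w) / 2 by rewrite /m; field.
  have mw : m - w = (s - w) / 2 by rewrite /m; field.
  rewrite ms in hm; rewrite mw in hw.
  have : 0 < (F' m - F' w) * ((s - w) / 2).
    have [ltsw|ltws|/esym//] := ltgtP s w.
      have : F' m < F' w by apply: mF; rewrite /m; lra.
      by move=> h; rewrite nmulr_rgt0; lra.
    have : F' w < F' m by apply: mF; rewrite /m; lra.
    by move=> h; rewrite pmulr_rgt0; lra.
  lra.
have h1' : a * (F w + F' w * (s - w)) < a * F s by rewrite ltr_pM2l.
have h2' : (1 - a) * (F w + F' w * (t - w)) <= (1 - a) * F t.
  by rewrite ler_wpM2l// subr_ge0 ltW.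
have e : a * (F' w * (s - w)) + (1 - a) * (F' w * (t - w)) = 0 by rewrite /w; ring.
lra.
Qed.

(** Subtracting [c * u ^+ 2] leaves a function with nondecreasing derivative, hence above its
    tangents; the quadratic accounts exactly for the last term. *)
Lemma sconvex1 F F' F'' (c l m : R) :
  (forall u : R, l <= u <= m -> is_derive u (1 : R) F (F' u)) ->
  (forall u : R, l <= u <= m -> is_derive u (1 : R) F' (F'' u)) ->
  (forall u, l <= u <= m -> 2 * c <= F'' u) ->
  forall s t a, l <= s <= m -> l <= t <= m -> 0 <= a <= 1 ->
    F (a * s + (1 - a) * t) <=
      a * F s + (1 - a) * F t - c * (a * (1 - a)) * (s - t) ^+ 2.
Proof.
move=> dF dF' F''c s t a slm tlm /andP[a0 a1].
pose G u := F u - c * u ^+ 2; pose G' u := F' u - 2 * c * u.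
have dG (u : R) : l <= u <= m -> is_derive u (1 : R) G (G' u).
  move=> /dF dFu; apply: is_derive_eq.
  rewrite /GRing.scale /= /G'; ring.
have mG u v : l <= u -> u <= v -> v <= m -> G' u <= G' v.
  move=> lu uv vm.
  have [|w /andP[uw wv] e] := MVT1_in F' F'' u v _ uv.
    by move=> w /andP[uw wv]; apply: dF'; rewrite (le_trans lu)// (le_trans wv).
  have wlm : l <= w <= m by rewrite (le_trans lu)// (le_trans wv).
  have := F''c w wlm; rewrite /G' => Fw.
  have : 2 * c * (v - u) <= F'' w * (v - u) by rewrite ler_wpM2r// subr_ge0.
  by rewrite -e; lra.
have wlm : l <= a * s + (1 - a) * t <= m.
  move: slm tlm => /andP[? ?] /andP[? ?]; apply/andP; split; nra.
have hs := tangent_le _ _ _ _ _ _ dG mG wlm slm.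
have ht := tangent_le _ _ _ _ _ _ dG mG wlm tlm.
set w := a * s + _ in hs ht *.
have h1 : a * (G w + G' w * (s - w)) <= a * G s by rewrite ler_wpM2l.
have h2 : (1 - a) * (G w + G' w * (t - w)) <= (1 - a) * G t.
  by rewrite ler_wpM2l// subr_ge0.
have e : a * (G' w * (s - w)) + (1 - a) * (G' w * (t - w)) = 0 by rewrite /w; ring.
have : G w <= a * G s + (1 - a) * G t by lra.
rewrite /G => h3.
have e2 : c * w ^+ 2 = a * (c * s ^+ 2) + (1 - a) * (c * t ^+ 2)
   - c * (a * (1 - a)) * (s - t) ^+ 2 by rewrite /w; ring.
lra.
Qed.
End tangent.

Section ramp.
Context {R : realType}.

(** The standard smooth transition from 0 on [t <= 0] to 1 on [t >= 1]; the ramp is its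
    antiderivative. *)
Let step (t : R) := flat 1 t * (flat 1 t + flat 1 (1 - t))^-1.

Let step_den (t : R) : 0 < flat 1 t + flat 1 (1 - t).
Proof.
have [t0|t0] := ltP 0 t; first by rewrite ltr_wpDr ?flat1_gt0 ?flat1_ge0.
by rewrite ltr_wpDl ?flat1_ge0// flat1_gt0// subr_gt0 (le_lt_trans t0).
Qed.

Let smooth1_step : smooth1 step.
Proof.
move=> k; apply: Ck1_mul; first exact: flat_smooth.
apply: Ck1_inv => [t|]; first by rewrite gt_eqF.
apply: Ck1_add; first exact: flat_smooth.
rewrite (_ : (fun _ => _) = (fun t => flat 1 (- 1 * t + 1))).
  by apply: Ck1_affine; exact: flat_smooth.
by apply/funext => t; rewrite mulN1r addrC.
Qed.

(* A smooth version of t |-> max(0, t), exact up to a constant off [0, 1]. *)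
Lemma ramp_ex : exists m m' : R -> R,
  [/\ smooth1 m, forall t : R, is_derive t (1 : R) m (m' t),
      {homo m' : s t / s <= t}, forall t, t <= 0 -> m t = 0 /\ m' t = 0 &
      forall t, 1 <= t -> m' t = 1].
Proof.
have s0 t : t <= 0 -> step t = 0 by move=> t0; rewrite /step flat1_le0// mul0r.
have [m dm m0] := antiderivative_ex step (smooth1_step 0) s0.
exists m, step; split=> //.
- by case=> [|k]; [exact: is_derive1_continuous dm|exists step].
- move=> s t st; rewrite /step ler_pdivrMr// mulrAC ler_pdivlMr//.
  have := flat1_homo _ _ st; have : 1 - t <= 1 - s by rewrite lerB.
  move=> /flat1_homo; have := @flat1_ge0 R s; have := @flat1_ge0 R (1 - t); nra.
- by move=> t t0; rewrite m0// s0.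
move=> t t1; rewrite /step (@flat1_le0 _ (1 - t)) ?subr_le0// addr0 divff//.
by rewrite gt_eqF// flat1_gt0// (lt_le_trans _ t1).
Qed.

End ramp.

Section chi.
Context {R : realType}.
Implicit Types (s t : R).

(** For positive t this is t exp(-1/t), with second derivative exp(-1/t) / t^3. Unlike exp(-1/t) it
    is convex, and its derivative stays in [0, 1], which gives linear growth. *)
Definition chi (t : R) : R := t * flat 1 t.
Definition chi1 : R -> R := flat (1 + 'X).
Definition chi2 : R -> R := flat 'X^3.

Lemma is_derive_chi t : is_derive t (1 : R) chi (chi1 t).
Proof.
have dF := is_derive_flat (1 : {poly R}) t.
have := is_deriveM (is_derive_id t (1 : R)) dF.
rewrite (_ : id * _ = chi)//; congr (is_derive _ _ _ _).
rewrite /chi1 /GRing.scale /= /flat.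
case: (leP t 0) => t0; first by rewrite !(mulr0, mul0r, addr0).
rewrite /flat_deriv derivC subr0 mulr1 !hornerE.
change (t * t^-1 * t^-1 * expR (- t^-1) + expR (- t^-1) =
  (1 + t^-1) * expR (- t^-1)).
by rewrite divff ?gt_eqF// mul1r mulrDl mul1r addrC.
Qed.

Lemma is_derive_chi1 t : is_derive t (1 : R) chi1 (chi2 t).
Proof.
rewrite /chi2 (_ : 'X^3 = flat_deriv (1 + 'X)); first exact: is_derive_flat.
by rewrite /flat_deriv derivD derivX derivC add0r addrAC subrr add0r -exprSr.
Qed.

Lemma smooth1_chi : smooth1 chi.
Proof.
case=> [|k]; first exact: is_derive1_continuous is_derive_chi.
by exists chi1; [exact: is_derive_chi|exact: flat_smooth].
Qed.

Lemma chi2_ge0 t : 0 <= chi2 t.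
Proof.
rewrite /chi2 /flat; case: (leP t 0) => // t0.
by rewrite hornerXn mulr_ge0 ?expR_ge0// exprn_ge0// invr_ge0 ltW.
Qed.

Lemma chi2_gt0 t : 0 < t -> 0 < chi2 t.
Proof.
move=> t0; rewrite /chi2 /flat leNgt t0 /= hornerXn.
by rewrite mulr_gt0 ?expR_gt0// exprn_gt0// invr_gt0.
Qed.

Lemma chi1_homo : {homo chi1 : s t / s <= t}.
Proof. exact: ge0_derive_homo is_derive_chi1 chi2_ge0. Qed.

Lemma chi_le0 t : t <= 0 -> chi t = 0.
Proof. by move=> t0; rewrite /chi flat1_le0// mulr0. Qed.

Lemma chi1_le0 t : t <= 0 -> chi1 t = 0.
Proof. by move=> t0; rewrite /chi1 /flat t0. Qed.

Lemma chi1_ge0 t : 0 <= chi1 t.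
Proof.
have [t0|/ltW t0] := leP t 0; first by rewrite chi1_le0.
by rewrite -(@chi1_le0 0)//; exact: chi1_homo.
Qed.

Lemma chi1_le1 t : chi1 t <= 1.
Proof.
rewrite /chi1 /flat; case: (leP t 0) => // t0.
by rewrite !hornerE expRN ler_pdivrMr ?expR_gt0// mul1r expR_ge1Dx.
Qed.

Lemma chi_ge0 t : 0 <= chi t.
Proof.
have [t0|/ltW t0] := leP t 0; first by rewrite chi_le0.
by rewrite mulr_ge0// flat1_ge0.
Qed.

Lemma chi_le t : chi t <= `|t|.
Proof.
have [t0|/ltW t0] := leP t 0; first by rewrite chi_le0.
rewrite ger0_norm// /chi -[leRHS]mulr1 ler_wpM2l// flat1E.
by case: ifP => // _; rewrite expR_le1 oppr_le0 invr_ge0.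
Qed.

(** At every t at least one of [1 + t] and [1 - t] is positive, so the second derivative is positive
    everywhere, while the slope is bounded by 1. *)
Definition bowl t : R := chi (1 + t) + chi (1 - t).
Definition bowl1 t : R := chi1 (1 + t) - chi1 (1 - t).
Definition bowl2 t : R := chi2 (1 + t) + chi2 (1 - t).

Let is_derive_refl (F F' : R -> R) t : (forall u : R, is_derive u (1 : R) F (F' u)) ->
  is_derive t (1 : R) (fun s => F (1 - s)) (- F' (1 - t)).
Proof.
move=> dF; rewrite (_ : (fun _ => _) = (fun s => F (- 1 * s + 1))).
  by have := @is_derive_affine R F _ (-1) 1 t (dF _); rewrite !mulN1r (addrC _ 1).
by apply/funext => s; rewrite mulN1r addrC.
Qed.

Let is_derive_trans (F F' : R -> R) t : (forall u : R, is_derive u (1 : R) F (F' u)) ->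
  is_derive t (1 : R) (fun s => F (1 + s)) (F' (1 + t)).
Proof.
move=> dF; rewrite (_ : (fun _ => _) = (fun s => F (1 * s + 1))).
  by have := @is_derive_affine R F _ 1 1 t (dF _); rewrite !mul1r (addrC _ 1).
by apply/funext => s; rewrite mul1r addrC.
Qed.

Lemma is_derive_bowl t : is_derive t (1 : R) bowl (bowl1 t).
Proof.
have d1 := is_derive_trans _ _ t is_derive_chi.
have d2 := is_derive_refl _ _ t is_derive_chi.
exact: is_deriveD.
Qed.

Lemma is_derive_bowl1 t : is_derive t (1 : R) bowl1 (bowl2 t).
Proof.
have d1 := is_derive_trans _ _ t is_derive_chi1.
have d2 := is_derive_refl _ _ t is_derive_chi1.
rewrite /bowl2 -[chi2 (1 - t)]opprK; exact: is_deriveB.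
Qed.

Lemma smooth1_bowl : smooth1 bowl.
Proof.
move=> k; apply: Ck1_add.
  rewrite (_ : (fun _ => _) = (fun s => chi (1 * s + 1))).
    by apply: Ck1_affine; exact: smooth1_chi.
  by apply/funext => s; rewrite mul1r addrC.
rewrite (_ : (fun _ => _) = (fun s => chi (- 1 * s + 1))).
  by apply: Ck1_affine; exact: smooth1_chi.
by apply/funext => s; rewrite mulN1r addrC.
Qed.

Lemma bowl2_gt0 t : 0 < bowl2 t.
Proof.
have [t0|t0] := ltP 0 (1 + t); first by rewrite ltr_wpDr ?chi2_gt0 ?chi2_ge0.
by rewrite ltr_wpDl ?chi2_ge0// chi2_gt0//; lra.
Qed.

Lemma bowl_ge0 t : 0 <= bowl t.
Proof. by rewrite addr_ge0 ?chi_ge0. Qed.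

Lemma bowl_le t : bowl t <= 2 * (1 + `|t|).
Proof.
have := chi_le (1 + t); have := chi_le (1 - t).
have := ler_normD 1 t; have := ler_normB 1 t; rewrite normr1 /bowl; lra.
Qed.

Lemma bowl1_le t : `|bowl1 t| <= 1.
Proof.
have := chi1_ge0 (1 + t); have := chi1_le1 (1 + t).
have := chi1_ge0 (1 - t); have := chi1_le1 (1 - t).
by rewrite ler_norml /bowl1 => *; apply/andP; split; lra.
Qed.

Lemma bowl1_lin : exists2 C, 0 < C & forall t, `|bowl1 t| <= C * `|t|.
Proof.
have [B B0 hB] := @flat_bounded R 'X^3.
have b1 : bowl1 0 = 0 by rewrite /bowl1 addr0 subr0 subrr.
exists (2 * B + 1) => [|t]; first by rewrite ltr_wpDl// mulr_ge0.
have key u v : u <= v -> `|bowl1 v - bowl1 u| <= (2 * B + 1) * `|v - u|.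
  move=> uv; have [w _ ->] := MVT1 _ _ _ _ is_derive_bowl1 uv.
  rewrite normrM ler_wpM2r//; apply: (le_trans (ler_normD _ _)).
  have := hB (1 + w); have := hB (1 - w); rewrite -/(chi2 _); lra.
have [t0|/ltW t0] := leP 0 t.
  by have := key _ _ t0; rewrite b1 !subr0.
by have := key _ _ t0; rewrite b1 !sub0r !normrN.
Qed.

(** The constant is half the minimum of the positive continuous function [bowl2] on the interval
    from [- A] to [A]. *)
Lemma bowl_sconvex (A : R) : exists2 c, 0 < c &
  forall s t a, `|s| <= A -> `|t| <= A -> 0 <= a <= 1 ->
    bowl (a * s + (1 - a) * t) <=
      a * bowl s + (1 - a) * bowl t - c * (a * (1 - a)) * (s - t) ^+ 2.
Proof.
have cb : continuous bowl2.
  move=> t; apply: (@continuousD _ _ _ (fun t => chi2 (1 + t)) (fun t => chi2 (1 - t))).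
    rewrite (_ : (fun _ => _) = (fun s => chi2 (1 * s + 1))).
      exact: (Ck1_affine 0 _ 1 1 (flat_smooth 'X^3 0)).
    by apply/funext => s; rewrite mul1r addrC.
  rewrite (_ : (fun _ => _) = (fun s => chi2 (- 1 * s + 1))).
    exact: (Ck1_affine 0 _ (-1) 1 (flat_smooth 'X^3 0)).
  by apply/funext => s; rewrite mulN1r addrC.
have [A0|A0] := ltP A 0.
  by exists 1 => // s t a sA; have := le_lt_trans (le_trans (normr_ge0 _) sA) A0; rewrite ltxx.
have [|w _ wmin] := @EVT_min R bowl2 (- A) A _ (continuous_subspaceT cb).
  by rewrite ge0_cp.
exists (bowl2 w / 2); first by rewrite divr_gt0// bowl2_gt0.
move=> s t a; rewrite !ler_norml.
apply: sconvex1 => u uA; [exact: is_derive_bowl|exact: is_derive_bowl1|].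
by rewrite mulrC divfK// wmin// in_itv/=.
Qed.

End chi.

(** * Smooth maxima and gluing *)

Definition cvx {R : realType} {d : nat} (U : set 'rV[R]_d) (g : 'rV[R]_d -> R) :=
  forall x y t, U x -> U y -> 0 <= t <= 1 ->
    g (t *: x + (1 - t) *: y) <= t * g x + (1 - t) * g y.

(* Locally, g - c |.|^2 is convex for some c > 0. *)
Definition locally_sconvex {R : realType} {d : nat} (U : set 'rV[R]_d)
    (g : 'rV[R]_d -> R) :=
  forall x, U x -> exists c, 0 < c /\ exists2 r, 0 < r &
    forall y z t, eball x r y -> eball x r z -> 0 <= t <= 1 ->
      g (t *: y + (1 - t) *: z) <=
        t * g y + (1 - t) * g z - c * (t * (1 - t)) * enorm (y - z) ^+ 2.

(** Where g is differentiable this bounds the Euclidean length of its gradient; the directional form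
    is stable under the convex combinations that smooth maxima produce. *)
Definition grad_le {R : realType} {d : nat} (g : 'rV[R]_d -> R) (x : 'rV[R]_d)
    (rho : R) :=
  forall v, 'D_v g x <= rho * enorm v.

Section smooth_max.
Context {R : realType}.
Implicit Types (a b e t : R).

Definition ramp : R -> R := sval (cid (@ramp_ex R)).
Definition ramp1 : R -> R := sval (cid (svalP (cid (@ramp_ex R)))).

Lemma rampP : [/\ smooth1 ramp, forall t : R, is_derive t (1 : R) ramp (ramp1 t),
  {homo ramp1 : s t / s <= t}, forall t, t <= 0 -> ramp t = 0 /\ ramp1 t = 0 &
  forall t, 1 <= t -> ramp1 t = 1].
Proof. exact: (svalP (cid (svalP (cid (@ramp_ex R))))). Qed.

Lemma ramp1_ge0 t : 0 <= ramp1 t.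
Proof.
have [_ _ hm r0 _] := rampP; have [t0|/ltW t0] := leP t 0.
  by have [_ ->] := r0 t t0.
by have [_ <-] := r0 0 (lexx _); exact: hm.
Qed.

Lemma ramp1_le1 t : ramp1 t <= 1.
Proof.
have [_ _ hm _ r1] := rampP; have [t1|/ltW t1] := leP 1 t; first by rewrite r1.
by rewrite -(r1 1 (lexx _)) hm.
Qed.

Lemma ramp_le0 t : t <= 0 -> ramp t = 0.
Proof. by have [_ _ _ r0 _] := rampP => /r0[]. Qed.

Lemma ramp_lip s t : s <= t -> 0 <= ramp t - ramp s <= t - s.
Proof.
have [_ dr _ _ _] := rampP => st; have [u _ ->] := MVT1 _ _ _ _ dr st.
have := ramp1_ge0 u; have := ramp1_le1 u; rewrite -subr_ge0 in st.
by move=> r1 r0; rewrite mulr_ge0//= ler_piMl.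
Qed.

Lemma ramp_ge0 t : 0 <= ramp t.
Proof.
have [t0|/ltW t0] := leP t 0; first by rewrite ramp_le0.
by have := ramp_lip _ _ t0; rewrite (ramp_le0 0)// subr0 => /andP[].
Qed.

Lemma ramp_le t : 0 <= t -> ramp t <= t.
Proof. by move=> /ramp_lip; rewrite (ramp_le0 0)// !subr0 => /andP[]. Qed.

Lemma ramp_ge t : t - 1 <= ramp t.
Proof.
have [_ dr _ _ r1] := rampP.
have [t1|/ltW t1] := leP t 1; first by rewrite (le_trans _ (ramp_ge0 t))// subr_le0.
have [u /andP[u1 _]] := MVT1 _ _ _ _ dr t1; rewrite r1// mul1r => <-.
by rewrite gerBl ramp_ge0.
Qed.

Lemma ramp_convex s t a : 0 <= a <= 1 ->
  ramp (a * s + (1 - a) * t) <= a * ramp s + (1 - a) * ramp t.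
Proof.
by have [_ dr hm _ _] := rampP; exact: homo_convex dr hm.
Qed.

(** A one-sided smooth maximum: it equals [a] exactly as soon as [b <= a], and may fall short of [b]
    by up to [e]. The exactness makes a sequence of glued functions stationary where the later
    pieces are low. *)
Definition smax e a b := a + e * ramp ((b - a) / e).

Lemma smax_le e a b : b <= a -> 0 < e -> smax e a b = a.
Proof.
move=> ba e0; rewrite /smax ramp_le0 ?mulr0 ?addr0//.
by rewrite pmulr_lle0 ?invr_gt0// subr_le0.
Qed.

Lemma smax_gel e a b : 0 < e -> a <= smax e a b.
Proof. by move=> e0; rewrite lerDl mulr_ge0 ?ramp_ge0// ltW. Qed.

Lemma smax_ger e a b : 0 < e -> b - e <= smax e a b.
Proof.
move=> e0; have := ramp_ge ((b - a) / e).
rewrite -(ler_pM2l e0) mulrBr mulr1 mulrCA divff ?gt_eqF// mulr1 /smax; lra.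
Qed.

Lemma smax_lub e a b c : 0 < e -> a <= c -> b <= c -> smax e a b <= c.
Proof.
move=> e0 ac bc; have [ba|/ltW ab] := leP b a; first by rewrite smax_le.
apply: le_trans bc; rewrite /smax.
have : ramp ((b - a) / e) <= (b - a) / e.
  by apply: ramp_le; rewrite divr_ge0 ?subr_ge0// ltW.
rewrite -(ler_pM2l e0) mulrCA divff ?gt_eqF// mulr1; lra.
Qed.

Lemma smaxD e a b c : smax e (a + c) (b + c) = smax e a b + c.
Proof. by rewrite /smax opprD addrACA subrr addr0 addrAC. Qed.

Lemma smax_homo e a b a' b' : 0 < e -> a <= a' -> b <= b' ->
  smax e a b <= smax e a' b'.
Proof.
move=> e0 aa bb; apply: (@le_trans _ _ (smax e a b')).
  rewrite lerD2l ler_pM2l//.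
  have /ramp_lip/andP[] : (b - a) / e <= (b' - a) / e.
    by rewrite ler_pM2r ?invr_gt0// lerD2r.
  by rewrite subr_ge0.
have /ramp_lip/andP[_] : (b' - a') / e <= (b' - a) / e.
  by rewrite ler_pM2r ?invr_gt0// lerB.
rewrite -mulrBl -(ler_pM2l e0) [X in _ <= X]mulrCA divff ?gt_eqF// mulr1 /smax; lra.
Qed.

Lemma smax_convex e a b a' b' t : 0 < e -> 0 <= t <= 1 ->
  smax e (t * a + (1 - t) * a') (t * b + (1 - t) * b') <=
  t * smax e a b + (1 - t) * smax e a' b'.
Proof.
move=> e0 t01; have en : e != 0 by rewrite gt_eqF.
have := ramp_convex ((b - a) / e) ((b' - a') / e) t t01.
rewrite -(ler_pM2l e0) /smax.
rewrite (_ : t * ((b - a) / e) + (1 - t) * ((b' - a') / e) =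
  (t * b + (1 - t) * b' - (t * a + (1 - t) * a')) / e); last first.
  by field.
lra.
Qed.

End smooth_max.

Section smooth_max_fun.
Context {R : realType} {d : nat}.
Implicit Types (U : set 'rV[R]_d) (f g : 'rV[R]_d -> R) (e : R).

Lemma smooth_on_smax U e f g : open U -> smooth_on U f -> smooth_on U g ->
  smooth_on U (fun x => smax e (f x) (g x)).
Proof.
move=> oU sf sg; have [sr _ _ _ _] := @rampP R.
apply: smooth_on_add => //; apply: smooth_on_scale => //.
apply: (@smooth_on_comp _ _ U ramp (fun x => (g x - f x) / e)) => //.
rewrite (_ : (fun _ => _) = (fun x => e^-1 * (g x + -1 * f x))).
  by apply: smooth_on_scale => //; apply: smooth_on_add => //; exact: smooth_on_scale.
by apply/funext => x; rewrite mulN1r mulrC.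
Qed.

Lemma derive_smax e f g x v : 0 < e -> differentiable f x -> differentiable g x ->
  'D_v (fun y => smax e (f y) (g y)) x =
  (1 - ramp1 ((g x - f x) / e)) * 'D_v f x + ramp1 ((g x - f x) / e) * 'D_v g x.
Proof.
move=> e0 df dg; have [_ dr _ _ _] := @rampP R.
have dq : differentiable ((g - f) * cst e^-1) x.
  by apply: differentiableM; [exact: differentiableB|exact: differentiable_cst].
have Df : is_derive x v f ('D_v f x) by apply: derivableP; exact: diff_derivable.
have Dg : is_derive x v g ('D_v g x) by apply: derivableP; exact: diff_derivable.
have dqv : 'D_v ((g - f) * cst e^-1) x = ('D_v g x - 'D_v f x) / e.
  rewrite deriveM; [|by apply: diff_derivable; exact: differentiableB|exact: derivable_cst].
  rewrite derive_cst deriveB; [|exact: diff_derivable..].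
  by rewrite /GRing.scale/= mulr0 add0r mulrC.
have Dr := is_derive_comp1 ramp _ _ _ v dq (dr ((g x - f x) / e)).
have De := is_deriveD Df (is_deriveZ e Dr).
rewrite (_ : (fun y => _) = f + e *: (fun y => ramp (((g - f) * cst e^-1) y)))//.
have [_ ->] := De; rewrite dqv /GRing.scale/=; field; by rewrite gt_eqF.
Qed.

(** A bound is asked only of a function with positive weight, because inactive pieces may be
    arbitrarily steep. *)
Lemma grad_le_conv f g h x (a rho : R) : 0 <= a <= 1 ->
  (forall v, 'D_v h x = (1 - a) * 'D_v f x + a * 'D_v g x) ->
  (a < 1 -> grad_le f x rho) -> (0 < a -> grad_le g x rho) -> grad_le h x rho.
Proof.
move=> /andP[a0 a1] hE gf gg v; rewrite hE.
have h1 : (1 - a) * 'D_v f x <= (1 - a) * (rho * enorm v).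
  move: a1; rewrite le_eqVlt => /predU1P[->|a1]; first by rewrite subrr !mul0r.
  by rewrite ler_wpM2l ?subr_ge0 ?(ltW a1)//; exact: gf.
have h2 : a * 'D_v g x <= a * (rho * enorm v).
  move: a0; rewrite le_eqVlt => /predU1P[<-|a0]; first by rewrite !mul0r.
  by rewrite ler_wpM2l ?(ltW a0)//; exact: gg.
lra.
Qed.

Lemma cvx_smax U e f g : 0 < e -> cvx U f -> cvx U g ->
  cvx U (fun x => smax e (f x) (g x)).
Proof.
move=> e0 cf cg x y t Ux Uy t01.
apply: le_trans (smax_convex e _ _ _ _ t e0 t01).
by apply: smax_homo => //; [exact: cf|exact: cg].
Qed.

Lemma strictly_convex_smax U e f g : 0 < e ->
  strictly_convex_on U f -> strictly_convex_on U g ->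
  strictly_convex_on U (fun x => smax e (f x) (g x)).
Proof.
move=> e0 cf cg x y t Ux Uy xy t01.
have hf := cf x y t Ux Uy xy t01; have hg := cg x y t Ux Uy xy t01.
set A := (1 - t) * f x + _ in hf; set B := (1 - t) * g x + _ in hg.
(* Both functions lie below their chords by at least [c], and [smax] commutes with subtracting a
   constant from both arguments. *)
pose c := Num.min (A - f ((1 - t) *: x + t *: y)) (B - g ((1 - t) *: x + t *: y)).
have c0 : 0 < c by rewrite lt_min !subr_gt0 hf.
have /andP[t0 t1] := t01.
have t01' : 0 <= 1 - t <= 1 by apply/andP; split; lra.
have := smax_convex e (f x) (g x) (f y) (g y) (1 - t) e0 t01'.
rewrite subKr => hc; apply: lt_le_trans hc; rewrite -/A -/B.
apply: (@le_lt_trans _ _ (smax e (A - c) (B - c))).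
  apply: smax_homo => //; first by rewrite lerBrDr addrC -lerBrDr ge_min lexx.
  by rewrite lerBrDr addrC -lerBrDr ge_min lexx orbT.
by rewrite smaxD gtrDl oppr_lt0.
Qed.

Lemma locally_sconvex_smax U e f g : 0 < e ->
  locally_sconvex U f -> locally_sconvex U g ->
  locally_sconvex U (fun x => smax e (f x) (g x)).
Proof.
move=> e0 cf cg x Ux.
have [c1 [c10 [r1 r10 h1]]] := cf x Ux; have [c2 [c20 [r2 r20 h2]]] := cg x Ux.
exists (Num.min c1 c2); split; first by rewrite lt_min c10.
exists (Num.min r1 r2); first by rewrite lt_min r10.
move=> y z t; rewrite /eball/= !lt_min => /andP[y1 y2] /andP[z1 z2] t01.
have := h1 y z t y1 z1 t01; have := h2 y z t y2 z2 t01.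
set q := enorm (y - z) ^+ 2; set w := t *: y + _ => hg hf.
have q0 : 0 <= t * (1 - t) * q.
  by case/andP: t01 => ? ?; rewrite mulr_ge0 ?sqr_ge0// mulr_ge0// subr_ge0.
apply: (@le_trans _ _ (smax e (t * f y + (1 - t) * f z - Num.min c1 c2 * (t * (1 - t)) * q)
   (t * g y + (1 - t) * g z - Num.min c1 c2 * (t * (1 - t)) * q))).
  apply: smax_homo => //.
    apply: (le_trans hf); rewrite lerD2l lerN2 -2!(mulrA _ (t * _)).
    by apply: ler_wpM2r => //; rewrite ge_min lexx.
  apply: (le_trans hg); rewrite lerD2l lerN2 -2!(mulrA _ (t * _)).
  by apply: ler_wpM2r => //; rewrite ge_min lexx orbT.
by rewrite smaxD lerD2r smax_convex.
Qed.

End smooth_max_fun.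

(** * Gluing a locally finite sequence of pieces *)

Section gluing.
Context {R : realType} {d : nat}.
Variables (U : set 'rV[R]_d) (h : nat -> 'rV[R]_d -> R) (beta : nat -> R).
Hypothesis openU : open U.
Hypothesis convU : forall x y t, U x -> U y -> 0 <= t <= 1 ->
  U (t *: x + (1 - t) *: y).
Hypothesis beta_gt0 : forall i, 0 < beta i.
Hypothesis smoothh : forall i, smooth_on U (h i).
Hypothesis cvxh : forall i, cvx U (h i).
Hypothesis locfin : forall x, U x -> exists N, \forall y \near x, forall i,
  (N <= i)%N -> exists2 j, (j < N)%N & h i y + beta j <= h j y.

(** With the running minimum, [eta n <= beta i / 2 ^+ n.+1] for all [i <= n]: the smoothing widths
    after step i add up to less than [beta i]. *)
Let bm := fix bm n := if n is m.+1 then Num.min (bm m) (beta n) else beta 0.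
Let eta n := bm n / 2 ^+ n.+1.

Let bm_gt0 n : 0 < bm n.
Proof. by elim: n => [|n IH] /=; [exact: beta_gt0|rewrite lt_min IH beta_gt0]. Qed.

Let bm_le n : bm n <= beta n.
Proof. by case: n => [|n] //=; rewrite ge_min lexx orbT. Qed.

Let bm_homo i n : (i <= n)%N -> bm n <= bm i.
Proof.
elim: n => [|n IH]; first by rewrite leqn0 => /eqP->.
rewrite leq_eqVlt => /predU1P[->//|]; rewrite ltnS => /IH; apply: le_trans.
by rewrite /= ge_min lexx.
Qed.

Let eta_gt0 n : 0 < eta n.
Proof. by rewrite divr_gt0 ?exprn_gt0. Qed.

Let eta_le n : eta n <= beta n.
Proof.
apply: le_trans (bm_le n); rewrite ler_pdivrMr ?exprn_gt0// ler_peMr ?(ltW (bm_gt0 n))//.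
by rewrite exprn_ege1// ler1n.
Qed.

Let g := fix g n x := if n is m.+1 then smax (eta n) (g m x) (h n x) else h 0 x.

Let g_homo m n x : (m <= n)%N -> g m x <= g n x.
Proof.
elim: n => [|n IH]; first by rewrite leqn0 => /eqP->.
rewrite leq_eqVlt => /predU1P[->//|]; rewrite ltnS => /IH /le_trans; apply.
by rewrite /= smax_gel.
Qed.

Let g_ge n x : h n x - eta n <= g n x.
Proof. by case: n => [|n] /=; [rewrite gerBl ltW|rewrite smax_ger]. Qed.

Let g_ge' i n x : (i <= n)%N -> h i x - beta i <= g n x.
Proof.
move=> /(g_homo _ _ x); apply: le_trans; apply: le_trans (g_ge i x).
by rewrite lerB.
Qed.

Let g_le n x M : (forall i, (i <= n)%N -> h i x <= M) -> g n x <= M.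
Proof.
elim: n => [|n IH] hM /=; first exact: hM.
by apply: smax_lub => //; [apply: IH => i /leqW; exact: hM|exact: hM].
Qed.

Let smooth_g n : smooth_on U (g n).
Proof. by elim: n => [|n IH]; [exact: smoothh|exact: smooth_on_smax]. Qed.

Let diff_g n x : U x -> differentiable (g n) x.
Proof. by move=> Ux; have [dg _] := smooth_g n 1; exact: dg. Qed.

Let diff_h n x : U x -> differentiable (h n) x.
Proof. by move=> Ux; have [dh _] := smoothh n 1; exact: dh. Qed.

(** An upper bound for the sum of [eta k] over i < k <= n. A step that leaves positive weight to the
    older pieces raises the running maximum by at most its [eta], so a piece this far below the
    final value was inactive before. *)
Let tail i n : R := bm i * (2 ^- i.+1 - 2 ^- n.+1).

Let tail_le i n : (i <= n)%N -> tail i n <= beta i.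
Proof.
move=> _; apply: le_trans (bm_le i); rewrite ler_piMr ?(ltW (bm_gt0 i))//.
have : 2 ^- i.+1 <= 1 :> R by rewrite invf_le1 ?exprn_gt0// exprn_ege1// ler1n.
have : 0 <= 2 ^- n.+1 :> R by rewrite invr_ge0 exprn_ge0.
lra.
Qed.

Let tailS i n : (i <= n)%N -> tail i n + eta n.+1 <= tail i n.+1.
Proof.
move=> ile; have : eta n.+1 <= bm i * 2 ^- n.+2.
  by rewrite ler_wpM2r ?invr_ge0 ?exprn_ge0// bm_homo// leqW.
rewrite /tail; have -> : 2 ^- n.+1 = 2 * 2 ^- n.+2 :> R.
  by rewrite [in RHS]exprS invfM mulrA divff ?mul1r// pnatr_eq0.
by have := bm_gt0 i; nra.
Qed.

(* Only the pieces whose value at x is nearly maximal contribute to the gradient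
   at x, because [ramp] is locally constant below 0 and affine of slope 1 above 1. *)
Let grad_g n x rho : U x ->
  (forall i, (i <= n)%N -> grad_le (h i) x rho \/ h i x < g n x - tail i n) ->
  grad_le (g n) x rho.
Proof.
move=> Ux; elim: n => [|n IH] good.
  by have [//|] := good 0 isT; rewrite /tail subrr mulr0 subr0 ltxx.
have [_ _ _ r0 r1] := @rampP R.
have := eta_gt0 n.+1 => e0.
set a := ramp1 ((h n.+1 x - g n x) / eta n.+1).
apply: (@grad_le_conv _ _ (g n) (h n.+1) _ _ a).
- by rewrite ramp1_ge0 ramp1_le1.
- by move=> v; rewrite /= derive_smax//; [exact: diff_g|exact: diff_h].
- move=> a1; apply: IH => i ile; have [|hi] := good i (leqW ile); first by left.
  right; apply: (lt_le_trans hi); have := tailS i n ile.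
  suff : g n.+1 x <= g n x + eta n.+1 by lra.
  have hlt : h n.+1 x < g n x + eta n.+1.
    rewrite ltNge; apply/negP => hge; move: a1; rewrite /a r1 ?ltxx//.
    by rewrite ler_pdivlMr// mul1r lerBrDr addrC.
  by apply: smax_lub => //; [rewrite lerDl ltW|exact: ltW].
move=> a0; have [//|] := good n.+1 (leqnn _).
have hgt : g n x < h n.+1 x.
  rewrite ltNge; apply/negP => hle; move: a0; rewrite /a.
  have [|_ ->] := r0 ((h n.+1 x - g n x) / eta n.+1); last by rewrite ltxx.
  by rewrite pmulr_lle0 ?invr_gt0// subr_le0.
rewrite /tail subrr mulr0 subr0 => hlt.
have : g n.+1 x <= h n.+1 x by apply: smax_lub => //; exact: ltW.
by rewrite leNgt hlt.
Qed.

(** A late piece is at most [h j - beta j] for some early j, and the running maximum has lost at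
    most [beta j] from [h j], so [smax] returns its first argument. *)
Let stat x : U x -> exists N, \forall y \near x, forall n, (N <= n)%N -> g n y = g N y.
Proof.
move=> /locfin[N HN]; exists N; apply: filterS HN => y HN.
elim=> [|n IH]; first by rewrite leqn0 => /eqP->.
rewrite leq_eqVlt => /predU1P[->//|]; rewrite ltnS => Nn.
rewrite -(IH Nn) /= smax_le//; have [j jN hj] := HN n.+1 (leqW Nn).
have := g_ge' j n y (leq_trans (ltnW jN) Nn); lra.
Qed.

Let glim x := limn (g ^~ x).

Let glimE x N : (forall n, (N <= n)%N -> g n x = g N x) -> glim x = g N x.
Proof.
move=> st; apply/cvg_lim => //; apply: cvg_near_cst.
by exists N => //= n /= Nn; rewrite st.
Qed.

Let glimP x : U x -> exists N, forall n, (N <= n)%N -> glim x = g n x.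
Proof.
move=> Ux; have [N /nbhs_singleton st] := stat x Ux; exists N => n Nn.
by rewrite (glimE x N)// st.
Qed.

Let glim_loc x : U x -> exists N W, [/\ open W, W x & forall y, W y -> g N y = glim y].
Proof.
move=> Ux; have [N st] := stat x Ux.
exists N, (interior [set y | forall n, (N <= n)%N -> g n y = g N y]).
split=> //; first exact: open_interior.
by move=> y /interior_subset Wy; rewrite (glimE y N).
Qed.

(** In the gradient clause [beta i] pays for the tail of smoothing widths and [beta j] for what
    [h j] may lose in g; only pieces that are nearly maximal at x have to be flat enough there. *)
Lemma gluing : exists g : 'rV[R]_d -> R,
  (smooth_on U g /\ cvx U g) /\
  (forall x i, U x -> h i x - beta i <= g x) /\
  (forall x M, U x -> (forall i, h i x <= M) -> g x <= M) /\
  (forall x rho, U x -> (forall i, grad_le (h i) x rho \/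
       exists j, h i x + beta i + beta j < h j x) -> grad_le g x rho) /\
  ((forall i, strictly_convex_on U (h i)) -> strictly_convex_on U g) /\
  ((forall i, locally_sconvex U (h i)) -> locally_sconvex U g).
Proof.
exists glim; do ![split].
- move=> k; apply: Ck_on_local => x Ux; have [N [W [oW Wx WN]]] := glim_loc x Ux.
  exists (W `&` U), (g N); split=> //; [exact: openI|by move=> y [/WN]|].
  by apply: (@Ck_on_sub _ _ _ U) => //; exact: smooth_g.
- move=> x y t Ux Uy t01.
  have cg n : cvx U (g n) by elim: n => [|n IH]; [exact: cvxh|exact: cvx_smax].
  have [N1 e1] := glimP x Ux; have [N2 e2] := glimP y Uy.
  have [N3 e3] := glimP _ (convU x y t Ux Uy t01).
  set n := maxn N1 (maxn N2 N3).
  by rewrite (e1 n) ?(e2 n) ?(e3 n) /n ?leq_max ?leqnn ?orbT//; exact: cg.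
- move=> x i Ux; have [N e] := glimP x Ux.
  by rewrite (e (maxn N i)) ?leq_maxl// g_ge'// leq_maxr.
- move=> x M Ux hM; have [N e] := glimP x Ux.
  by rewrite (e N)//; apply: g_le => i _; exact: hM.
- move=> x rho Ux good v.
  have [N [W [oW Wx WN]]] := glim_loc x Ux.
  have [N' e'] := glimP x Ux.
  have nW : \forall y \near x, g N y = glim y.
    by apply: (filterS WN); exact: open_nbhs_nbhs.
  rewrite -(near_eq_derive _ nW); move: v; apply: grad_g => // i iN.
  have [|[j hj]] := good i; first by left.
  right; rewrite (WN x Wx) (e' (maxn N' j)) ?leq_maxl//.
  have := g_ge' j (maxn N' j) x (leq_maxr _ _).
  have := tail_le i N iN; lra.
- move=> sh x y t Ux Uy xy t01.
  have cg n : strictly_convex_on U (g n).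
    by elim: n => [|n IH]; [exact: sh|exact: strictly_convex_smax].
  have [N1 e1] := glimP x Ux; have [N2 e2] := glimP y Uy.
  have t01' : 0 <= t <= 1 by case/andP: t01 => *; apply/andP; split; lra.
  have := convU y x t Uy Ux t01'; rewrite addrC => Uw.
  have [N3 e3] := glimP _ Uw.
  set n := maxn N1 (maxn N2 N3).
  by rewrite (e1 n) ?(e2 n) ?(e3 n) /n ?leq_max ?leqnn ?orbT//; exact: cg.
move=> sh x Ux; have [N [W [oW Wx WN]]] := glim_loc x Ux.
have cg n : locally_sconvex U (g n).
  by elim: n => [|n IH]; [exact: sh|exact: locally_sconvex_smax].
have [c [c0 [r r0 hc]]] := cg N x Ux; exists c; split=> //.
have : nbhs x W by exact: open_nbhs_nbhs.
move=> /nbhs_normP[e /= e0 eW].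
exists (Num.min r e); first by rewrite lt_min r0.
have xW z : enorm (z - x) < e -> W z.
  move=> ze; apply: eW; rewrite /ball_/= (le_lt_trans _ ze)//.
  by rewrite enormB ler_norm_enorm.
move=> y z t; rewrite /eball/= !lt_min => /andP[yr ye] /andP[zr ze] t01.
rewrite -!WN; [exact: hc|exact: xW|exact: xW|].
apply: xW; rewrite (_ : _ - x = t *: (y - x) + (1 - t) *: (z - x)); last first.
  by rewrite !scalerBr addrACA -opprD -scalerDl [t + _]addrC addrNK scale1r.
have /andP[t0 t1] := t01.
apply: le_lt_trans (ler_enormD _ _) _; rewrite !enormZ !ger0_norm ?subr_ge0//.
apply: (@le_lt_trans _ _ (Num.max (enorm (y - x)) (enorm (z - x)))).
  set m := Num.max _ _.
  have h1 : t * enorm (y - x) <= t * m by rewrite ler_wpM2l// le_max lexx.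
  have h2 : (1 - t) * enorm (z - x) <= (1 - t) * m.
    by rewrite ler_wpM2l ?subr_ge0// le_max lexx orbT.
  lra.
by rewrite gt_max ye.
Qed.
End gluing.

(** * Convex functions and their supports *)

Definition sub {R : realType} {d : nat} (U : set 'rV[R]_d) (f : 'rV[R]_d -> R)
    (x p : 'rV[R]_d) :=
  forall y, U y -> f x + dot p (y - x) <= f y.

Section convex_analysis.
Context {R : realType} {d : nat}.
Local Notation V := 'rV[R]_d.
Variables (U : set V) (f : V -> R).
Hypothesis openU : open U.
Hypothesis convU : forall x y t, U x -> U y -> 0 <= t <= 1 ->
  U (t *: x + (1 - t) *: y).
Hypothesis cvxf : cvx U f.

Lemma open_norm_ball (x : V) : U x ->
  exists2 r, 0 < r & forall y, `|y - x| <= r -> U y.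
Proof.
move=> Ux; have : nbhs x U by exact: open_nbhs_nbhs.
move=> /nbhs_normP[e /= e0 eU]; exists (e / 2); first by rewrite divr_gt0.
move=> y yx; apply: eU; rewrite /ball_ /= distrC (le_lt_trans yx)//.
by rewrite ltr_pdivrMr// ltr_pMr// ltr1n.
Qed.

(** On a cube a convex function is bounded by its values at the vertices. The induction is on the
    number of coordinates not yet pushed to a face; the sum of absolute values over all vertices
    serves as the bound. *)
Lemma cvx_bounded_above (x : V) : U x -> exists r M, 0 < r /\
  forall y, `|y - x| <= r -> U y /\ f y <= M.
Proof.
move=> Ux; have [r r0 rU] := open_norm_ball x Ux.
pose vtx (b : {ffun 'I_d -> bool}) : V := x + \row_i (if b i then r else - r).
pose M := \sum_(b : {ffun 'I_d -> bool}) `|f (vtx b)|.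
exists r, M; split=> //.
have key k : (k <= d)%N -> forall y : V,
    (forall i : 'I_d, `|y ord0 i - x ord0 i| <= r) ->
    (forall i : 'I_d, (k <= i)%N -> `|y ord0 i - x ord0 i| = r) -> U y /\ f y <= M.
  elim: k => [|k IH] kd y yr yk.
    pose b := [ffun i => 0 <= y ord0 i - x ord0 i].
    have -> : y = vtx b.
      apply/rowP => i; rewrite !mxE ffunE; have := yk i (leq0n _).
      by case: leP => h; [rewrite ger0_norm// => <-|rewrite ltr0_norm// => <-]; ring.
    split; last first.
      by rewrite (le_trans (ler_norm _))// /M (bigD1 b)//= lerDl sumr_ge0.
    apply: rU; rewrite /vtx addrC addKr.
    rewrite [leLHS]/Num.norm /= mx_normrE; apply/bigmax_leP; split; first exact: ltW.
    move=> [i j] _ /=; rewrite mxE; case: ifP => _; first by rewrite gtr0_norm.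
    by rewrite normrN gtr0_norm.
  pose i0 := Ordinal kd.
  pose yy (s : R) : V := \row_i (if i == i0 then x ord0 i + s else y ord0 i).
  pose t := (y ord0 i0 - x ord0 i0 + r) / (2 * r).
  have := yr i0; rewrite ler_norml => /andP[ym yM].
  have r2 : 0 < 2 * r by rewrite mulr_gt0.
  have t01 : 0 <= t <= 1.
    by rewrite /t divr_ge0 ?(ltW r2)//= ?ler_pdivrMr//; lra.
  have yE : y = t *: yy r + (1 - t) *: yy (- r).
    apply/rowP => i; rewrite !mxE; case: eqP => [->|_]; last by ring.
    by rewrite /t; field; rewrite gt_eqF.
  have hyy s : `|s| = r -> U (yy s) /\ f (yy s) <= M.
    move=> sr; apply: IH; first exact: ltnW.
      move=> i; rewrite mxE; case: eqP => [->|_]; last exact: yr.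
      by rewrite addrC addKr sr.
    move=> i ki; rewrite mxE; case: eqP => [->|ii0]; first by rewrite addrC addKr sr.
    apply: yk; rewrite ltn_neqAle ki andbT; apply/eqP => kie.
    by apply: ii0; apply/val_inj.
  have [|U1 f1] := hyy r; first by rewrite gtr0_norm.
  have [|U2 f2] := hyy (- r); first by rewrite normrN gtr0_norm.
  split; first by rewrite yE; exact: convU.
  rewrite yE; apply: (le_trans (cvxf _ _ _ U1 U2 t01)).
  by case/andP: t01 => t0 t1; nra.
move=> y yx; apply: (key d) => // [i|i]; last by rewrite leqNgt ltn_ord.
by apply: le_trans yx; have := ler_coord_norm (y - x) i; rewrite !mxE.
Qed.

(** On the line through x and y, prolonged to the boundary of the ball on both sides, y lies between
    x and [z1], and x between y and [z2]; the two chord inequalities give the two bounds. *)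
Lemma cvx_lip_at (x : V) r M : 0 < r ->
  (forall y, `|y - x| <= r -> U y /\ f y <= M) ->
  forall y, `|y - x| <= r -> `|f x - f y| <= (M - f x) / r * `|y - x|.
Proof.
move=> r0 rM y yr.
have Ux : U x by apply: (rM x _).1; rewrite subrr normr0 ltW.
have [Uy _] := rM y yr.
have [yx|yx] := eqVneq y x; first by rewrite yx !subrr !normr0 mulr0.
pose s := `|y - x| / r.
have s0 : 0 < s by rewrite divr_gt0// normr_gt0 subr_eq0.
have s1 : s <= 1 by rewrite ler_pdivrMr// mul1r.
rewrite (_ : _ * `|_| = s * (M - f x)); last by rewrite /s; ring.
pose z1 := x + s^-1 *: (y - x); pose z2 := x - s^-1 *: (y - x).
have zr : `|s^-1 *: (y - x)| = r.
  rewrite normrZ gtr0_norm ?invr_gt0// /s invf_div mulrC mulrCA.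
  by rewrite divff ?mulr1// normr_eq0 subr_eq0.
have [U1 f1] : U z1 /\ f z1 <= M by apply: rM; rewrite addrC addKr zr.
have [U2 f2] : U z2 /\ f z2 <= M by apply: rM; rewrite addrC addKr normrN zr.
have yE : y = s *: z1 + (1 - s) *: x.
  rewrite /z1 scalerDr scalerA divff ?gt_eqF// scale1r addrAC -scalerDl.
  by rewrite addrC subrKC scale1r subrK.
have xE : x = (1 + s)^-1 *: y + (1 - (1 + s)^-1) *: z2.
  have s1n : 1 + s != 0 by rewrite gt_eqF// addr_gt0.
  apply/rowP => i; rewrite !mxE; field; apply/andP; split=> //.
  by rewrite gt_eqF.
have hy : f y <= s * f z1 + (1 - s) * f x.
  by rewrite {1}yE; apply: cvxf => //; rewrite ltW.
have ss : 0 < 1 + s by rewrite addr_gt0.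
have hx : f x <= (1 + s)^-1 * f y + (1 - (1 + s)^-1) * f z2.
  rewrite {1}xE; apply: cvxf => //; rewrite invr_ge0 (ltW ss)/= invf_le1//.
  by rewrite lerDl ltW.
have hx' : (1 + s) * f x <= f y + s * f z2.
  have := hx; rewrite -(ler_pM2l ss) mulrDr mulrA mulrV ?unitfE ?gt_eqF// mul1r.
  by rewrite mulrA mulrBr mulrV ?unitfE ?gt_eqF// mulr1 [1 + s]addrC addrK.
by rewrite ler_norml; apply/andP; split; nra.
Qed.

Lemma cvx_continuous (x : V) : U x -> {for x, continuous f}.
Proof.
move=> Ux; have [r [M [r0 rM]]] := cvx_bounded_above x Ux.
apply: (@continuous_of_lip _ _ _ _ ((M - f x) / r)).
apply/nbhs_normP; exists r => // y /= yx.
have yr : `|y - x| <= r by rewrite distrC ltW.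
apply: (le_trans (cvx_lip_at x r M r0 rM y yr)).
rewrite enormB ler_wpM2l ?ler_norm_enorm// divr_ge0 ?(ltW r0)// subr_ge0.
by apply: (rM x _).2; rewrite subrr normr0 ltW.
Qed.

End convex_analysis.

Section compact_balls.
Context {R : realType} {d : nat}.
Local Notation V := 'rV[R]_d.

Lemma near_dist_lt (g : V -> R) x (e : R) : {for x, continuous g} -> 0 < e ->
  \forall y \near x, `|g x - g y| < e.
Proof. by move=> cg e0; apply: (@cvgrPdist_lt _ R^o V (nbhs x) _ _ _).1 e e0. Qed.

Lemma near_lt (g g' : V -> R) x : {for x, continuous g} -> {for x, continuous g'} ->
  g x < g' x -> \forall y \near x, g y < g' y.
Proof.
move=> cg cg' lt; have e0 : 0 < (g' x - g x) / 2 by rewrite divr_gt0// subr_gt0.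
apply: filterS2 (near_dist_lt g x _ cg e0) (near_dist_lt g' x _ cg' e0) => y.
by rewrite !ltr_norml => /andP[? ?] /andP[? ?]; lra.
Qed.

Lemma continuous_enormB (x : V) : continuous (fun y : V => enorm (y - x)).
Proof.
move=> y; apply: (@continuous_of_lip _ _ _ _ 1); apply: filterE => z.
rewrite mul1r; apply: (le_trans (ler_dist_enorm _ _)).
by rewrite opprB addrA subrK.
Qed.

Lemma compact_norm_ball (x : V) (r : R) : compact [set y : V | `|y - x| <= r].
Proof.
apply: bounded_closed_compact.
  exists (`|x| + r); split; first by rewrite num_real.
  move=> M xM y /= yr; rewrite -(subrK x y) (le_trans (ler_normD _ _))//.
  by apply: (le_trans _ (ltW xM)); rewrite addrC lerD2l.
have cN : continuous (fun y : V => `|y - x|).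
  move=> y; apply: (@continuous_of_lip _ _ _ _ 1); apply: filterE => z.
  rewrite mul1r; apply: (le_trans (ler_dist_dist _ _)).
  by rewrite opprB addrA subrK ler_norm_enorm.
rewrite (_ : [set y | _] = (fun y : V => `|y - x|) @^-1` [set t | t <= r])//.
by apply: closed_comp; [move=> y _; exact: cN|exact: closed_le].
Qed.

Lemma compact_enorm_ball (x : V) (r : R) : compact [set y : V | enorm (y - x) <= r].
Proof.
apply: (@subclosed_compact _ _ [set y : V | `|y - x| <= r]); last first.
- by move=> y /= yr; exact: le_trans (ler_norm_enorm _) yr.
- exact: compact_norm_ball.
have cN := continuous_enormB x.
rewrite (_ : [set y | _] = (fun y : V => enorm (y - x)) @^-1` [set t | t <= r])//.
by apply: closed_comp; [move=> y _; exact: cN|exact: closed_le].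
Qed.

Lemma compact_min (K : set V) (g : V -> R) : K !=set0 -> compact K ->
  (forall x, K x -> {for x, continuous g}) ->
  exists2 c, K c & forall t, K t -> g c <= g t.
Proof.
move=> K0 cK cg; have [|c] := @EVT_min_rV R d g K K0 cK.
  by apply: continuous_in_subspaceT => x /set_mem; exact: cg.
by move=> /set_mem Kc cmin; exists c => // t Kt; apply: cmin; exact: mem_set.
Qed.

Lemma compact_max (K : set V) (g : V -> R) : compact K ->
  (forall x, K x -> {for x, continuous g}) ->
  exists M, forall t, K t -> g t <= M.
Proof.
move=> cK cg; have [K0|K0] := pselect (K !=set0); last by exists 0 => t Kt; case: K0; exists t.
have [|c _ hc] := compact_min K (fun x => - g x) K0 cK.
  by move=> x Kx; apply: continuousN; exact: cg.
by exists (g c) => t /hc; rewrite lerN2.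
Qed.

End compact_balls.

Section subgradient.
Context {R : realType} {d : nat}.
Local Notation V := 'rV[R]_d.
Variables (U : set V) (f : V -> R).
Hypothesis openU : open U.
Hypothesis convU : forall x y t, U x -> U y -> 0 <= t <= 1 ->
  U (t *: x + (1 - t) *: y).
Hypothesis cvxf : cvx U f.

(* If y0 minimises f + N |. - x|^2 on a ball around x, then -2N(y0 - x) is a
   slope of f at y0, and y0 is close to x for N large. *)
Let approx_sub (x : V) r M e : 0 < r -> 0 < e ->
  (forall y, `|y - x| <= r -> U y /\ f y <= M) ->
  exists2 p, enorm p <= 2 * (M - f x) / r &
    forall y, `|y - x| <= r -> f x - e + dot p (y - x) <= f y.
Proof.
move=> r0 e0 rM.
have lip := cvx_lip_at U f cvxf x r M r0 rM.
have xx : `|x - x| <= r by rewrite subrr normr0 ltW.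
have A0 : 0 <= M - f x by rewrite subr_ge0; exact: (rM x xx).2.
set A := M - f x in lip A0 *.
(* Chosen so that N q^2 > A for q = r e / (A + 1). The minimiser is then within q of x, where f has
   dropped by at most (A / r) q <= e. *)
pose N := (A + 1) * ((A + 1) / r / e) ^+ 2 + 1.
have N0 : 0 < N by rewrite ltr_wpDl// mulr_ge0 ?sqr_ge0// addr_ge0.
pose Phi y := f y + N * enorm (y - x) ^+ 2.
pose B := [set y : V | `|y - x| <= r].
have [|y0 By0 ymin] := @compact_min R d B Phi (ex_intro _ x xx) (compact_norm_ball x r).
  move=> y By; apply: continuousD; first exact: cvx_continuous openU convU cvxf y (rM y By).1.
  apply: continuousM; first exact: cst_continuous.
  apply: (@continuous_comp _ _ _ (fun y : V => enorm (y - x)) (fun t => t ^+ 2)).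
    exact: continuous_enormB.
  exact: exprn_continuous.
have fy0 : f x - f y0 <= A / r * `|y0 - x| := le_trans (ler_norm _) (lip y0 By0).
have fA : f x - f y0 <= A.
  apply: (le_trans fy0); rewrite -mulrA ler_piMr// ler_pdivrMl// mulr1; exact: By0.
have NA : N * enorm (y0 - x) ^+ 2 <= A.
  have := ymin x xx; rewrite /Phi subrr enorm0 expr0n /= mulr0 addr0; lra.
have fe : f x - e <= f y0.
  have small : `|y0 - x| <= r * e / (A + 1).
    apply: le_trans (ler_norm_enorm _) _.
    have A1 : 0 < A + 1 by rewrite ltr_wpDl.
    have q0 : 0 < r * e / (A + 1) by rewrite divr_gt0// mulr_gt0.
    rewrite leNgt; apply/negP => lt.
    have : (r * e / (A + 1)) ^+ 2 < enorm (y0 - x) ^+ 2.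
      by rewrite ltr_pXn2r ?nnegrE ?enorm_ge0// ltW.
    rewrite -(ltr_pM2l N0) => /lt_le_trans /(_ NA).
    rewrite (_ : N * _ = A + 1 + (r * e / (A + 1)) ^+ 2); last first.
      by rewrite /N; field; rewrite !gt_eqF.
    by have := sqr_ge0 (r * e / (A + 1)); lra.
  have : A / r * `|y0 - x| <= e.
    apply: (@le_trans _ _ (A / r * (r * e / (A + 1)))).
      by rewrite ler_wpM2l// divr_ge0// ltW.
    rewrite (_ : A / r * _ = e * (A / (A + 1))); last by field; rewrite !gt_eqF// ltr_wpDl.
    by rewrite ler_piMr ?(ltW e0)// ler_pdivrMr ?ltr_wpDl// mul1r lerDl.
  lra.
pose p := (2 * N) *: (x - y0).
have first_order y : `|y - x| <= r -> f y0 + dot p (y - y0) <= f y.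
  move=> By; rewrite -subr_ge0.
  set c := f y - _.
  (* Minimality of [y0] is tested at a point of the segment towards y. Convexity and division by t
     leave an error proportional to t, too small to be compatible with a negative [c]. *)
  have ct t : 0 < t -> t <= 1 -> - (t * (N * enorm (y - y0) ^+ 2)) <= c.
    move=> t0 t1; have Bw : `|t *: y + (1 - t) *: y0 - x| <= r.
      rewrite (_ : _ - x = t *: (y - x) + (1 - t) *: (y0 - x)); last first.
        by rewrite !scalerBr addrACA -opprD -scalerDl [t + _]addrC addrNK scale1r.
      apply: (le_trans (ler_normD _ _)); rewrite !normrZ !ger0_norm ?subr_ge0// ?(ltW t0)//.
      move: By0; rewrite /B /= => By0.
      have h1 : t * `|y - x| <= t * r by rewrite ler_wpM2l// ltW.
      have h2 : (1 - t) * `|y0 - x| <= (1 - t) * r by rewrite ler_wpM2l// subr_ge0.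
      lra.
    have := ymin _ Bw; rewrite /Phi.
    have := cvxf y y0 t (rM y By).1 (rM y0 By0).1.
    rewrite (ltW t0) t1 => /(_ isT) h1 h2.
    have e1 : enorm (t *: y + (1 - t) *: y0 - x) ^+ 2 =
      enorm (y0 - x) ^+ 2 + 2 * t * dot (y0 - x) (y - y0) + t ^+ 2 * enorm (y - y0) ^+ 2.
      rewrite (_ : _ - x = (y0 - x) + t *: (y - y0)); last first.
        by apply/rowP => i; rewrite !mxE; ring.
      rewrite !enorm_sq !(dotDl (y0 - x)) !(dotDr (y0 - x)) !dotZl !dotZr.
      by rewrite (dotC (y - y0) (y0 - x)); ring.
    rewrite e1 in h2.
    have e2 : dot p (y - y0) = - (2 * N * dot (y0 - x) (y - y0)).
      by rewrite /p dotZl -[x - y0]opprB dotNl mulrN.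
    rewrite -(ler_pM2l t0) /c e2; nra.
  rewrite leNgt; apply/negP => c0.
  set Q := N * enorm (y - y0) ^+ 2 in ct.
  have Q0 : 0 <= Q by rewrite mulr_ge0 ?sqr_ge0// ltW.
  pose t := Num.min 1 (- c / 2 / (Q + 1)).
  have t0 : 0 < t.
    by rewrite /t lt_min ltr01/= !divr_gt0 ?oppr_gt0// ltr_wpDl.
  have t1 : t <= 1 by rewrite /t ge_min lexx.
  have tQ : t * (Q + 1) <= - c / 2.
    by rewrite -ler_pdivlMr ?ltr_wpDl// /t ge_min lexx orbT.
  have := ct t t0 t1; nra.
have low y : `|y - x| <= r -> f x - e + dot p (y - x) <= f y.
  move=> By; apply: le_trans (first_order y By).
  have -> : y - y0 = (y - x) + (x - y0) by rewrite addrA subrK.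
  have : 0 <= dot p (x - y0).
    by rewrite /p dotZl mulr_ge0 ?dotxx_ge0// mulr_ge0// ltW.
  rewrite (dotDr (y - x)); lra.
exists p => //.
have [p0|p0] := eqVneq (enorm p) 0.
  by rewrite p0 divr_ge0 ?(ltW r0)// mulr_ge0.
have {}p0 : 0 < enorm p by rewrite lt_neqAle eq_sym p0 enorm_ge0.
(* At distance r from x in the direction of p, the first-order inequality and [f y <= M] bound the
   length of p independently of [e], as the compactness argument for exact slopes requires. *)
pose y := x + (r / enorm p) *: p.
have By : `|y - x| <= r.
  rewrite /y addrC addKr normrZ gtr0_norm ?divr_gt0//.
  by rewrite mulrAC ler_pdivrMr// ler_wpM2l ?ler_norm_enorm// ltW.
have := first_order y By; have := (rM y By).2.
have -> : y - y0 = (y - x) + (x - y0) by rewrite addrA subrK.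
have : 0 <= dot p (x - y0).
  by rewrite /p dotZl mulr_ge0 ?dotxx_ge0// mulr_ge0// ltW.
have yx : y - x = (r / enorm p) *: p by rewrite /y addrC addKr.
rewrite (dotDr (y - x)) yx dotZr -enorm_sq.
rewrite (_ : r / enorm p * enorm p ^+ 2 = r * enorm p); last first.
  by field; rewrite gt_eqF.
rewrite ler_pdivlMr// mulrC /A; rewrite /A in fA; lra.
Qed.

(** If no slope supported f on a small ball, all slopes in a compact set would fail by a common
    margin, against [approx_sub] with that margin as error. Convexity along segments extends a local
    support to U. *)
Lemma subgradient_ex x : U x -> exists p, sub U f x p.
Proof.
move=> Ux; have [r [M [r0 rM]]] := cvx_bounded_above U f openU convU cvxf x Ux.
pose L := 2 * (M - f x) / r.
have [[p pB]|none] := pselect (exists p, forall y, `|y - x| <= r -> f x + dot p (y - x) <= f y).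
  exists p => y Uy.
  have [yx|yx] := eqVneq y x; first by rewrite yx subrr dotC dot0l addr0.
  have n0 : 0 < `|y - x| by rewrite normr_gt0 subr_eq0.
  pose t := Num.min 1 (r / `|y - x|).
  have t0 : 0 < t by rewrite lt_min ltr01 divr_gt0.
  have t1 : t <= 1 by rewrite ge_min lexx.
  have wx : t *: y + (1 - t) *: x - x = t *: (y - x).
    by apply/rowP => i; rewrite !mxE; ring.
  have := pB (t *: y + (1 - t) *: x); rewrite wx normrZ gtr0_norm//.
  rewrite -ler_pdivlMr// ge_min lexx orbT => /(_ isT).
  have t01 : 0 <= t <= 1 by rewrite (ltW t0).
  have := cvxf y x t Uy Ux t01; rewrite dotZr => h1 h2.
  by rewrite -(ler_pM2l t0); nra.
exfalso.
have [| |p0 K0|e e0 eP] := @compact_unif R d [set p | enorm (p - 0) <= L]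
  (fun e p => exists2 y, `|y - x| <= r & f y + e < f x + dot p (y - x)).
- exact: compact_enorm_ball.
- move=> e e' p e'0 e'e [y yr hy]; exists y => //; apply: le_lt_trans hy; by rewrite lerD2l.
- have [y yr hy] : exists2 y, `|y - x| <= r & f y < f x + dot p0 (y - x).
    apply: contrapT => no; apply: none; exists p0 => y yr.
    by rewrite leNgt; apply/negP => lt; apply: no; exists y.
  pose s := f x + dot p0 (y - x) - f y.
  have s0 : 0 < s by rewrite subr_gt0.
  exists (s / 2); first by rewrite divr_gt0.
  have cd : {for p0, continuous (fun p : V => dot p (y - x))}.
    rewrite (_ : (fun p => _) = dot (y - x)); first exact: continuous_dotr.
    by apply/funext => p; rewrite dotC.
  have s20 : 0 < s / 2 by rewrite divr_gt0.
  apply: filterS (near_dist_lt _ p0 _ cd s20) => p; rewrite ltr_norml => /andP[_ h]; exists y => //.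
  by rewrite /s in h *; lra.
have [p pL low] := approx_sub x r M e r0 e0 rM.
have [|y yr hy] := eP p; first by rewrite /= subr0.
by have := low y yr; lra.
Qed.

End subgradient.

(** * Finite nets, compact exhaustions, sums over coordinates, affine functions *)

Section tools.
Context {R : realType} {d : nat}.
Local Notation V := 'rV[R]_d.

Lemma compact_net (T : eqType) (K : set V) (B : T -> Prop) (Q : T -> V -> Prop) :
  compact K ->
  (forall x, K x -> exists2 t, B t & \forall y \near x, Q t y) ->
  exists2 l : seq T, (forall t, t \in l -> B t) &
    forall x, K x -> exists2 t, t \in l & Q t x.
Proof.
move=> /compact_near_coveringP cK cover.
(* The lists containing a given finite set of elements form a filter base. *)
pose F : set_system (seq T) := [set S | exists2 l0 : seq T,
  (forall t, t \in l0 -> B t) & forall l : seq T, {subset l0 <= l} ->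
  (forall t, t \in l -> B t) -> S l].
have FF : Filter F.
  split; first by exists [::].
  - move=> S1 S2 [l1 B1 S1l] [l2 B2 S2l]; exists (l1 ++ l2).
      by move=> t; rewrite mem_cat => /orP[/B1|/B2].
    move=> l l12 Bl; split; [apply: S1l|apply: S2l] => // t tl; apply: l12;
      by rewrite mem_cat tl ?orbT.
  - move=> S1 S2 S12 [l1 B1 S1l]; exists l1 => // l l1l Bl; apply: S12; exact: S1l.
have [|l0 B0 /(_ l0)] := cK (seq T) F (fun l x => exists2 t, t \in l & Q t x) FF.
  move=> x /cover[t Bt Qt]; exists (Q t, [set l : seq T | t \in l]) => /=.
    split=> //; exists [:: t]; first by move=> s; rewrite inE => /eqP->.
    by move=> l tl _; apply: tl; rewrite inE.
  by move=> [y l] /= [Qty tl]; exists t.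
by move=> /(_ (fun t => id) B0) h; exists l0.
Qed.

(** The usual compact exhaustion of an open set. The distance to the complement is expressed through
    balls, so an empty complement is no special case. *)
Definition exh (U : set V) (n : nat) : set V :=
  [set y | `|y| <= n%:R /\ forall z, `|z - y| < n.+1%:R^-1 -> U z].

Lemma exh_sub U n : exh U n `<=` U.
Proof. by move=> y [_ h]; apply: h; rewrite subrr normr0 invr_gt0. Qed.

Lemma exh_homo U m n : (m <= n)%N -> exh U m `<=` exh U n.
Proof.
move=> mn y [ym yU]; split; first by rewrite (le_trans ym)// ler_nat.
move=> z zy; apply: yU; apply: (lt_le_trans zy).
by rewrite lef_pV2 ?posrE// ler_nat.
Qed.

Lemma exh_compact U n : compact (exh U n).
Proof.
apply: (@subclosed_compact _ _ [set y : V | `|y - 0| <= n%:R]); last first.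
- by move=> y [yn _] /=; rewrite subr0.
- exact: compact_norm_ball.
rewrite (_ : exh U n = [set y | `|y| <= n%:R] `&`
  \bigcap_(z in ~` U) [set y : V | n.+1%:R^-1 <= `|z - y|]); last first.
  apply/seteqP; split=> y /=.
    move=> [yn yU]; split=> // z zU /=; rewrite leNgt; apply/negP => zy.
    by apply: zU; exact: yU.
  move=> [yn yU]; split=> // z zy; apply: contrapT => zU.
  by have := yU z zU; rewrite /= leNgt zy.
have cN (z : V) : continuous (fun y : V => `|z - y|).
  move=> y; apply: (@continuous_of_lip _ _ _ _ 1); apply: filterE => w.
  rewrite mul1r; apply: (le_trans (ler_dist_dist _ _)).
  by rewrite opprB addrC addrA subrK -normrN opprB ler_norm_enorm.
apply: closedI.
  rewrite (_ : [set y | _] = (fun y : V => `|0 - y|) @^-1` [set t | t <= n%:R]).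
    by apply: closed_comp; [move=> y _; exact: cN|exact: closed_le].
  by apply/seteqP; split=> y /=; rewrite sub0r normrN.
apply: closed_bigI => z _.
rewrite (_ : [set y | _] = (fun y : V => `|z - y|) @^-1` [set t | n.+1%:R^-1 <= t])//.
by apply: closed_comp; [move=> y _; exact: cN|exact: closed_ge].
Qed.

Lemma exh_near U x : open U -> U x -> exists n, \forall y \near x, exh U n y.
Proof.
move=> oU Ux; have : nbhs x U by exact: open_nbhs_nbhs.
move=> /nbhs_normP[e /= e0 eU].
pose n := maxn (Num.bound (`|x| + 1)) (Num.bound (2 / e)).
exists n; apply/nbhs_normP; exists (Num.min 1 (e / 2)).
  by rewrite /= lt_min ltr01 divr_gt0.
move=> y /=; rewrite lt_min => /andP[y1 ye]; split.
  have h1 : `|x| + 1 < n%:R.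
    apply: (lt_le_trans (archi_boundP _)); first by rewrite addr_ge0.
    by rewrite ler_nat leq_maxl.
  have h2 : `|y| <= `|x - y| + `|x|.
    by rewrite (distrC x) -{1}(subrK x y) ler_normD.
  by apply: (le_trans h2); apply: ltW; apply: lt_trans h1; rewrite addrC ltrD2l.
move=> z zy; apply: eU; rewrite /ball_/=.
have h2 : 2 / e < n.+1%:R.
  apply: (lt_le_trans (archi_boundP _)); first by rewrite divr_ge0 ?(ltW e0).
  by rewrite ler_nat leqW// leq_maxr.
have h3 : n.+1%:R^-1 < e / 2.
  by rewrite -(invf_div 2) ltf_pV2 ?posrE// divr_gt0.
have h4 : `|x - z| <= `|x - y| + `|y - z|.
  by rewrite -{1}(subrK y x) -addrA ler_normD.
apply: (le_lt_trans h4); rewrite (distrC y z) [ltRHS]splitr ltrD//.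
exact: lt_trans h3.
Qed.

(** The reference strongly convex function. Its gradient is bounded by d and it grows linearly, so a
    small multiple can be added to an affine piece without making it much steeper. *)
Definition psi (x : V) : R := \sum_(i < d) bowl (x ord0 i).

Lemma coordE i : (fun x : V => x ord0 i) = dot (delta_mx ord0 i).
Proof.
apply/funext => x; rewrite /dot (bigD1 i)//= !mxE !eqxx mul1r.
by rewrite big1 ?addr0// => j ji; rewrite !mxE (negbTE ji) andbF mul0r.
Qed.

Lemma smooth_on_sumcoord (U : set V) (F : 'I_d -> R -> R) : open U ->
  (forall i, smooth1 (F i)) -> smooth_on U (fun x : V => \sum_(i < d) F i (x ord0 i)).
Proof.
move=> oU sF; apply: smooth_on_sum => // i.
apply: (@smooth_on_comp _ _ U (F i) (fun x => x ord0 i)) => //.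
rewrite coordE; exact: smooth_on_dot.
Qed.

Lemma derive_sumcoord (F F' : 'I_d -> R -> R) (x v : V) :
  (forall i (t : R), is_derive t (1 : R) (F i) (F' i t)) ->
  'D_v (fun x : V => \sum_(i < d) F i (x ord0 i)) x = \sum_(i < d) F' i (x ord0 i) * v ord0 i.
Proof.
move=> dF.
have dc i : is_derive x v (fun y : V => F i (y ord0 i)) (F' i (x ord0 i) * v ord0 i).
  have dl : differentiable (fun y : V => y ord0 i) x.
    by rewrite coordE; exact: differentiable_dot.
  have := is_derive_comp1 (F i) (fun y : V => y ord0 i) _ x v dl (dF i _).
  have -> : 'D_v (fun y : V => y ord0 i) x = v ord0 i.
    by rewrite coordE derive_dot -coordE.
  exact.
have := @is_derive_sum _ _ _ _ (fun (i : 'I_d) (y : V) => F i (y ord0 i)) x v _ dc.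
rewrite (_ : \sum_(i < d) _ = (fun x : V => \sum_(i < d) F i (x ord0 i))) => [[_ ->]//|].
by apply/funext => y; rewrite fct_sumE.
Qed.

Lemma smooth_psi (U : set V) : open U -> smooth_on U psi.
Proof. by move=> oU; apply: (@smooth_on_sumcoord U (fun=> bowl)) => // i; exact: smooth1_bowl. Qed.

Lemma psi_ge0 x : 0 <= psi x.
Proof. by apply: sumr_ge0 => i _; exact: bowl_ge0. Qed.

Lemma psi_le x : psi x <= 2 * d%:R * (1 + enorm x).
Proof.
rewrite mulrAC; apply: (@le_trans _ _ (\sum_(i < d) 2 * (1 + enorm x))).
  by apply: ler_sum => i _; apply: (le_trans (bowl_le _));
    rewrite ler_pM2l// lerD2l ler_coord_enorm.
by rewrite sumr_const card_ord -[leLHS]mulr_natr.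
Qed.

Lemma grad_sumcoord (F F' : 'I_d -> R -> R) (x : V) (a : R) :
  (forall i (t : R), is_derive t (1 : R) (F i) (F' i t)) ->
  (forall i, `|F' i (x ord0 i)| <= a) ->
  grad_le (fun x : V => \sum_(i < d) F i (x ord0 i)) x (d%:R * a).
Proof.
move=> dF Fa v; rewrite (derive_sumcoord F F')//.
apply: (@le_trans _ _ (\sum_(i < d) a * enorm v)).
  apply: ler_sum => i _; apply: (le_trans (ler_norm _)); rewrite normrM.
  by rewrite ler_pM// ler_coord_enorm.
by rewrite sumr_const card_ord -[leLHS]mulr_natl mulrA.
Qed.

Lemma grad_psi x : grad_le psi x d%:R.
Proof.
rewrite -[X in grad_le _ _ X]mulr1; apply: (grad_sumcoord (fun=> bowl) (fun=> bowl1)) => [i t|i]; first exact: is_derive_bowl.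
exact: bowl1_le.
Qed.

Lemma sumcoord_sconvex (F : 'I_d -> R -> R) (U : set V) :
  (forall A, exists2 c, 0 < c & forall i s t a, `|s| <= A -> `|t| <= A ->
    0 <= a <= 1 -> F i (a * s + (1 - a) * t) <=
      a * F i s + (1 - a) * F i t - c * (a * (1 - a)) * (s - t) ^+ 2) ->
  locally_sconvex U (fun x : V => \sum_(i < d) F i (x ord0 i)).
Proof.
move=> hF x _; have [c c0 hc] := hF (enorm x + 1); exists c; split=> //.
exists 1 => // y z t yx zx t01.
have bd (w : V) : eball x 1 w -> forall i, `|w ord0 i| <= enorm x + 1.
  move=> wx i; apply: (le_trans (ler_coord_enorm _ _)).
  have := ler_enormD (w - x) x; rewrite subrK; move: wx; rewrite /eball/=; lra.
apply: (@le_trans _ _ (\sum_(i < d) (t * F i (y ord0 i) + (1 - t) * F i (z ord0 i)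
   - c * (t * (1 - t)) * (y ord0 i - z ord0 i) ^+ 2))).
  by apply: ler_sum => i _; rewrite !mxE; apply: hc => //; exact: bd.
rewrite sumrB big_split /= -!mulr_sumr enorm_sq.
rewrite (_ : dot _ _ = \sum_(i < d) (y ord0 i - z ord0 i) ^+ 2)//.
by apply: eq_bigr => i _; rewrite !mxE expr2.
Qed.

Lemma psi_sconvex (U : set V) : locally_sconvex U psi.
Proof.
apply: (sumcoord_sconvex (fun=> bowl)) => A; have [c c0 hc] := bowl_sconvex A.
by exists c.
Qed.

Lemma sumcoord_cvx (F : 'I_d -> R -> R) (U : set V) :
  (forall i s t a, 0 <= a <= 1 ->
    F i (a * s + (1 - a) * t) <= a * F i s + (1 - a) * F i t) ->
  cvx U (fun x : V => \sum_(i < d) F i (x ord0 i)).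
Proof.
move=> hF x y t _ _ t01; rewrite !mulr_sumr -big_split.
by apply: ler_sum => i _; rewrite !mxE hF.
Qed.

Lemma psi_cvx (U : set V) : cvx U psi.
Proof.
apply: (sumcoord_cvx (fun=> bowl)) => i s t a a01; have [c c0 hc] := @bowl_sconvex R (`|s| + `|t|).
apply: (le_trans (hc s t a _ _ a01)); rewrite ?lerDl ?lerDr//.
rewrite gerBl; apply: mulr_ge0; last exact: sqr_ge0.
by case/andP: a01 => ? ?; rewrite !mulr_ge0 ?subr_ge0// ltW.
Qed.

(* Affine functions, given by their slope and constant term. *)
Definition ev (a : V * R) (x : V) : R := dot a.1 x + a.2.

Lemma smooth_ev (U : set V) a : open U -> smooth_on U (ev a).
Proof.
by move=> oU; apply: smooth_on_add => //; [exact: smooth_on_dot|exact: smooth_on_cst].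
Qed.

Lemma grad_ev a x : grad_le (ev a) x (enorm a.1).
Proof.
move=> v; rewrite (_ : ev a = dot a.1 + cst a.2)// deriveD.
- by rewrite derive_dot derive_cst addr0 dot_enorm.
- exact/diff_derivable/differentiable_dot.
- exact: derivable_cst.
Qed.

Lemma ev_conv a x y t : ev a (t *: x + (1 - t) *: y) = t * ev a x + (1 - t) * ev a y.
Proof. by rewrite /ev dotDr !dotZr; ring. Qed.

Lemma ev_cvx (U : set V) a : cvx U (ev a).
Proof. by move=> x y t _ _ _; rewrite ev_conv. Qed.

Lemma ev_lip a x y : `|ev a x - ev a y| <= enorm a.1 * enorm (x - y).
Proof.
rewrite /ev opprD addrACA subrr addr0 -dotNr -dotDr.
exact: normr_dot_enorm.
Qed.

Lemma continuous_ev a : continuous (ev a).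
Proof.
by move=> x; apply: (@continuous_of_lip _ _ _ _ (enorm a.1)); apply: filterE => y; exact: ev_lip.
Qed.

Definition minor (U : set V) (f : V -> R) (a : V * R) := forall y, U y -> ev a y <= f y.

Lemma sub_minor (U : set V) (f : V -> R) (x q : V) : sub U f x q -> minor U f (q, f x - dot q x).
Proof.
by move=> sq y /sq; rewrite dotDr dotNr /ev/=; lra.
Qed.

(** The admissible slopes no longer than [p1] form a compact set. The value [v] may differ from
    [f x], which is what [low_values] exploits. *)
Lemma minnorm (U : set V) (f : V -> R) (x : V) (v : R) (p1 : V) : (forall y, U y -> v + dot p1 (y - x) <= f y) ->
  exists2 p : V, forall y, U y -> v + dot p (y - x) <= f y &
    forall q : V, (forall y, U y -> v + dot q (y - x) <= f y) -> enorm p <= enorm q.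
Proof.
move=> hp1.
pose P := [set p : V | forall y, U y -> v + dot p (y - x) <= f y].
pose K := [set p : V | enorm (p - 0) <= enorm p1] `&` P.
have cK : compact K.
  apply: compact_closedI; first exact: compact_enorm_ball.
  rewrite (_ : P = \bigcap_(y in U) [set p | dot (y - x) p <= f y - v]); last first.
    apply/seteqP; split=> p /= hp y Uy /=; have := hp y Uy;
      by rewrite /= dotC; lra.
  apply: closed_bigI => y _.
  rewrite (_ : [set p | _] = (dot (y - x)) @^-1` [set t | t <= f y - v])//.
  by apply: closed_comp; [move=> p _; exact: continuous_dotr|exact: closed_le].
have K1 : K p1 by split=> //=; rewrite subr0.
have [|p [_ Pp] pmin] := compact_min K (@enorm R d) (ex_intro _ p1 K1) cK.
  by move=> p _; exact: continuous_enorm.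
exists p => // q hq; have [qp|/ltW pq] := leP (enorm q) (enorm p1).
  by apply: pmin; split=> //=; rewrite subr0.
by apply: le_trans pq; exact: pmin.
Qed.

End tools.

Section gluing_stages.
Context {R : realType} {d : nat}.
Local Notation V := 'rV[R]_d.
Variables (T : Type) (U : set V) (L : nat -> seq T) (t0 : T).
Variables (h : nat -> T -> V -> R) (beta : nat -> R).
Hypothesis openU : open U.
Hypothesis convU : forall x y t, U x -> U y -> 0 <= t <= 1 ->
  U (t *: x + (1 - t) *: y).
Hypothesis beta_gt0 : forall n, 0 < beta n.

Let inL n t := exists2 k, (k < size (L n))%N & t = nth t0 (L n) k.

Hypothesis L0 : inL 0 t0.
Hypothesis smoothh : forall n t, inL n t -> smooth_on U (h n t).
Hypothesis cvxh : forall n t, inL n t -> cvx U (h n t).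
Hypothesis locfin : forall x, U x -> exists n, \forall y \near x, forall m t,
  (n < m)%N -> inL m t -> exists2 t', inL n t' & h m t y + beta n <= h n t' y.

Let ind (nk : nat * nat) : nat := pickle nk.

(* Indices coding no element of a stage get a copy of the first piece, lowered
   so that it is never active. *)
Let dec i : nat * T * R :=
  if @pickle_inv (nat * nat)%type i is Some nk then
    if (nk.2 < size (L nk.1))%N then (nk.1, nth t0 (L nk.1) nk.2, 0) else (0%N, t0, 3 * beta 0)
  else (0%N, t0, 3 * beta 0).

Let H i x := h (dec i).1.1 (dec i).1.2 x - (dec i).2.
Let B i := beta (dec i).1.1.

Let decP i : inL (dec i).1.1 (dec i).1.2 /\
  ((dec i).2 = 0 \/ dec i = (0%N, t0, 3 * beta 0)).
Proof.
rewrite /dec; case: pickle_inv => [[n k]|] /=; last by split=> //; right.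
by case: ifP => kn /=; split=> //; [exists k|left|right].
Qed.

Let dec_ind n t : inL n t -> exists i, dec i = (n, t, 0).
Proof. by move=> [k kn ->]; exists (ind (n, k)); rewrite /dec /ind pickleK_inv /= kn. Qed.

Let stage_bound n : exists N, forall i, (N <= i)%N ->
  (n < (dec i).1.1)%N \/ dec i = (0%N, t0, 3 * beta 0).
Proof.
pose N := (\max_(p < n.+1) \max_(k < size (L p)) ind (p : nat, k : nat)).+1.
exists N => i Ni; rewrite /dec; case E : pickle_inv => [[m k]|] /=; last by right.
case: ifP => km /=; last by right.
left; rewrite ltnNge; apply/negP => mn.
have : i = ind (m, k).
  by have := @pickle_invK (nat * nat)%type i; rewrite E /= => <-.
move=> iE; move: Ni; rewrite ltnNge => /negP; apply.
rewrite iE.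
have mn' : (m < n.+1)%N by rewrite ltnS.
pose m' : 'I_n.+1 := Ordinal mn'.
apply: leq_trans (leq_bigmax m'); pose k' : 'I_(size (L m')) := Ordinal km.
exact: (leq_bigmax k').
Qed.

(** Pairs of a stage and a position in its list are coded by natural numbers. Only finitely many
    codes belong to stages up to n, so domination by a stage turns into domination by a bounded
    index. *)
Lemma gluing_stages : exists g : V -> R,
  (smooth_on U g /\ cvx U g) /\
  (forall x n t, U x -> inL n t -> h n t x - beta n <= g x) /\
  (forall x M, U x -> (forall n t, inL n t -> h n t x <= M) -> g x <= M) /\
  (forall x rho, U x -> (forall n t, inL n t -> grad_le (h n t) x rho \/
       exists m t', inL m t' /\ h n t x + beta n + beta m < h m t' x) -> grad_le g x rho) /\
  ((forall n t, inL n t -> strictly_convex_on U (h n t)) -> strictly_convex_on U g) /\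
  ((forall n t, inL n t -> locally_sconvex U (h n t)) -> locally_sconvex U g).
Proof.
have HE i x : H i x = h (dec i).1.1 (dec i).1.2 x + - (dec i).2 by [].
have [i0 i0E] := dec_ind 0%N t0 L0.
have [|i|i|x Ux|g [[sg cg] [lg [ug [gg [stg scg]]]]]] := @gluing R d U H B openU convU.
- by move=> i; exact: beta_gt0.
- apply: smooth_on_add => //; last exact: smooth_on_cst.
  by apply: smoothh; case: (decP i).
- move=> x y t Ux Uy t01; rewrite !HE.
  have := cvxh _ _ (decP i).1 x y t Ux Uy t01; lra.
- have [n locn] := locfin x Ux; have [N stN] := stage_bound n.
  pose N' := maxn N (\max_(k < size (L n)) ind (n, k : nat)).+1.
  exists (maxn N' i0.+1); apply: filterS locn => y locn i; rewrite geq_max => /andP[Ni i0i].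
  have [|iE] := stN i (leq_trans (leq_maxl _ _) Ni).
    move=> nm; have [t' [k kn t'E] ht'] := locn _ _ nm (decP i).1.
    exists (ind (n, k)).
      rewrite leq_max; apply/orP; left; rewrite /N' leq_max ltnS.
      by rewrite (leq_bigmax (Ordinal kn)) orbT.
    have dE : dec (ind (n, k)) = (n, t', 0) by rewrite /dec /ind pickleK_inv/= kn t'E.
    rewrite /H /B dE /= subr0; apply: le_trans ht'; rewrite lerD2r gerBl.
    by have [_ [->//|->/=]] := decP i; rewrite mulr_ge0// ltW.
  exists i0; first by rewrite leq_max ltnSn orbT.
  by rewrite /H /B iE i0E /= subr0; have := beta_gt0 0; lra.
exists g; split=> //; do ![split].
- move=> x n t Ux /dec_ind[i iE]; have := lg x i Ux; by rewrite /H /B iE /= subr0.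
- move=> x M Ux hM; apply: ug => // i; apply: le_trans (hM _ _ (decP i).1).
  by rewrite gerBl; have [_ [->//|->/=]] := decP i; rewrite mulr_ge0// ltW.
- move=> x rho Ux hgood; apply: gg => // i.
  have [_ [e0|eE]] := decP i; last first.
    (* The lowering by [3 * beta 0] exceeds the two margins [beta 0] in the gradient clause of
       [gluing]. *)
    right; exists i0; rewrite /H /B eE i0E /= subr0; have := beta_gt0 0; lra.
  have [hg|[m [t' [/dec_ind[j jE] hj]]]] := hgood _ _ (decP i).1.
    left; rewrite (_ : H i = h (dec i).1.1 (dec i).1.2)//.
    by apply/funext => y; rewrite /H e0 subr0.
  by right; exists j; rewrite /H /B jE /= e0 !subr0.
- move=> st; apply: stg => i x y t Ux Uy xy t01; rewrite !HE.
  have := st _ _ (decP i).1 x y t Ux Uy xy t01; lra.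
move=> sc; apply: scg => i x Ux; have [c [c0 [r r0 hc]]] := sc _ _ (decP i).1 x Ux.
exists c; split=> //; exists r => // y z t yr zr t01; rewrite !HE.
have := hc y z t yr zr t01; lra.
Qed.

End gluing_stages.

Section sconvex_facts.
Context {R : realType} {d : nat}.
Local Notation V := 'rV[R]_d.

(** Strong convexity near the intermediate point is strict between two neighbours of it on the
    segment; plain convexity compares these with the endpoints. *)
Lemma strictly_convex_of_sconvex (U : set V) (g : V -> R) :
  (forall x y t, U x -> U y -> 0 <= t <= 1 -> U (t *: x + (1 - t) *: y)) ->
  cvx U g -> locally_sconvex U g -> strictly_convex_on U g.
Proof.
move=> cU cg sg x y t Ux Uy xy /andP[t0 t1].
pose z s : V := s *: y + (1 - s) *: x.
have -> : (1 - t) *: x + t *: y = z t by rewrite /z addrC.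
have Uz s : 0 <= s <= 1 -> U (z s) by move=> s01; exact: cU.
have hz s : 0 <= s <= 1 -> g (z s) <= s * g y + (1 - s) * g x by move=> s01; exact: cg.
have t01 : 0 <= t <= 1 by rewrite !ltW.
have [c [c0 [r r0 hc]]] := sg (z t) (Uz t t01).
have n0 : 0 < enorm (y - x).
  rewrite lt_neqAle enorm_ge0 andbT eq_sym; apply/eqP => /enorm_eq0 /eqP.
  by rewrite subr_eq0 => /eqP yx; apply: xy.
have nn : enorm (y - x) != 0 by rewrite gt_eqF.
pose e := Num.min (Num.min t (1 - t)) (r / 2 / enorm (y - x)).
have e0 : 0 < e by rewrite !lt_min t0 subr_gt0 t1 !divr_gt0.
have et : e <= t by rewrite /e !ge_min lexx.
have et1 : e <= 1 - t by rewrite /e !ge_min lexx orbT.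
have er : e * enorm (y - x) < r.
  apply: (@le_lt_trans _ _ (r / 2)); last by lra.
  by rewrite -ler_pdivlMr// /e !ge_min lexx !orbT.
have zB s s' : z s - z s' = (s - s') *: (y - x).
  by apply/rowP => i; rewrite /z !mxE; ring.
have b s : `|s - t| <= e -> eball (z t) r (z s).
  move=> st; rewrite /eball/= zB enormZ; apply: le_lt_trans er.
  by rewrite ler_wpM2r ?enorm_ge0.
have bp : eball (z t) r (z (t + e)) by apply: b; rewrite addrAC subrr add0r gtr0_norm.
have bm : eball (z t) r (z (t - e)).
  by apply: b; rewrite addrAC subrr add0r normrN gtr0_norm.
have h2 : 0 <= (1 / 2 : R) <= 1 by apply/andP; split; lra.
have := hc _ _ _ bp bm h2.
have -> : (1 / 2) *: z (t + e) + (1 - 1 / 2) *: z (t - e) = z t.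
  by apply/rowP => i; rewrite /z !mxE; field.
have : 0 < c * (1 / 2 * (1 - 1 / 2)) * enorm (z (t + e) - z (t - e)) ^+ 2.
  rewrite zB enormZ (_ : t + e - (t - e) = 2 * e); last by ring.
  have e20 : 0 < 2 * e by rewrite mulr_gt0.
  apply: mulr_gt0; first by apply: mulr_gt0 => //; lra.
  by rewrite exprn_gt0// mulr_gt0// normr_gt0 gt_eqF.
have p1 : 0 <= t + e <= 1 by apply/andP; split; lra.
have p2 : 0 <= t - e <= 1 by apply/andP; split; lra.
have := hz _ p1; have := hz _ p2; lra.
Qed.

Lemma psi_strict (U : set V) : strictly_convex_on U (@psi R d).
Proof.
move=> x y t _ _ xy t01.
apply: (@strictly_convex_of_sconvex setT) => //; [exact: psi_cvx|exact: psi_sconvex].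
Qed.

End sconvex_facts.

Section sums.
Context {R : realType} {d : nat}.
Local Notation V := 'rV[R]_d.
Implicit Types (U : set V) (f g : V -> R).

Lemma smooth_differentiable U g x : smooth_on U g -> U x -> differentiable g x.
Proof. by move=> /(_ 1%N)[sg _]; exact: sg. Qed.

Lemma grad_le_perturb f g x (a b k c : R) : differentiable f x -> differentiable g x ->
  0 <= k -> grad_le f x a -> grad_le g x b ->
  grad_le (fun y => f y + c + k * g y) x (a + k * b).
Proof.
move=> df dg k0 fa gb v.
have Df : is_derive x v f ('D_v f x) by apply: derivableP; exact: diff_derivable.
have Dg : is_derive x v g ('D_v g x) by apply: derivableP; exact: diff_derivable.
have Dc : is_derive x v (cst c : V -> R) (0 : R) by exact: is_derive_cst.
have [_] := is_deriveD (is_deriveD Df Dc) (is_deriveZ k Dg).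
rewrite (_ : (f + cst c + k *: g) = (fun y => f y + c + k * g y))// => ->.
rewrite /GRing.scale/= addr0 mulrDl lerD ?fa// -mulrA ler_wpM2l//.
Qed.

Lemma cvx_perturb U f g (k c : R) : 0 <= k -> cvx U f -> cvx U g ->
  cvx U (fun y => f y + c + k * g y).
Proof.
move=> k0 cf cg x y t Ux Uy t01; have := cf x y t Ux Uy t01.
have := ler_wpM2l k0 (cg x y t Ux Uy t01); lra.
Qed.

Lemma strictly_convex_perturb U f g (k c : R) : 0 < k -> cvx U f -> strictly_convex_on U g ->
  strictly_convex_on U (fun y => f y + c + k * g y).
Proof.
move=> k0 cf cg x y t Ux Uy xy t01.
have := cg x y t Ux Uy xy t01; rewrite -(ltr_pM2l k0).
have t01' : 0 <= 1 - t <= 1 by case/andP: t01 => ? ?; apply/andP; split; lra.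
have := cf x y _ Ux Uy t01'; rewrite subKr; lra.
Qed.

Lemma locally_sconvex_perturb U f g (k c : R) : 0 < k ->
  open U -> cvx U f -> locally_sconvex U g ->
  locally_sconvex U (fun y => f y + c + k * g y).
Proof.
move=> k0 oU cf cg x Ux; have [e [e0 [r r0 h]]] := cg x Ux.
have : nbhs x U by exact: open_nbhs_nbhs.
move=> /nbhs_normP[e' /= e'0 eU].
exists (k * e); split; first exact: mulr_gt0.
exists (Num.min r e'); first by rewrite lt_min r0.
move=> y z t; rewrite /eball/= !lt_min => /andP[yr ye] /andP[zr ze] t01.
have inU w : enorm (w - x) < e' -> U w.
  move=> we; apply: eU; rewrite /ball_/= distrC.
  exact: le_lt_trans (ler_norm_enorm _) we.
have := cf y z t (inU y ye) (inU z ze) t01.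
have := ler_wpM2l (ltW k0) (h y z t yr zr t01); lra.
Qed.

End sums.

(** * Approximation by a family of modified minorants *)

Lemma bump_ge0 {R : realType} (e z : R) : 0 <= e -> 0 <= e * (1 - (1 + z ^+ 2)^-1).
Proof.
move=> e0; rewrite mulr_ge0// subr_ge0 invf_le1 ?ltr_wpDr ?sqr_ge0//.
by rewrite lerDl sqr_ge0.
Qed.

Section family.
Context {R : realType} {d : nat}.
Local Notation V := 'rV[R]_d.
Variables (U : set V) (f : V -> R).
Variables (LL : V * R -> Prop) (incl : Prop) (s0 : V -> R) (r0 e1 J : R).
Variables (Um : R -> R) (tm : R -> V * R).

(** Increasing on [r0, +oo) with values between J and J + e1. It is quadratic in nu - r0 near r0, so
    a linear gain in value outweighs it there. *)
Definition phi (nu : R) := J + e1 * (1 - (1 + (nu - r0) ^+ 2)^-1).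

(* A minorant of slope nu is mixed with the gap [Um nu * f - tm nu >= 0], which
   shortens its slope, and lowered by [phi nu], so that steeper minorants are
   lowered more. *)
Definition mixed lam (a : V * R) : V * R :=
  let nu := enorm a.1 in
  ((1 - lam * Um nu) *: a.1 + lam *: (tm nu).1,
   (1 - lam * Um nu) * a.2 + lam * (tm nu).2 - phi nu).

Definition piece lam (o : option (V * R)) (x : V) :=
  if o is Some a then ev (mixed lam a) x else s0 x.

Definition okp (o : option (V * R)) :=
  if o is Some a then LL a /\ r0 < enorm a.1 else incl.

Definition Psi lam (x : V) := sup [set piece lam o x | o in okp].

(* [s0] is a special piece, used when [incl] holds, which takes care of the
   points having a support of the least possible slope [r0]. *)
Record family_spec := FamilySpec {
  openU : open U;
  convU : forall x y t, U x -> U y -> 0 <= t <= 1 -> U (t *: x + (1 - t) *: y);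
  cvxf : cvx U f;
  J_ge0 : 0 <= J;
  e1_gt0 : 0 < e1;
  LL_minor : forall a, LL a -> minor U f a;
  LL_sub : forall x q, U x -> sub U f x q -> LL (q, f x - dot q x);
  small_sub : forall x q, U x -> sub U f x q -> enorm q <= r0 -> incl /\ f x <= s0 x;
  Um_01 : forall nu, r0 < nu -> 0 <= Um nu <= 1;
  tm_le : forall nu y, r0 < nu -> U y -> ev (tm nu) y <= Um nu * f y;
  mix_homo : forall nu nu' y, r0 < nu -> nu <= nu' -> U y ->
    Um nu * f y - ev (tm nu) y <= Um nu' * f y - ev (tm nu') y;
  (* Multiplied by [lam], this [s] is the amount by which mixing shortens slopes of length at least
     [rho]. *)
  mix_slope : forall rho, r0 < rho -> exists2 s, 0 < s &
    forall nu, rho <= nu -> enorm (tm nu).1 + s <= nu * Um nu;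
  mix_bounded : forall K, compact K -> K `<=` U -> exists B, forall nu y,
    r0 < nu -> K y -> Um nu * f y - ev (tm nu) y <= B;
  (* Near r0 the shortening degenerates. This clause keeps such pieces from being nearly maximal. *)
  low_slopes : forall lam x, 0 < lam -> lam <= 1 / 2 -> U x ->
    exists r T, [/\ r0 < r, 0 < T & forall a, okp (Some a) -> enorm a.1 < r ->
      exists2 o, okp o & ev (mixed lam a) x + T <= piece lam o x];
  special : incl -> [/\ smooth_on U s0, cvx U s0, forall x, U x -> s0 x <= f x &
    forall x q, U x -> sub U f x q -> grad_le s0 x (enorm q)] }.

Hypothesis spec : family_spec.
Let oU := openU spec.
Let cU := convU spec.
Let cf := cvxf spec.

Let phi_ge0 nu : 0 <= phi nu.
Proof. by rewrite addr_ge0 ?(J_ge0 spec)// bump_ge0// ltW// (e1_gt0 spec). Qed.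

Lemma phi_le nu : phi nu <= J + e1.
Proof.
rewrite lerD2l ler_piMr ?(ltW (e1_gt0 spec))// gerBl invr_ge0 addr_ge0//.
exact: sqr_ge0.
Qed.

(** The function [phi] flattens at infinity, so the margin depends on an upper bound [rho] for the
    slopes; it comes from 1/b - 1/a = (a - b) / (a b). *)
Let phi_gap rho s : 0 < s -> exists2 mu, 0 < mu & forall nu q,
  nu <= rho -> r0 <= q -> q <= nu - s -> phi q + mu <= phi nu.
Proof.
move=> s_gt0; pose A := 1 + (rho - r0) ^+ 2.
have A0 : 0 < A by rewrite ltr_wpDr ?sqr_ge0.
exists (e1 * (s ^+ 2 / A ^+ 2)).
  by rewrite mulr_gt0 ?(e1_gt0 spec)// divr_gt0 ?exprn_gt0.
move=> nu q nur rq qs; rewrite /phi -addrA lerD2l -mulrDr.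
rewrite ler_pM2l ?(e1_gt0 spec)//.
set a := 1 + (nu - r0) ^+ 2; set b := 1 + (q - r0) ^+ 2.
have a0 : 0 < a by rewrite ltr_wpDr ?sqr_ge0.
have b0 : 0 < b by rewrite ltr_wpDr ?sqr_ge0.
have aA : a <= A.
  have h1 : 0 <= nu - r0 by lra.
  have h2 : nu - r0 <= rho - r0 by lra.
  by rewrite lerD2l !expr2 ler_pM.
have ba : b + s ^+ 2 <= a by rewrite /a /b; nra.
have : s ^+ 2 / A ^+ 2 <= (a - b) / (a * b).
  rewrite ler_pdivlMr ?mulr_gt0// mulrAC ler_pdivrMr ?exprn_gt0//.
  have : s ^+ 2 <= a - b by lra.
  have : a * b <= A ^+ 2.
    rewrite expr2 ler_pM ?(ltW a0) ?(ltW b0)//; have := sqr_ge0 s; lra.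
  have := mulr_gt0 a0 b0; have := sqr_ge0 s; nra.
rewrite (_ : (a - b) / (a * b) = b^-1 - a^-1); last by field; rewrite !gt_eqF.
lra.
Qed.

Lemma ev_mixed lam a x : ev (mixed lam a) x =
  (1 - lam * Um (enorm a.1)) * ev a x + lam * ev (tm (enorm a.1)) x - phi (enorm a.1).
Proof. by rewrite /ev /mixed /= dotDl !dotZl; ring. Qed.

Section fixed_lam.
Variable lam : R.
Hypotheses (lam_gt0 : 0 < lam) (lam_le : lam <= 1 / 2).

Let lamU nu : r0 < nu -> 0 <= lam * Um nu <= 1 / 2.
Proof.
move=> /(Um_01 spec)/andP[u0 u1]; rewrite mulr_ge0 ?(ltW lam_gt0)//=.
by rewrite -[leRHS]mulr1 ler_pM// ltW.
Qed.

(** As [lam * Um nu] is at most 1/2, half of the gap [f x - ev a x] survives the mixing; it later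
    absorbs the multiples of [psi]. *)
Lemma mixed_le a x : okp (Some a) -> U x ->
  ev (mixed lam a) x + phi (enorm a.1) + (f x - ev a x) / 2 +
  lam * (Um (enorm a.1) * f x - ev (tm (enorm a.1)) x) <= f x.
Proof.
move=> [La ra] Ux; rewrite ev_mixed.
have := LL_minor spec _ La x Ux; have /andP[] := lamU _ ra.
set u := lam * _ => u0 u2 h; rewrite mulrBr mulrA -/u.
have : 0 <= (1 / 2 - u) * (f x - ev a x) by rewrite mulr_ge0 ?subr_ge0.
lra.
Qed.

Let mix_ge0 nu y : r0 < nu -> U y -> 0 <= Um nu * f y - ev (tm nu) y.
Proof. by move=> rn Uy; rewrite subr_ge0 (tm_le spec). Qed.

Lemma piece_le o x : okp o -> U x -> piece lam o x <= f x.
Proof.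
case: o => [a|] oko Ux /=; last by have [_ _ h _] := special spec oko; exact: h.
have := mixed_le a x oko Ux; have := phi_ge0 (enorm a.1).
have := LL_minor spec _ oko.1 x Ux; have := mix_ge0 _ x oko.2 Ux => h0 h1 h2.
have := mulr_ge0 (ltW lam_gt0) h0; lra.
Qed.

Let sub_ok x q : U x -> sub U f x q -> r0 < enorm q ->
  okp (Some (q, f x - dot q x)).
Proof. by move=> Ux sq rq; split=> //; exact: (LL_sub spec _ _ Ux sq). Qed.

Lemma okp_ex x : U x -> exists o, okp o.
Proof.
move=> Ux; have [q sq] := subgradient_ex U f oU cU cf x Ux.
have [qr|rq] := leP (enorm q) r0.
  by exists None; have [] := small_sub spec _ _ Ux sq qr.
by exists (Some (q, f x - dot q x)); exact: sub_ok.
Qed.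

Lemma Psi_ub o x : okp o -> U x -> piece lam o x <= Psi lam x.
Proof.
move=> oko Ux; apply: sup_upper_bound; last by exists o.
split; first by exists (piece lam o x), o.
by exists (f x); move=> _ [p okp' <-]; exact: piece_le.
Qed.

Lemma Psi_lub x M : U x -> (forall o, okp o -> piece lam o x <= M) -> Psi lam x <= M.
Proof.
move=> Ux hM; have [p okp'] := okp_ex x Ux.
apply: sup_le_ub; first by exists (piece lam p x), p.
by move=> _ [p' okp2 <-]; exact: hM.
Qed.

Lemma Psi_adherent x e : U x -> 0 < e ->
  exists2 o, okp o & Psi lam x - e < piece lam o x.
Proof.
move=> Ux e0; apply: contrapT => no.
have : Psi lam x <= Psi lam x - e.
  apply: Psi_lub => // o oko; rewrite leNgt; apply/negP => lt; apply: no.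
  by exists o.
by rewrite lerDl oppr_ge0 leNgt e0.
Qed.

Lemma Psi_cvx : cvx U (Psi lam).
Proof.
move=> x y t Ux Uy t01; apply: Psi_lub; first exact: cU.
move=> o oko; apply: (@le_trans _ _ (t * piece lam o x + (1 - t) * piece lam o y)).
  case: o oko => [a|] oko /=; first by rewrite ev_conv.
  by have [_ cs _ _] := special spec oko; exact: cs.
have /andP[t0 t1] := t01.
by rewrite lerD// ler_wpM2l ?subr_ge0// Psi_ub.
Qed.

Lemma Psi_cont x : U x -> {for x, continuous (Psi lam)}.
Proof. exact: cvx_continuous oU cU Psi_cvx x. Qed.

(** At x the piece of the support q falls short of [f x] only by its [phi] and its mixing gap, and
    the gap is no larger than that of the steeper [a]. If q has length at most r0, the special piece
    takes over. *)
Lemma Psi_sub a x q : okp (Some a) -> U x -> sub U f x q -> enorm q <= enorm a.1 ->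
  ev (mixed lam a) x + (phi (enorm a.1) - phi (enorm q)) + (f x - ev a x) / 2
    <= Psi lam x.
Proof.
move=> oka Ux sq qa; have := mixed_le a x oka Ux.
have [qr|rq] := leP (enorm q) r0.
  have [inc fs] := small_sub spec _ _ Ux sq qr.
  have := Psi_ub None x inc Ux => /=; have := phi_ge0 (enorm q).
  have := mulr_ge0 (ltW lam_gt0) (mix_ge0 _ x oka.2 Ux); lra.
have := Psi_ub _ x (sub_ok x q Ux sq rq) Ux; rewrite /= ev_mixed /=.
have -> : ev (q, f x - dot q x) x = f x by rewrite /ev /= addrC subrK.
have := mix_homo spec _ _ x rq qa Ux.
rewrite -(ler_pM2l lam_gt0); lra.
Qed.

(** Slopes near r0 are excluded by [low_slopes]. A very steep minorant stays below an upper bound of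
    f on a ball, so it is very low at points from which it can climb inside the ball. *)
Let near_window K : compact K -> K `<=` U -> exists2 e, 0 < e & forall y, K y ->
  forall a, okp (Some a) -> enorm a.1 <= r0 + e \/ e^-1 <= enorm a.1 ->
  ev (mixed lam a) y + e <= Psi lam y.
Proof.
move=> cK KU; apply: compact_unif => //.
  move=> e e' x e'0 e'e h a oka ha.
  have e0 := lt_le_trans e'0 e'e.
  have : ev (mixed lam a) x + e <= Psi lam x.
    apply: h => //; case: ha => [ha|ha]; [left|right].
      by rewrite (le_trans ha)// lerD2l.
    by apply: le_trans ha; rewrite lef_pV2.
  lra.
move=> x /KU Ux.
have [r [T [rr T0 hT]]] := low_slopes spec lam x lam_gt0 lam_le Ux.
have [rx [M [rx0 hM]]] := cvx_bounded_above U f oU cU cf x Ux.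
(* A slope above Q costs at least rx Q / 4 = |M| + |Psi lam x| + 3 after mixing: enough to fall
   below [Psi lam y], which is at least [Psi lam x - 1], by a further 1. *)
pose Q := 4 * (`|M| + `|Psi lam x| + 3) / rx.
have Q0 : 0 < Q by rewrite divr_gt0// mulr_gt0// ltr_wpDl// addr_ge0.
have Cx := Psi_cont x Ux.
pose rr1 := `|r|.
exists (Num.min (Num.min (T / 2) ((r - r0) / 2)) (Num.min 1 Q^-1)).
  by rewrite !lt_min !divr_gt0//= ?subr_gt0// ltr01 invr_gt0.
set e := Num.min _ _.
have eT : e <= T / 2 by rewrite /e !ge_min lexx.
have er : e <= (r - r0) / 2 by rewrite /e !ge_min lexx ?orbT.
have e1' : e <= 1 by rewrite /e !ge_min lexx ?orbT.
have eQ : e <= Q^-1 by rewrite /e !ge_min lexx ?orbT.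
have e0 : 0 < e by rewrite /e !lt_min !divr_gt0//= ?subr_gt0// ltr01 invr_gt0.
have T40 : 0 < T / 4 by rewrite divr_gt0.
have n1 := near_dist_lt _ x _ Cx T40.
have n2 := near_dist_lt _ x _ Cx ltr01.
pose q := Num.min (rx / 2) (T / 4 / (rr1 + 1)).
have r10 : 0 < rr1 + 1 by rewrite ltr_wpDl// normr_ge0.
have q0 : 0 < q by rewrite lt_min divr_gt0// divr_gt0.
have n3 : \forall y \near x, enorm (y - x) < q.
  have := near_dist_lt _ x q (continuous_enormB x x) q0.
  by apply: filterS => y; rewrite subrr enorm0 sub0r normrN ger0_norm// enorm_ge0.
apply: filterS3 n1 n2 n3 => y h1 h2 h3 a oka; case: oka => La ra ha.
have Uy : U y.
  apply: (hM y _).1; apply: (le_trans (ler_norm_enorm _)); apply: (le_trans (ltW h3)).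
  by rewrite /q ge_min; apply/orP; left; lra.
have /andP[u0 u2] := lamU _ ra.
have mn : enorm (mixed lam a).1 <= enorm a.1.
  have [s s_gt0 hs] := mix_slope spec _ ra.
  have := hs _ (lexx _); rewrite /mixed /= => hs'.
  apply: (le_trans (ler_enormD _ _)); rewrite !enormZ (gtr0_norm lam_gt0) ger0_norm; last by lra.
  have : lam * enorm (tm (enorm a.1)).1 <= lam * (enorm a.1 * Um (enorm a.1)).
    by rewrite ler_pM2l//; lra.
  lra.
case: ha => ha.
  have ar : enorm a.1 < r by lra.
  have [p okp' ho] := hT a (conj La ra) ar.
  have := ev_lip (mixed lam a) y x; rewrite ler_norml => /andP[_ hl].
  have : enorm (mixed lam a).1 * enorm (y - x) <= T / 4.
    apply: (@le_trans _ _ (rr1 * (T / 4 / (rr1 + 1)))).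
      rewrite ler_pM ?enorm_ge0//; first by rewrite (le_trans mn)// (le_trans (ltW ar)) // ler_norm.
      by rewrite (le_trans (ltW h3))// ge_min lexx orbT.
    rewrite mulrCA ler_piMr ?(ltW T40)// ler_pdivrMr ?mul1r ?lerDl// ltr_wpDl//.
  have := Psi_ub p x okp' Ux; move: h1; rewrite ltr_norml => /andP[h1 h1']; lra.
have an0 : 0 < enorm a.1 by apply: lt_le_trans ha; rewrite invr_gt0.
(* The point reached from y by climbing along [a.1] within the ball, where [ev a z <= M]. *)
pose z := y + (rx / 2 / enorm a.1) *: a.1.
have zx : `|z - x| <= rx.
  rewrite /z addrAC; apply: (le_trans (ler_normD _ _)).
  have hq : q <= rx / 2 by rewrite /q ge_min lexx.
  have p1 := le_trans (ler_norm_enorm (y - x)) (ltW h3).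
  have : `|(rx / 2 / enorm a.1) *: a.1| <= rx / 2.
    rewrite normrZ gtr0_norm ?divr_gt0// mulrAC ler_pdivrMr// ler_pM2l ?divr_gt0//.
    exact: ler_norm_enorm.
  move=> p2; have := lerD p1 p2; rewrite /=; lra.
have [Uz fz] := hM z zx.
have az : ev a z = ev a y + rx / 2 * enorm a.1.
  rewrite /z /ev dotDr dotZr -enorm_sq expr2 mulrA divfK ?gt_eqF//; ring.
have lz := le_trans (LL_minor spec _ La z Uz) fz.
have fy : f y <= M.
  apply: (hM y _).2; apply: (le_trans (ler_norm_enorm _)); apply: (le_trans (ltW h3)).
  by rewrite /q ge_min; apply/orP; left; lra.
have := tm_le spec _ y ra Uy; rewrite -(ler_pM2l lam_gt0) mulrA => ht.
rewrite ev_mixed; have := phi_ge0 (enorm a.1) => ph.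
set u := lam * Um (enorm a.1) in u0 u2 ht *.
have p1 : u * f y <= u * M by rewrite ler_wpM2l.
have p2 : (1 - u) * ev a y <= (1 - u) * (M - rx / 2 * enorm a.1).
  by rewrite ler_wpM2l; lra.
have p3 : 1 / 2 * (rx / 2 * enorm a.1) <= (1 - u) * (rx / 2 * enorm a.1).
  by rewrite ler_wpM2r ?mulr_ge0 ?divr_ge0 ?(ltW rx0) ?enorm_ge0//; lra.
have p4 : rx * Q <= rx * enorm a.1.
  rewrite ler_pM2l// (le_trans _ ha)// -[leLHS]invrK lef_pV2 ?posrE//.
  by rewrite invr_gt0.
have p5 : rx * Q = 4 * (`|M| + `|Psi lam x| + 3).
  by rewrite /Q mulrC divfK// gt_eqF.
have := ler_norm M; have := ler_norm (- Psi lam x); rewrite normrN.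
move: h2; rewrite ltr_norml => /andP[h2 h2']; lra.
Qed.

(* The slopes of the pieces that are nearly maximal somewhere on K stay away
   from [r0] and from infinity. For such a piece a, either the slope of the mixed
   piece is shorter than the support q at x, or q is noticeably shorter than the
   slope of a, and then the piece of q is noticeably higher than that of a at x. *)
Lemma near_margin K : compact K -> K `<=` U -> exists2 mu, 0 < mu &
  forall a, okp (Some a) -> (exists2 y, K y & Psi lam y - mu < ev (mixed lam a) y) ->
  forall x q, U x -> sub U f x q -> enorm (mixed lam a).1 + mu <= enorm q \/
    ev (mixed lam a) x + mu + (f x - ev a x) / 2 <= Psi lam x.
Proof.
move=> cK KU; have [e e0 he] := near_window K cK KU.
have re : r0 < r0 + e by rewrite ltrDl.
have [s s_gt0 hs] := mix_slope spec _ re.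
(* Two times s' is at most the shortening lam s, so a slope q longer than |a.1| - s' exceeds the
   mixed slope by s'. Having s' <= e allows r0 to stand in for q in [phi_gap]. *)
pose s' := Num.min (lam * s / 2) e.
have ls0 : 0 < lam * s by rewrite mulr_gt0.
have s'0 : 0 < s' by rewrite lt_min e0 divr_gt0.
have s'e : s' <= e by rewrite ge_min lexx orbT.
have s's : s' <= lam * s / 2 by rewrite ge_min lexx.
have [mu mu0 hmu] := phi_gap e^-1 s' s'0.
pose m := Num.min mu s'.
have m_mu : m <= mu by rewrite ge_min lexx.
have ms : m <= s' by rewrite ge_min lexx orbT.
exists m; first by rewrite lt_min mu0.
move=> a oka [y Ky hy] x q Ux sq.
have ar : r0 + e < enorm a.1.
  rewrite ltNge; apply/negP => ae; have := he y Ky a oka (or_introl ae); lra.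
have ae : enorm a.1 < e^-1.
  rewrite ltNge; apply/negP => ae; have := he y Ky a oka (or_intror ae); lra.
have [La ra] := oka; have /andP[u0 u2] := lamU _ ra.
have mn : enorm (mixed lam a).1 <= enorm a.1 - lam * s.
  have hs' := hs _ (ltW ar).
  rewrite /mixed /=; apply: (le_trans (ler_enormD _ _)).
  rewrite !enormZ (gtr0_norm lam_gt0) ger0_norm; last by lra.
  have : lam * (enorm (tm (enorm a.1)).1 + s) <= lam * (enorm a.1 * Um (enorm a.1)).
    by rewrite ler_pM2l.
  lra.
have [qa|qa] := leP (enorm q) (enorm a.1 - s'); last by left; lra.
right; have [qr|rq] := leP (enorm q) r0.
  have [inc fs] := small_sub spec _ _ Ux sq qr.
  have := Psi_ub None x inc Ux => /=; have := mixed_le a x oka Ux.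
  have := mulr_ge0 (ltW lam_gt0) (mix_ge0 _ x oka.2 Ux).
  have h1 : r0 <= enorm a.1 - s' by lra.
  have := hmu _ r0 (ltW ae) (lexx _) h1; have := phi_ge0 r0; lra.
have qa' : enorm q <= enorm a.1 by lra.
have := Psi_sub a x q oka Ux sq qa'; have := hmu _ _ (ltW ae) (ltW rq) qa; lra.
Qed.

End fixed_lam.

Variable str : Prop.
Hypothesis growth : str -> forall a, okp (Some a) -> exists2 C, 0 < C & exists D,
  forall y, U y -> C * psi y - D <= f y - ev a y.

(** The bounds make the added multiple of [psi] small on K, absorbed on U by the half gap left in
    [mixed_le], and nearly harmless for the slope, d being the gradient bound of [psi]. If [str]
    fails the multiple is 0. *)
Lemma kap_ex a (K : set V) e : okp (Some a) -> compact K -> 0 < e -> exists2 k, 0 <= k &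
  (str -> 0 < k) /\ [/\ forall y, K y -> k * psi y <= e,
    forall y, U y -> k * psi y <= e + (f y - ev a y) / 2 & k * d%:R <= e].
Proof.
move=> oka cK e0; have [st|nst] := pselect str; last first.
  exists 0 => //; split=> //; split=> [y _|y Uy|]; rewrite mul0r ?(ltW e0)//.
  have := LL_minor spec a oka.1 y Uy; lra.
have [C C0 [D hD]] := growth st a oka.
have [P [P0 hP]] : exists P, 0 <= P /\ forall y, K y -> psi y <= P.
  have cpsi y : K y -> {for y, continuous (@psi R d)}.
    by move=> _; exact: (@smooth_psi R d setT openT 0%N y I).
  have [P hP] := compact_max K (@psi R d) cK cpsi; exists `|P|; split=> // y Ky.
  by apply: le_trans (hP y Ky) _; exact: ler_norm.
have D0 : 0 < `|D| / C + 1 by rewrite ltr_wpDl// divr_ge0 ?(ltW C0).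
have P1 : 0 < P + 1 by lra.
have d1 : 0 < d%:R + 1 :> R by rewrite ltr_wpDl.
pose k := Num.min (Num.min (C / 2) (e / (`|D| / C + 1))) (Num.min (e / (P + 1)) (e / (d%:R + 1))).
have k0 : 0 < k by rewrite !lt_min !divr_gt0.
have kC : k <= C / 2 by rewrite /k !ge_min lexx.
have kD : k * (`|D| / C + 1) <= e by rewrite -ler_pdivlMr// /k !ge_min lexx orbT.
have kP : k * (P + 1) <= e by rewrite -ler_pdivlMr// /k !ge_min lexx !orbT.
have kd : k * (d%:R + 1) <= e by rewrite -ler_pdivlMr// /k !ge_min lexx !orbT.
exists k; first exact: ltW.
split=> //; split=> [y Ky|y Uy|].
- apply: le_trans kP; rewrite ler_pM2l//; have := hP y Ky; lra.
- have := hD y Uy; have := LL_minor spec a oka.1 y Uy; set w := f y - ev a y => h1 h2.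
  have w0 : 0 <= w by rewrite /w subr_ge0.
  have : k * psi y <= k * ((w + `|D|) / C).
    rewrite ler_pM2l// ler_pdivlMr//; have := ler_norm D; lra.
  have : k / C * w <= 1 / 2 * w by rewrite ler_wpM2r// ler_pdivrMr//; lra.
  lra.
- lra.
Qed.

(* Pieces from finite nets on the sets of an exhaustion are glued; those of later
   stages are raised less, so that they are inactive on the earlier sets. When
   [str] holds, the affine pieces are perturbed by multiples of [psi], which the
   growth of [f - ev a] absorbs. *)
Lemma inner_approx lam n0 c0 : 0 < lam -> lam <= 1 / 2 -> exh U n0 !=set0 -> 0 < c0 ->
  exists h : V -> R,
  [/\ smooth_on U h, cvx U h, forall x, U x -> Psi lam x <= h x,
    forall x, U x -> h x <= f x + 2 * c0 &
    forall x, exh U n0 x -> h x <= Psi lam x + 2 * c0] /\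
  (forall x q, U x -> sub U f x q -> grad_le h x (enorm q)) /\
  (str -> (incl -> strictly_convex_on U s0) -> strictly_convex_on U h) /\
  (str -> (incl -> locally_sconvex U s0) -> locally_sconvex U h).
Proof.
move=> lam0 lam1 [x0 Kx0] c00.
pose K n := exh U (n0 + n).
have KU n : K n `<=` U by exact: exh_sub.
have cK n : compact (K n) by exact: exh_compact.
have Khomo m n : (m <= n)%N -> K m `<=` K n by move=> mn; apply: exh_homo; rewrite leq_add2l.
have mu_ex n : exists mu, 0 < mu /\
  forall a, okp (Some a) -> (exists2 y, K n y & Psi lam y - mu < ev (mixed lam a) y) ->
  forall x q, U x -> sub U f x q -> enorm (mixed lam a).1 + mu <= enorm q \/
    ev (mixed lam a) x + mu + (f x - ev a x) / 2 <= Psi lam x.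
  by have [mu mu0 h] := near_margin lam lam0 lam1 (K n) (cK n) (KU n); exists mu.
have {mu_ex}[mu hmu] := choice mu_ex.
have mu_gt0 n : 0 < mu n by case: (hmu n).
(* The lift of stage n. Halving keeps later stages below on [K n]; the bound [mu n / 8] leaves room
   in the margin for the net error, the multiple of [psi] and the gluing errors; the bound [c0]
   limits the excess over f. *)
pose c := fix c n : R := if n is m.+1 then Num.min (c m / 2) (mu n / 8) else Num.min c0 (mu 0%N / 8).
have c_gt0 n : 0 < c n.
  by elim: n => [|n IH] /=; rewrite lt_min ?c00 ?divr_gt0.
have c_mu n : c n <= mu n / 8 by case: n => [|n] /=; rewrite ge_min lexx orbT.
have cS n : c n.+1 <= c n / 2 by rewrite /= ge_min lexx.
have c_lt m n : (m < n)%N -> c n <= c m / 2.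
  elim: n => // n IH; rewrite ltnS leq_eqVlt => /predU1P[->//|/IH h].
  have := cS n; have := c_gt0 n; lra.
have c_le n : c n <= c0.
  have c0l : c 0%N <= c0 by rewrite /= ge_min lexx.
  case: n => [//|n]; have := c_lt 0%N n.+1 (ltn0Sn n); have := c_gt0 0%N; lra.
have net n : exists L : seq (option (V * R)), (forall t, t \in L -> okp t /\
    exists2 y, K n y & Psi lam y - c n / 8 < piece lam t y) /\
    forall x, K n x -> exists2 t, t \in L & Psi lam x - c n / 8 < piece lam t x.
  have [|L h1 h2] := @compact_net R d (option (V * R)) (K n) (fun t => okp t /\
    exists2 y, K n y & Psi lam y - c n / 8 < piece lam t y)
    (fun t x => Psi lam x - c n / 8 < piece lam t x) (cK n); last by exists L.
  move=> x Kx; have Ux := KU n x Kx.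
  have c80 : 0 < c n / 8 by rewrite divr_gt0.
  have [p okp' hp] := Psi_adherent lam x _ Ux c80.
  exists p; first by split=> //; exists x.
  have cP := Psi_cont lam lam0 lam1 x Ux.
  apply: (@near_lt R d (fun x => Psi lam x - c n / 8) (piece lam p)) => //.
    by apply: (@cvgB _ _ _ (nbhs x)) => //; exact: cvg_cst.
  case: p okp' {hp} => [a|] okp'; first exact: continuous_ev.
  by have [sm _ _ _] := special spec okp'; apply: (sm 0%N).
have {net}[L hL] := choice net.
pose kP n t k := match t with
  | Some a => okp t -> 0 <= k /\ (str -> 0 < k) /\ [/\ forall y, K n y -> k * psi y <= c n / 16,
    forall y, U y -> k * psi y <= c n / 16 + (f y - ev a y) / 2 & k * d%:R <= c n / 16]
  | None => k = 0 end.
have kap_ex' (nt : nat * option (V * R)) : exists k : R, kP nt.1 nt.2 k.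
  case: nt => n [a|] /=; last by exists 0.
  have c160 : 0 < c n / 16 by rewrite divr_gt0.
  have [oka|nok] := pselect (okp (Some a)); last by exists 0.
  have [k k0 [h1 h2]] := kap_ex a (K n) _ oka (cK n) c160.
  by exists k.
have {kap_ex'}[kap hkap] := choice kap_ex'.
have kap0 n t : okp t -> 0 <= kap (n, t).
  case: t => [a|] okt; last by rewrite (hkap (n, None)).
  by case: (hkap (n, Some a) okt).
pose h n t x := piece lam t x + c n + kap (n, t) * psi x.
pose t0 := head None (L 0%N).
pose inL n t := exists2 k, (k < size (L n))%N & t = nth t0 (L n) k.
have inLP n t : t \in L n -> inL n t.
  by move=> tL; exists (index t (L n)); rewrite ?index_mem// nth_index.
have inLok n t : inL n t -> t \in L n by move=> [k kn ->]; exact: mem_nth.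
have Lok n t : inL n t -> okp t by move=> /inLok /(hL n).1 [].
have piece_smooth t : okp t -> smooth_on U (piece lam t).
  case: t => [a|] okt; first exact: smooth_ev.
  by have [sm _ _ _] := special spec okt.
have piece_cvx t : okp t -> cvx U (piece lam t).
  case: t => [a|] okt; first exact: ev_cvx.
  by have [_ sm _ _] := special spec okt.
have beta_gt0 n : 0 < c n / 8 by rewrite divr_gt0.
have psi0 (x : V) : 0 <= psi x by exact: psi_ge0.
have lowP n x : K n x -> exists2 t, inL n t & Psi lam x + 7 * c n / 8 < h n t x.
  move=> Kx; have [t tL ht] := (hL n).2 x Kx; exists t; first exact: inLP.
  have := mulr_ge0 (kap0 n t (Lok n t (inLP n t tL))) (psi0 x); rewrite /h; lra.
have upP n t x : inL n t -> K n x -> h n t x <= Psi lam x + 17 / 16 * c n.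
  move=> tL Kx; have okt := Lok n t tL.
  have := Psi_ub lam lam0 lam1 t x okt (KU n x Kx).
  rewrite /h; case: t {tL} okt => [a|] okt.
    by have [_ [_ [h1 _ _]]] := hkap (n, Some a) okt; have := h1 x Kx => /=; lra.
  by rewrite (hkap (n, None)) mul0r; have := c_gt0 n; lra.
have Lx0 : inL 0%N t0.
  have : K 0%N x0 by rewrite /K addn0.
  by move=> /lowP[t [k kn _] _]; exists 0%N; [exact: leq_ltn_trans kn|rewrite /t0; case: (L 0%N) kn].
have h_smooth n t : inL n t -> smooth_on U (h n t).
  move=> tL; apply: smooth_on_add => //; last by apply: smooth_on_scale => //; exact: smooth_psi.
  by apply: smooth_on_add => //; [exact/piece_smooth/(Lok n)|exact: smooth_on_cst].
have h_cvx n t : inL n t -> cvx U (h n t).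
  move=> tL; have okt := Lok n t tL.
  by apply: cvx_perturb; [exact: kap0|exact: piece_cvx|exact: psi_cvx].
have locfin x : U x -> exists n, \forall y \near x, forall m t,
    (n < m)%N -> inL m t -> exists2 t', inL n t' & h m t y + c n / 8 <= h n t' y.
  move=> Ux; have [n nK] := exh_near U x oU Ux; exists n.
  apply: filterS nK => y nK m t nm tL.
  have Kn : K n y by apply: exh_homo nK; rewrite leq_addl.
  have Km : K m y by apply: Khomo Kn; exact: ltnW.
  have [t' t'L ht'] := lowP n y Kn; exists t' => //.
  have := upP m t y tL Km; have := c_lt n m nm; have := c_gt0 n; lra.
have [g [[sg cg] [lg [ug [gg [stg scg]]]]]] :=
  @gluing_stages R d (option (V * R)) U L t0 h (fun n => c n / 8) oU cU beta_gt0 Lx0 h_smooth h_cvx locfin.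
exists g; split; first split=> //.
- move=> x Ux; have [n nK] := exh_near U x oU Ux.
  have Kn : K n x by apply: exh_homo (nbhs_singleton nK); rewrite leq_addl.
  have [t tL ht] := lowP n x Kn; have := lg x n t Ux tL; have := c_gt0 n; lra.
- move=> x Ux; apply: ug => // n t tL; have okt := Lok n t tL.
  have := c_le n; have := c_gt0 n; rewrite /h; case: t {tL} okt => [a|] okt.
    have [_ [_ [_ h1 _]]] := hkap (n, Some a) okt; have := h1 x Ux => /=.
    have := mixed_le lam lam0 lam1 a x okt Ux.
    have := ler_wpM2l (ltW lam0) (tm_le spec _ x okt.2 Ux).
    have := phi_ge0 (enorm a.1).
    lra.
  have := piece_le lam lam0 lam1 None x okt Ux.
  by rewrite (hkap (n, None)) mul0r; lra.
- move=> x Kx; have Kx0' : K 0%N x by rewrite /K addn0.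
  apply: ug; first exact: KU Kx0'.
  move=> n t tL; have := upP n t x tL (Khomo 0%N n (leq0n n) x Kx0').
  have := c_le n; have := c_gt0 n; lra.
split.
  move=> x q Ux sq; apply: gg => // n t tL; have okt := Lok n t tL.
  have dpsi : differentiable (@psi R d) x.
    exact: smooth_differentiable U _ x (smooth_psi U oU) Ux.
  have dp := smooth_differentiable U _ x (piece_smooth t okt) Ux.
  have [y Ky hy] := ((hL n).1 t (inLok n t tL)).2.
  case: t okt dp hy tL => [a|] okt dp hy tL; last first.
    left; have [_ _ _ gs] := special spec okt.
    have := grad_le_perturb _ _ x _ _ 0 (c n) dp dpsi (lexx _) (gs x q Ux sq) (grad_psi x).
    by rewrite mul0r addr0 /h (hkap (n, None)).
  have [k0 [_ [_ h2 h3]]] := hkap (n, Some a) okt.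
  have cmu := c_mu n; have cn0 := c_gt0 n.
  have near : exists2 y, K n y & Psi lam y - mu n < ev (mixed lam a) y.
    by exists y => //; move: hy => /=; lra.
  have [hq|hq] := (hmu n).2 a okt near x q Ux sq.
    left; have := grad_le_perturb _ _ x _ _ _ (c n) dp dpsi k0 (grad_ev (mixed lam a) x) (grad_psi x).
    move=> hg v; apply: (le_trans (hg v)); rewrite ler_wpM2r ?enorm_ge0//=.
    apply: le_trans hq; rewrite lerD2l; apply: (le_trans h3); lra.
  (* The point x need not lie in [K n]: a later stage whose compact set contains x supplies the
     higher piece, which is why [near_margin] speaks of all x in U. *)
  right; have [m nK] := exh_near U x oU Ux.
  have Km : K (maxn n.+1 m) x.
    by apply: exh_homo (nbhs_singleton nK); rewrite (leq_trans (leq_maxr n.+1 m))// leq_addl.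
  have [t' t'L ht'] := lowP _ x Km; exists (maxn n.+1 m), t'; split=> //.
  apply: lt_trans ht'; have := c_lt n (maxn n.+1 m) (leq_maxl _ _).
  have := h2 x Ux; rewrite /h /=; have := c_gt0 (maxn n.+1 m); lra.
split=> st s0c.
  apply: stg => n t tL; have okt := Lok n t tL.
  case: t okt tL => [a|] okt tL; last first.
    move=> x y t Ux Uy xy t01; rewrite /h (hkap (n, None)) !mul0r /=.
    have := s0c okt x y t Ux Uy xy t01; lra.
  have [_ [k0 _]] := hkap (n, Some a) okt.
  by apply: strictly_convex_perturb; [exact: k0|exact: ev_cvx|exact: psi_strict].
apply: scg => n t tL; have okt := Lok n t tL.
case: t okt tL => [a|] okt tL; last first.
  move=> x Ux; have [e [e0 [r rp hr]]] := s0c okt x Ux.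
  exists e; split=> //; exists r => // y z t yr zr t01; rewrite /h (hkap (n, None)) !mul0r /=.
  have := hr y z t yr zr t01; lra.
have [_ [k0 _]] := hkap (n, Some a) okt.
by apply: locally_sconvex_perturb => //; [exact: k0|exact: ev_cvx|exact: psi_sconvex].
Qed.

Lemma Psi_ge lam x B : 0 < lam -> lam <= 1 / 2 -> U x ->
  (forall nu, r0 < nu -> Um nu * f x - ev (tm nu) x <= B) ->
  f x - (J + e1) - lam * `|B| <= Psi lam x.
Proof.
move=> lam0 lam1 Ux hB.
have lB : 0 <= lam * `|B| by rewrite mulr_ge0// ltW.
have Je : 0 <= J + e1 by rewrite addr_ge0 ?(J_ge0 spec)// ltW// (e1_gt0 spec).
have [q sq] := subgradient_ex U f (openU spec) (convU spec) (cvxf spec) x Ux.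
have [qr|rq] := leP (enorm q) r0.
  have [inc fs] := small_sub spec x q Ux sq qr.
  have /= := Psi_ub lam lam0 lam1 None x inc Ux; lra.
have okq : okp (Some (q, f x - dot q x)) by split=> //; exact: (LL_sub spec).
have /= := Psi_ub lam lam0 lam1 _ x okq Ux; apply: le_trans.
rewrite ev_mixed /= (_ : ev (q, f x - dot q x) x = f x); last by rewrite /ev /= addrC subrK.
have := phi_le (enorm q).
have := ler_wpM2l (ltW lam0) (le_trans (hB _ rq) (ler_norm B)); lra.
Qed.

(** Mixing less raises an affine piece by [lam - lam'] times its own gap, which is at most the gap
    of f because the minorant is below f. *)
Lemma Psi_compare lam lam' x B : 0 < lam' -> lam' <= lam -> lam <= 1 / 2 -> U x ->
  (forall nu, r0 < nu -> Um nu * f x - ev (tm nu) x <= B) ->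
  Psi lam' x <= Psi lam x + lam * `|B|.
Proof.
move=> l'0 l'l l1 Ux hB; have l0 := lt_le_trans l'0 l'l.
have lB : 0 <= lam * `|B| by rewrite mulr_ge0// ltW.
apply: (Psi_lub) => // p okpp; have := Psi_ub lam l0 l1 p x okpp Ux.
case: p okpp => [a|] okpp /=; last by lra.
rewrite !ev_mixed; have [La ra] := okpp.
have /andP[u0 u1] := Um_01 spec _ ra.
have := LL_minor spec a La x Ux.
set u := Um (enorm a.1) in u0 u1 *; set t := ev (tm _) x => af.
have h1 : (lam - lam') * (u * ev a x - t) <= (lam - lam') * (u * f x - t).
  by rewrite ler_wpM2l ?subr_ge0// lerD2r ler_wpM2l.
have h2 : (lam - lam') * (u * f x - t) <= lam * (u * f x - t).
  by rewrite ler_wpM2r ?subr_ge0 ?(tm_le spec)// gerBl ltW.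
have := ler_wpM2l (ltW l0) (le_trans (hB _ ra) (ler_norm B)); rewrite -/u -/t; lra.
Qed.

(* The functions of [inner_approx] for decreasing [lam] are glued in turn, as the
   gap [lam * (Um nu * f - tm nu)] is small on compact sets only. *)
Lemma outer_approx x0 : U x0 ->
  exists g : V -> R,
  [/\ smooth_on U g, cvx U g & forall x, U x -> f x - (J + 2 * e1) <= g x <= f x] /\
  (forall x q, U x -> sub U f x q -> grad_le g x (enorm q)) /\
  (str -> (incl -> strictly_convex_on U s0) -> strictly_convex_on U g) /\
  (str -> (incl -> locally_sconvex U s0) -> locally_sconvex U g).
Proof.
move=> Ux0; have e10 := e1_gt0 spec.
have [n0 Kx0] := exh_near U x0 oU Ux0; have {}Kx0 := nbhs_singleton Kx0.
pose K n := exh U (n0 + n).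
have KU n : K n `<=` U by exact: exh_sub.
have Khomo m n : (m <= n)%N -> K m `<=` K n by move=> mn; apply: exh_homo; rewrite leq_add2l.
have Kne n : exh U (n0 + n) !=set0 by exists x0; apply: exh_homo Kx0; rewrite leq_addr.
pose C n : R := e1 / 2 / 2 ^+ n.
have C0 n : 0 < C n by rewrite !divr_gt0// exprn_gt0.
have C_le n : C n <= e1 / 2.
  by rewrite ler_pdivrMr ?exprn_gt0// ler_peMr ?exprn_ege1 ?ler1n// divr_ge0// ltW.
have C_lt m n : (m < n)%N -> C n <= C m / 2.
  move=> mn; rewrite /C -[leRHS]mulrA -invfM -exprSr ler_pM2l ?divr_gt0//.
  by rewrite lef_pV2 ?posrE ?exprn_gt0// ler_weXn2l// ler1n.
have Bex n : exists B, forall nu y, r0 < nu -> K n y -> Um nu * f y - ev (tm nu) y <= B.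
  exact: (mix_bounded spec) (K n) (@exh_compact _ _ _ _) (KU n).
have {Bex}[B hB] := choice Bex.
(* This limits the mixing loss on [K n] to [C n / 8], which is covered by the drop from [C n] to the
   later lifts. *)
pose l n := Num.min (1 / 2) (C n / 8 / (`|B n| + 1)).
have B1 n : 0 < `|B n| + 1 by rewrite ltr_wpDl.
pose lam := fix lam n := if n is m.+1 then Num.min (lam m) (l n) else l 0%N.
have l0 n : 0 < l n by rewrite lt_min !divr_gt0.
have lam0 n : 0 < lam n by elim: n => [|n IH] //=; rewrite lt_min IH l0.
have lam_l n : lam n <= l n by case: n => [|n] //=; rewrite ge_min lexx orbT.
have lam_homo m n : (m <= n)%N -> lam n <= lam m.
  elim: n => [|n IH]; first by rewrite leqn0 => /eqP->.
  rewrite leq_eqVlt => /predU1P[->//|]; rewrite ltnS => /IH; apply: le_trans.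
  by rewrite /= ge_min lexx.
have lam1 n : lam n <= 1 / 2 by rewrite (le_trans (lam_l n))// ge_min lexx.
have lamB n : lam n * `|B n| <= C n / 8.
  apply: (@le_trans _ _ (lam n * (`|B n| + 1))); first by rewrite ler_pM2l// lerDl.
  by rewrite -ler_pdivlMr// (le_trans (lam_l n))// ge_min lexx orbT.
have hex n : exists h : V -> R,
  [/\ smooth_on U h, cvx U h, forall x, U x -> Psi (lam n) x <= h x,
    forall x, U x -> h x <= f x + 2 * (C n / 32) &
    forall x, K n x -> h x <= Psi (lam n) x + 2 * (C n / 32)] /\
  (forall x q, U x -> sub U f x q -> grad_le h x (enorm q)) /\
  (str -> (incl -> strictly_convex_on U s0) -> strictly_convex_on U h) /\
  (str -> (incl -> locally_sconvex U s0) -> locally_sconvex U h).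
  by apply: (inner_approx) => //; rewrite divr_gt0.
have {hex}[h hh] := choice hex.
(* Decreasing lifts make later functions inactive on earlier sets; the shift by [- e1] compensates
   the lifts [C n <= e1 / 2] and the inner errors, so that all [H n] stay below f. *)
pose H n x := h n x + (C n - e1).
have b0 n : 0 < C n / 16 by rewrite divr_gt0.
have sH n : smooth_on U (H n).
  by apply: smooth_on_add => //; [have [[]] := hh n|exact: smooth_on_cst].
have cH n : cvx U (H n).
  move=> x y t Ux Uy t01; have [[_ ch _ _ _] _] := hh n.
  have := ch x y t Ux Uy t01; rewrite /H; lra.
have lowH n x : K n x -> f x - (J + e1) - e1 + 3 / 4 * C n <= H n x.
  move=> Kx; have Ux := KU n x Kx; have [[_ _ h1 _ _] _] := hh n.
  have := Psi_ge (lam n) x (B n) (lam0 n) (lam1 n) Ux (fun nu rn => hB n nu x rn Kx).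
  have := h1 x Ux; have := lamB n; have := C0 n; rewrite /H; lra.
have locfin x : U x -> exists N, \forall y \near x, forall i,
  (N <= i)%N -> exists2 j, (j < N)%N & H i y + C j / 16 <= H j y.
  move=> Ux; have [n nK] := exh_near U x oU Ux; exists n.+1.
  apply: filterS nK => y nK i ni; exists n => //.
  have Kn : K n y by apply: exh_homo nK; rewrite leq_addl.
  have Ki : K i y by apply: Khomo Kn; exact: ltnW.
  have [[_ _ h1 _ _] _] := hh n; have [[_ _ _ _ h2] _] := hh i.
  have := h1 y (KU n y Kn); have := h2 y Ki.
  have := Psi_compare (lam n) (lam i) y (B n) (lam0 i) (lam_homo _ _ (ltnW ni)) (lam1 n)
    (KU n y Kn) (fun nu rn => hB n nu y rn Kn).
  have := lamB n; have := C_lt n i ni; have := C0 n; have := C0 i; rewrite /H; lra.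
have [g [[sg cg] [lg [ug [gg [stg scg]]]]]] :=
  @gluing R d U H (fun n => C n / 16) oU cU b0 sH cH locfin.
exists g; split; first split=> //.
- move=> x Ux; apply/andP; split.
    have [n nK] := exh_near U x oU Ux.
    have Kn : K n x by apply: exh_homo (nbhs_singleton nK); rewrite leq_addl.
    have := lg x n Ux; have := lowH n x Kn; have := C0 n; lra.
  apply: ug => // n; have [[_ _ _ h1 _] _] := hh n; have := h1 x Ux.
  have := C_le n; have := C0 n; rewrite /H; lra.
split.
  move=> x q Ux sq; apply: gg => // i; left => v; have [[sh _ _ _ _] [vh _]] := hh i.
  have dh := smooth_differentiable U _ x sh Ux.
  rewrite (_ : H i = h i + cst (C i - e1))// deriveD; [|exact: diff_derivable|exact: derivable_cst].
  by rewrite derive_cst addr0; exact: vh.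
split=> st s0c.
  apply: stg => i x y t Ux Uy xy t01; have [_ [_ [sth _]]] := hh i.
  have := sth st s0c x y t Ux Uy xy t01; rewrite /H; lra.
apply: scg => i x Ux; have [_ [_ [_ sch]]] := hh i.
have [c [c0 [r rp hc]]] := sch st s0c x Ux; exists c; split=> //; exists r => //.
move=> y z t yr zr t01; have := hc y z t yr zr t01; rewrite /H; lra.
Qed.

End family.

(** * Minorants of least slope *)

Section min_slope.
Context {R : realType} {d : nat}.
Local Notation V := 'rV[R]_d.
Variables (U : set V) (f : V -> R).

Definition rmin : R := inf [set enorm a.1 | a in minor U f].

Lemma rmin_le a : minor U f a -> rmin <= enorm a.1.
Proof.
move=> ma; apply: ge_inf; last by exists a.
by exists 0 => _ [b mb <-]; exact: enorm_ge0.
Qed.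

Lemma rmin_near a e : minor U f a -> 0 < e -> exists2 b, minor U f b & enorm b.1 < rmin + e.
Proof.
move=> ma e0; have hi : has_inf [set enorm a.1 | a in minor U f].
  split; first by exists (enorm a.1), a.
  by exists 0 => _ [b mb <-]; exact: enorm_ge0.
by have [_ [b mb <-] h] := inf_adherent e0 hi; exists b.
Qed.

Lemma rmin_ge0 a : minor U f a -> 0 <= rmin.
Proof.
move=> ma; apply: lb_le_inf; first by exists (enorm a.1), a.
by move=> _ [b mb <-]; exact: enorm_ge0.
Qed.

Definition mix (t : R) (a b : V * R) : V * R :=
  ((1 - t) *: a.1 + t *: b.1, (1 - t) * a.2 + t * b.2).

Lemma ev_mix t a b x : ev (mix t a b) x = (1 - t) * ev a x + t * ev b x.
Proof. by rewrite /ev /mix /= dotDl !dotZl; ring. Qed.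

Lemma minor_mix t a b : 0 <= t <= 1 -> minor U f a -> minor U f b ->
  minor U f (mix t a b).
Proof.
move=> /andP[t0 t1] ma mb y Uy; rewrite ev_mix.
have t1' : 0 <= 1 - t by rewrite subr_ge0.
have := ler_wpM2l t0 (mb y Uy); have := ler_wpM2l t1' (ma y Uy); lra.
Qed.

(* The parallelogram law makes the slope of minimal length unique. *)
Lemma rmin_unique a b : minor U f a -> minor U f b ->
  enorm a.1 = rmin -> enorm b.1 = rmin -> a.1 = b.1.
Proof.
move=> ma mb ar br; have h2 : 0 <= (1 / 2 : R) <= 1 by apply/andP; split; lra.
have := rmin_le _ (minor_mix _ _ _ h2 ma mb); rewrite /mix /=.
set p := _ + _ => rp; apply/eqP; rewrite -subr_eq0; apply/eqP/enorm_eq0/eqP.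
rewrite -sqrf_eq0; apply/eqP/le_anti; rewrite sqr_ge0 andbT.
have h : rmin ^+ 2 <= enorm p ^+ 2.
  by rewrite ler_pXn2r// ?nnegrE ?enorm_ge0// (rmin_ge0 a).
move: h; have a2 := enorm_sq a.1; have b2 := enorm_sq b.1; rewrite ar in a2; rewrite br in b2.
rewrite !enorm_sq /p !(dotDl, dotDr, dotZl, dotZr, dotNl, dotNr) (dotC b.1 a.1) -a2 -b2; lra.
Qed.

(** Among the minorants with value at least v at x, one has shortest slope by [minnorm]. Its length
    is not [rmin] by hypothesis, so it is the threshold r. *)
Lemma low_values x v : U x -> (forall a, minor U f a -> enorm a.1 = rmin -> ev a x < v) ->
  exists2 r, rmin < r & forall a, minor U f a -> enorm a.1 < r -> ev a x < v.
Proof.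
move=> Ux hv.
have minorP p : (forall y, U y -> v + dot p (y - x) <= f y) <-> minor U f (p, v - dot p x).
  by split=> h y Uy; have := h y Uy; rewrite /ev /= dotDr dotNr; lra.
have [[p1 hp1]|np] := pselect (exists p, forall y, U y -> v + dot p (y - x) <= f y).
  have [p hp pmin] := minnorm U f x v p1 hp1.
  have mp := (minorP p).1 hp.
  exists (enorm p).
    rewrite lt_neqAle (rmin_le _ mp) andbT; apply/eqP => pr.
    by have := hv _ mp (esym pr); rewrite /ev /= addrC subrK ltxx.
  move=> a ma ap; rewrite ltNge; apply/negP => va.
  move: ap; rewrite ltNge => /negP; apply; apply: pmin => y Uy.
  have := ma y Uy; move: va; rewrite /ev dotDr dotNr; lra.
exists (rmin + 1); first by rewrite ltrDl.
move=> a ma _; rewrite ltNge; apply/negP => va; apply: np; exists a.1 => y Uy.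
have := ma y Uy; move: va; rewrite /ev dotDr dotNr; lra.
Qed.

(** All minorants of least slope share that slope, so the one with the largest constant term is
    obtained from an infimum over U. *)
Lemma rmin_attained x0 : U x0 -> (exists2 a, minor U f a & enorm a.1 = rmin) ->
  exists l0, [/\ minor U f l0, enorm l0.1 = rmin &
    forall a, minor U f a -> enorm a.1 = rmin -> a.1 = l0.1 /\ a.2 <= l0.2].
Proof.
move=> Ux0 [a ma ar].
pose S := [set f y - dot a.1 y | y in U].
have lS : has_lbound S.
  by exists a.2 => _ [y Uy <-]; have := ma y Uy; rewrite /ev; lra.
exists (a.1, inf S); split=> //.
  move=> y Uy; have : inf S <= f y - dot a.1 y by apply: ge_inf => //; exists y.
  by rewrite /ev /=; lra.
move=> b mb br; have ba := rmin_unique b a mb ma br ar; split=> //=.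
apply: lb_le_inf; first by exists (f x0 - dot a.1 x0), x0.
by move=> _ [y Uy <-]; have := mb y Uy; rewrite /ev ba; lra.
Qed.

End min_slope.

Section attained.
Context {R : realType} {d : nat}.
Local Notation V := 'rV[R]_d.
Variables (U : set V) (f : V -> R) (LL : V * R -> Prop).
Hypothesis openU : open U.
Hypothesis convU : forall x y t, U x -> U y -> 0 <= t <= 1 -> U (t *: x + (1 - t) *: y).
Hypothesis cvxf : cvx U f.
Hypothesis LL_minor : forall a, LL a -> minor U f a.
Hypothesis LL_sub : forall x q, U x -> sub U f x q -> LL (q, f x - dot q x).
Local Notation r0 := (rmin U f).

Lemma gap_bounded (a : V * R) (K : set V) : compact K -> K `<=` U ->
  exists B, forall y, K y -> f y - ev a y <= B.
Proof.
move=> cK KU; have [|B hB] := compact_max K (fun y => f y - ev a y) cK; last by exists B.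
move=> y Ky; apply: (@cvgB _ _ _ (nbhs y)) => //; last exact: continuous_ev.
exact: cvx_continuous openU convU cvxf y (KU y Ky).
Qed.

Variable l0 : V * R.
Hypothesis minor_l0 : minor U f l0.
Hypothesis l0r : enorm l0.1 = r0.
Hypothesis l0max : forall a, minor U f a -> enorm a.1 = r0 -> a.1 = l0.1 /\ a.2 <= l0.2.

Lemma near_l0 x e : U x -> 0 < e -> exists2 r, r0 < r &
  forall a, minor U f a -> enorm a.1 < r -> ev a x < ev l0 x + e.
Proof.
move=> Ux e0; apply: low_values => // a ma ar; have [a1 a2] := l0max a ma ar.
by rewrite /ev a1; lra.
Qed.

Let mix1_slope rho : r0 < rho -> exists2 s, 0 < s &
  forall nu, rho <= nu -> enorm l0.1 + s <= nu * 1.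
Proof. by move=> rr; exists (rho - r0); rewrite ?subr_gt0// l0r => nu; lra. Qed.

Let mix1_bounded K : compact K -> K `<=` U -> exists B, forall nu y,
  r0 < nu -> K y -> 1 * f y - ev l0 y <= B.
Proof.
move=> cK KU; have [B hB] := gap_bounded l0 K cK KU.
by exists B => nu y _ Ky; rewrite mul1r hB.
Qed.

(* The minorant of least slope is itself the special piece; [J > 0] keeps the
   other pieces of almost the same slope below it. *)
Lemma spec_affine e : 0 < e ->
  family_spec U f LL True (ev l0) r0 e e (fun=> 1) (fun=> l0).
Proof.
move=> e0; split=> //.
- exact: ltW.
- move=> x q Ux sq qr; split=> //; have mq := sub_minor U f x q sq.
  have qr' : enorm q = r0 by apply/le_anti; rewrite qr (rmin_le U f _ mq).
  by have /= [q1 q2] := l0max _ mq qr'; rewrite /ev -q1; lra.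
- by move=> nu _; rewrite ler01 lexx.
- by move=> nu y _ Uy; rewrite mul1r; exact: minor_l0.
- move=> lam x lam0 lam1 Ux; have e20 : 0 < e / 2 by rewrite divr_gt0.
  have [r rr hr] := near_l0 x (e / 2) Ux e20.
  exists r, (e / 2); split=> // a [La ra] ar; exists None => //=.
  have h := hr a (LL_minor a La) ar.
  have l1 : 0 < 1 - lam by lra.
  rewrite ev_mixed mulr1; have := h; rewrite -(ltr_pM2l l1).
  have : 0 <= e * (1 - (1 + (enorm a.1 - r0) ^+ 2)^-1).
    by rewrite bump_ge0// ltW.
  have : 0 < lam * (e / 2) by rewrite mulr_gt0.
  rewrite /phi; lra.
move=> _; split; [exact: smooth_ev|exact: ev_cvx|exact: minor_l0|].
move=> x q Ux sq v; apply: (le_trans (grad_ev l0 x v)).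
by rewrite ler_wpM2r ?enorm_ge0// l0r (rmin_le U f _ (sub_minor U f x q sq)).
Qed.

Hypothesis no_contact : forall x q, U x -> sub U f x q -> r0 < enorm q.
Hypothesis LL_mix : forall b t, LL b -> 0 < t -> t <= 1 -> LL (mix t l0 b).

(** The gap w of f above [l0] is positive at x. Mixing a support at x into [l0] with weight s gains
    s w there, while the slope grows by at most s A and [phi] by at most e (s A)^2. *)
Lemma spec_no_contact e : 0 < e ->
  family_spec U f LL False (cst 0) r0 e 0 (fun=> 1) (fun=> l0).
Proof.
move=> e0; split=> //.
- by move=> x q Ux sq; rewrite leNgt (no_contact x q Ux sq).
- by move=> nu _; rewrite ler01 lexx.
- by move=> nu y _ Uy; rewrite mul1r; exact: minor_l0.
move=> lam x lam0 lam1 Ux.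
have [q sq] := subgradient_ex U f openU convU cvxf x Ux.
have rq := no_contact x q Ux sq.
pose b : V * R := (q, f x - dot q x).
have Lb : LL b by exact: LL_sub.
have bx : ev b x = f x by rewrite /ev /= addrC subrK.
pose w := f x - ev l0 x.
have w0 : 0 < w.
  rewrite /w subr_gt0 lt_neqAle minor_l0// andbT; apply/eqP => e'.
  have s0 : sub U f x l0.1.
    by move=> y Uy; rewrite -e' dotDr dotNr; have := minor_l0 y Uy; rewrite /ev; lra.
  by have := no_contact x _ Ux s0; rewrite l0r ltxx.
pose A := enorm (q - l0.1).
have A0 : 0 <= A by exact: enorm_ge0.
have eA : 0 < e * A ^+ 2 + 1 by rewrite ltr_wpDl// mulr_ge0 ?sqr_ge0// ltW.
(* Makes [phi] at most s w / 4. The gain is at least s w / 2 after the factor 1 - lam, and a nearby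
   slope may exceed [l0] by s w / 8, so a margin s w / 8 remains. *)
pose s := Num.min 1 (w / 4 / (e * A ^+ 2 + 1)).
have s0 : 0 < s by rewrite lt_min ltr01 !divr_gt0.
have s1 : s <= 1 by rewrite ge_min lexx.
have sw : s * (e * A ^+ 2 + 1) <= w / 4 by rewrite -ler_pdivlMr// ge_min lexx orbT.
have Ls := LL_mix b s Lb s0 s1.
have dE : (mix s l0 b).1 - l0.1 = s *: (q - l0.1).
  by apply/rowP => i; rewrite /mix /= !mxE; ring.
have rs : r0 < enorm (mix s l0 b).1.
  rewrite lt_neqAle (rmin_le U f _ (LL_minor _ Ls)) andbT; apply/eqP => /esym rE.
  have [h _] := l0max _ (LL_minor _ Ls) rE.
  move: dE; rewrite h subrr => /esym/eqP; rewrite scaler_eq0 gt_eqF//= subr_eq0.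
  by move=> /eqP qE; move: rq; rewrite qE l0r ltxx.
have sw0 : 0 < s * w by rewrite mulr_gt0.
have T0 : 0 < s * w / 8 by rewrite divr_gt0.
have [r rr hr] := near_l0 x (s * w / 8) Ux T0.
exists r, (s * w / 8); split=> // a [La ra] ar; exists (Some (mix s l0 b)) => //=.
rewrite !ev_mixed ev_mix bx !mulr1.
set ns := enorm (mix s l0 b).1 in rs *.
have nsA : ns - r0 <= s * A.
  have := ler_enormD ((mix s l0 b).1 - l0.1) l0.1.
  by rewrite subrK dE enormZ gtr0_norm// -/A l0r -/ns; lra.
have ph : phi r0 e 0 ns <= s * (w / 4).
  rewrite /phi add0r; apply: (@le_trans _ _ (e * (ns - r0) ^+ 2)).
    rewrite ler_pM2l//; set z := (ns - r0) ^+ 2.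
    have z0 : 0 <= z by exact: sqr_ge0.
    have z1 : 0 < 1 + z by rewrite ltr_wpDr.
    have : 1 - z <= (1 + z)^-1.
      rewrite -div1r ler_pdivlMr//; have := sqr_ge0 z; rewrite expr2; lra.
    lra.
  have h2 : (ns - r0) ^+ 2 <= (s * A) ^+ 2.
    by rewrite ler_pXn2r ?nnegrE ?mulr_ge0 ?(ltW s0)// subr_ge0 ltW.
  have := ler_wpM2l (ltW e0) h2; rewrite exprMn.
  have := ler_wpM2l (ltW s0) sw; have := sqr_ge0 s; lra.
have pa : 0 <= phi r0 e 0 (enorm a.1).
  by rewrite /phi add0r bump_ge0// ltW.
have ha := hr a (LL_minor a La) ar.
have l1 : 0 < 1 - lam by lra.
move: ha; rewrite -(ltr_pM2l l1).
have lw : 1 / 2 * (s * w) <= (1 - lam) * (s * w) by rewrite ler_wpM2r ?(ltW sw0)//; lra.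
have lT : 0 <= lam * (s * w / 8) by rewrite mulr_ge0 ?(ltW lam0) ?(ltW T0).
have -> : f x = w + ev l0 x by rewrite /w subrK.
lra.
Qed.

End attained.

(** * Remainders of geometrically dominated series *)

Section tails.
Context {R : realType}.
Implicit Types (a F : nat -> R) (B : R).

Lemma pow2S n : (2 ^+ n.+1)^-1 = (2 ^+ n)^-1 / 2 :> R.
Proof. by rewrite exprSr invfM. Qed.

Lemma lt_pow2 B e : 0 < e -> exists n, B / 2 ^+ n < e.
Proof.
move=> e0; exists (Num.bound (`|B| / e)).
have : `|B| / e < (Num.bound (`|B| / e))%:R.
  by apply: archi_boundP; rewrite divr_ge0 ?(ltW e0).
rewrite ltr_pdivrMr// ltr_pdivrMr ?exprn_gt0// mulrC => h.
apply: (le_lt_trans (ler_norm B)); apply: (lt_le_trans h); rewrite ler_pM2l//.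
by rewrite -natrX ler_nat ltnW// ltn_expl.
Qed.

(** The intervals of radius [B / 2 ^+ n] around the partial sums are nested; [L] is a common point,
    and [T n] is the remainder from n on. *)
Lemma tail_series a B : (forall n, `|a n| <= B / 2 ^+ n.+1) ->
  exists T : nat -> R, (forall n, T n = a n + T n.+1) /\
    forall n, `|T n| <= B / 2 ^+ n.
Proof.
move=> aB; pose S n := \sum_(k < n) a k.
have SS n : S n.+1 = S n + a n by rewrite /S big_ord_recr.
have B2 n : B / 2 ^+ n = 2 * (B / 2 ^+ n.+1).
  by rewrite pow2S; field; rewrite gt_eqF// exprn_gt0.
have up n k : S (n + k)%N + B / 2 ^+ (n + k) <= S n + B / 2 ^+ n.
  elim: k => [|k IH]; first by rewrite addn0.
  apply: le_trans IH; rewrite addnS SS [in leRHS]B2.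
  by have := aB (n + k)%N; rewrite ler_norml => /andP[_]; lra.
have lo n k : S n - B / 2 ^+ n <= S (n + k)%N - B / 2 ^+ (n + k).
  elim: k => [|k IH]; first by rewrite addn0.
  apply: (le_trans IH); rewrite addnS SS [in leLHS]B2.
  by have := aB (n + k)%N; rewrite ler_norml => /andP[+ _]; lra.
have B0 n : 0 <= B / 2 ^+ n.
  by rewrite B2 mulr_ge0//; apply: le_trans (aB n).
have cross n m : S n - B / 2 ^+ n <= S m + B / 2 ^+ m.
  have := lo n m; have := up m n; rewrite (addnC m n); have := B0 (n + m)%N; lra.
pose L := sup [set S n - B / 2 ^+ n | n in setT].
have hub : has_ubound [set S n - B / 2 ^+ n | n in setT].
  by exists (S 0%N + B / 2 ^+ 0); move=> _ [n _ <-].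
exists (fun n => L - S n); split=> n; first by rewrite SS; lra.
rewrite ler_norml; apply/andP; split.
  have : S n - B / 2 ^+ n <= L by apply: ub_le_sup => //; exists n.
  lra.
have : L <= S n + B / 2 ^+ n.
  by apply: ge_sup; [exists (S 0%N - B / 2 ^+ 0), 0%N|move=> _ [m _ <-]].
lra.
Qed.

Lemma tail_ge0 F B : (forall n, F n.+1 <= F n) -> (forall n, `|F n| <= B / 2 ^+ n) ->
  forall n, 0 <= F n.
Proof.
move=> mF bF n; rewrite leNgt; apply/negP => Fn.
have mono k : F (n + k)%N <= F n.
  by elim: k => [|k IH]; [rewrite addn0|rewrite addnS (le_trans (mF _))].
have Fn0 : 0 < - F n by lra.
have [m hm] := lt_pow2 B _ Fn0.
have := mono m; have := bF (n + m)%N; rewrite ler_norml => /andP[h _].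
have B0 : 0 <= B.
  have := le_trans (normr_ge0 _) (bF 0%N); by rewrite expr0 divr1.
have : B / 2 ^+ (n + m) <= B / 2 ^+ m.
  by rewrite ler_wpM2l// lef_pV2 ?posrE ?exprn_gt0// ler_weXn2l ?ler1n// leq_addl.
lra.
Qed.

End tails.

Section not_attained.
Context {R : realType} {d : nat}.
Local Notation V := 'rV[R]_d.
Variables (U : set V) (f : V -> R) (LL : V * R -> Prop).
Hypothesis openU : open U.
Hypothesis convU : forall x y t, U x -> U y -> 0 <= t <= 1 -> U (t *: x + (1 - t) *: y).
Hypothesis cvxf : cvx U f.
Hypothesis LL_minor : forall a, LL a -> minor U f a.
Hypothesis LL_sub : forall x q, U x -> sub U f x q -> LL (q, f x - dot q x).
Local Notation r0 := (rmin U f).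
Hypothesis rmin_lt : forall a, minor U f a -> r0 < enorm a.1.

(* Here [tm nu] is the sum of a series of minorants with slopes shorter than nu
   and tending to the infimum. *)
Lemma spec_series x0 e : U x0 -> 0 < e -> exists Um tm,
  family_spec U f LL False (cst 0) r0 e 0 Um tm.
Proof.
move=> Ux0 e0.
have [q0 sq0] := subgradient_ex U f openU convU cvxf x0 Ux0.
have m0 := sub_minor U f x0 q0 sq0.
pose rho n : R := r0 + n.+1%:R^-1.
have rho_homo m n : (m <= n)%N -> rho n <= rho m.
  by move=> mn; rewrite lerD2l lef_pV2 ?posrE// ler_nat.
have wex n : exists w, minor U f w /\ enorm w.1 < rho n.
  have i0 : 0 < n.+1%:R^-1 :> R by rewrite invr_gt0.
  by have [w mw hw] := rmin_near U f _ _ m0 i0; exists w.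
have {wex}[w hw] := choice wex.
have mw n : minor U f (w n) by case: (hw n).
have wrho n : enorm (w n).1 < rho n by case: (hw n).
(* Dividing by [D n] makes the series of weights, of slope coordinates and of constant terms all
   dominated by 2^-(n+1). *)
pose D n := 1 + enorm (w n).1 + `|(w n).2|.
have D1 n : 0 < D n by rewrite ltr_wpDr// ltr_wpDr// enorm_ge0.
pose u n : R := 1 / 2 ^+ n.+1 / D n.
have u0 n : 0 < u n by rewrite !divr_gt0// exprn_gt0.
have uD n z : `|z| <= D n -> `|u n * z| <= 1 / 2 ^+ n.+1.
  move=> zD; rewrite normrM gtr0_norm// /u mulrAC ler_pdivrMr//.
  by rewrite ler_pM2l// divr_gt0 ?exprn_gt0.
have [W [WS Wb]] : exists W, (forall n, W n = u n + W n.+1) /\ forall n, `|W n| <= 1 / 2 ^+ n.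
  apply: tail_series => n; rewrite -(mulr1 (u n)); apply: uD.
  by rewrite normr1 /D -addrA lerDl addr_ge0 ?enorm_ge0.
have [k [kS kb]] : exists T, (forall n, T n = u n * (w n).2 + T n.+1) /\
    forall n, `|T n| <= 1 / 2 ^+ n.
  by apply: tail_series => n; apply: uD; rewrite /D lerDr addr_ge0 ?enorm_ge0.
have tex (i : 'I_d) : exists T, (forall n, T n = u n * (w n).1 ord0 i + T n.+1) /\
    forall n, `|T n| <= 1 / 2 ^+ n.
  apply: tail_series => n; apply: uD; apply: (le_trans (ler_coord_enorm _ _)).
  by rewrite /D -addrA addrCA lerDl addr_ge0.
have {tex}[tau htau] := choice tex.
pose t n : V * R := (\row_i tau i n, k n).
have tS n : t n = (u n *: (w n).1 + (t n.+1).1, u n * (w n).2 + (t n.+1).2).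
  rewrite /t /= -kS; congr (_, _); apply/rowP => i; rewrite !mxE.
  by have [-> _] := htau i.
have tb n : enorm (t n).1 <= d%:R / 2 ^+ n.
  apply: (le_trans (enorm_le_sum _)); apply: (@le_trans _ _ (\sum_(i < d) 1 / 2 ^+ n)).
    by apply: ler_sum => i _; rewrite mxE; have [_ ->] := htau i.
  by rewrite sumr_const card_ord -[leLHS]mulr_natl mul1r.
have evt n y : ev (t n) y = u n * ev (w n) y + ev (t n.+1) y.
  by rewrite tS /ev /= dotDl dotZl; ring.
have p20 n : 0 < 2 ^+ n :> R by rewrite exprn_gt0.
have W0 : forall n, 0 <= W n.
  by apply: tail_ge0 Wb => n; rewrite (WS n) lerDr ltW.
have W1 n : W n <= 1.
  have := Wb n; rewrite (ger0_norm (W0 n)) => /le_trans; apply.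
  by rewrite div1r invf_le1// exprn_ege1// ler1n.
pose S n y := W n * f y - ev (t n) y.
have SS n y : S n y = u n * (f y - ev (w n) y) + S n.+1 y.
  by rewrite /S evt WS; ring.
have Sle n y : U y -> S n.+1 y <= S n y.
  by move=> Uy; rewrite (SS n) lerDr mulr_ge0 ?(ltW (u0 n))// subr_ge0 mw.
have S0 y : U y -> forall n, 0 <= S n y.
  move=> Uy; apply: (tail_ge0 _ (`|f y| + d%:R * enorm y + 1)); first by move=> n; exact: Sle.
  move=> n; rewrite /S /ev opprD addrA.
  have h1 : `|W n * f y| <= `|f y| / 2 ^+ n.
    by rewrite normrM mulrC ler_wpM2l// (le_trans (Wb n))// div1r.
  have h2 : `|dot (t n).1 y| <= d%:R * enorm y / 2 ^+ n.
    by rewrite (le_trans (normr_dot_enorm _ _))// mulrAC ler_wpM2r ?enorm_ge0.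
  have h3 := kb n.
  rewrite !mulrDl; apply: (le_trans (ler_normB _ _)); rewrite lerD//.
  by apply: (le_trans (ler_normB _ _)); rewrite lerD.
have S_homo m n y : U y -> (m <= n)%N -> S n y <= S m y.
  move=> Uy; elim: n => [|n IH]; first by rewrite leqn0 => /eqP->.
  by rewrite leq_eqVlt => /predU1P[->//|]; rewrite ltnS => /IH; apply: le_trans; exact: Sle.
(* From this index on, all minorants of the series are shorter than nu; a larger nu starts the
   series no later, which makes the mixing gap monotone. *)
pose idx nu := Num.truncn ((nu - r0)^-1).
have idxP nu : r0 < nu -> rho (idx nu) < nu.
  move=> rn; rewrite /rho -ltrBrDl invf_plt ?posrE ?subr_gt0//.
  exact: truncnS_gt.
have idx_homo nu nu' : r0 < nu -> nu <= nu' -> (idx nu' <= idx nu)%N.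
  move=> rn nn; apply: le_truncn; rewrite lef_pV2 ?posrE ?subr_gt0//; first by lra.
  exact: lt_le_trans nn.
(* The slope saved by the tail starting at n. It does not increase with n once [rho n <= nu], and it
   tends to 0, so it is nonnegative; the single term at [idx r] then provides a uniform margin. *)
pose G nu n := nu * W n - enorm (t n).1.
have GS nu n : u n * (nu - enorm (w n).1) + G nu n.+1 <= G nu n.
  have : enorm (t n).1 <= u n * enorm (w n).1 + enorm (t n.+1).1.
    by rewrite tS /=; apply: (le_trans (ler_enormD _ _)); rewrite enormZ gtr0_norm.
  by rewrite /G (WS n); lra.
have Gle nu n : rho n <= nu -> G nu n.+1 <= G nu n.
  move=> rn; apply: le_trans (GS nu n); rewrite lerDr mulr_ge0 ?(ltW (u0 n))// subr_ge0.
  exact: le_trans (ltW (wrho n)) rn.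
have Ghomo nu n i : rho n <= nu -> G nu (n + i)%N <= G nu n.
  move=> rn; elim: i => [|i IH]; first by rewrite addn0.
  rewrite addnS; apply: le_trans IH; apply: Gle; apply: le_trans rn.
  by rewrite rho_homo// leq_addr.
have G0 nu n : rho n <= nu -> 0 <= G nu n.
  move=> rn; rewrite -(addn0 n).
  apply: (tail_ge0 (fun i => G nu (n + i)%N) (`|nu| + d%:R)).
    move=> i; rewrite addnS; apply: Gle; apply: le_trans rn.
    by rewrite rho_homo// leq_addr.
  move=> i; rewrite mulrDl /G; apply: (le_trans (ler_normB _ _)).
  have p2 : (2 ^+ (n + i))^-1 <= (2 ^+ i)^-1 :> R.
    by rewrite lef_pV2 ?posrE// ler_weXn2l ?ler1n// leq_addl.
  rewrite lerD//.
    rewrite normrM ler_wpM2l// (le_trans (Wb _))// div1r//.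
  by rewrite ger0_norm ?enorm_ge0// (le_trans (tb _))// ler_wpM2l.
have nosub x q : U x -> sub U f x q -> r0 < enorm q.
  by move=> Ux sq; exact: rmin_lt (sub_minor U f x q sq).
exists (fun nu => W (idx nu)), (fun nu => t (idx nu)); split=> //.
- by move=> x q Ux sq; rewrite leNgt (nosub x q Ux sq).
- by move=> nu _; rewrite W0 W1.
- by move=> nu y _ Uy; have := S0 y Uy (idx nu); rewrite /S; lra.
- by move=> nu nu' y rn nn Uy; apply: (S_homo _ _ y Uy); exact: idx_homo.
- move=> r rr; exists (u (idx r) * (r - enorm (w (idx r)).1)).
    by rewrite mulr_gt0// subr_gt0 (lt_trans (wrho _))// idxP.
  move=> nu rn; have rnu : r0 < nu by exact: lt_le_trans rn.
  have h1 : G nu (idx r) <= G nu (idx nu).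
    by rewrite -(subnKC (idx_homo r nu rr rn)); apply: Ghomo; rewrite ltW// idxP.
  have h2 : 0 <= G nu (idx r).+1.
    by apply: G0; apply: (le_trans _ rn); apply: (le_trans _ (ltW (idxP r rr))); exact: rho_homo.
  have h3 : u (idx r) * (r - enorm (w (idx r)).1) <= u (idx r) * (nu - enorm (w (idx r)).1).
    by rewrite ler_pM2l// lerD2r.
  have : u (idx r) * (r - enorm (w (idx r)).1) <= G nu (idx nu).
    by have := GS nu (idx r); lra.
  by rewrite /G; lra.
- move=> K cK KU; have [|B hB] := compact_max K (S 0%N) cK.
    move=> y Ky; apply: (@cvgB _ _ _ (nbhs y)) => //; last exact: continuous_ev.
    apply: (@cvgM _ _ (nbhs y)) => //; first exact: cvg_cst.
    exact: cvx_continuous openU convU cvxf y (KU y Ky).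
  by exists B => nu y _ Ky; apply: le_trans (hB y Ky); apply: S_homo => //; exact: KU.
move=> lam x lam0 lam1 Ux.
have [q sq] := subgradient_ex U f openU convU cvxf x Ux.
pose b : V * R := (q, f x - dot q x).
have Lb : LL b by exact: LL_sub.
pose M := mixed r0 e 0 (fun nu => W (idx nu)) (fun nu => t (idx nu)) lam.
(* Since no minorant has slope length r0, those of slope near r0 lie below any prescribed value at
   x. Their weight after mixing is at least 1/2, whence the factor 2 needed to stay below the piece
   of [b]. *)
pose v := - 2 * (`|ev (M b) x| + `|f x| + 1).
have [r rr hr] : exists2 r, r0 < r & forall a, minor U f a -> enorm a.1 < r -> ev a x < v.
  by apply: low_values => // a ma ar; have := rmin_lt a ma; rewrite ar ltxx.
exists r, 1; split=> // a [La ra] ar; exists (Some b); first by split=> //; exact: (nosub x).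
rewrite /= -/M [ev (M a) x]ev_mixed.
have ha := hr a (LL_minor a La) ar.
set n := idx _.
have hS := S0 x Ux n; rewrite /S in hS.
have W0' := W0 n; have W1' := W1 n.
have l0 : 0 <= lam * W n <= 1 / 2.
  by rewrite mulr_ge0 ?(ltW lam0)//= -[leRHS]mulr1 ler_pM// ltW.
have pa : 0 <= phi r0 e 0 (enorm a.1).
  by rewrite /phi add0r bump_ge0// ltW.
have /andP[l1 l2] := l0.
have vneg : v <= 0 by rewrite /v; have := normr_ge0 (ev (M b) x); have := normr_ge0 (f x); lra.
have h1 : (1 - lam * W n) * ev a x <= (1 - lam * W n) * v.
  by rewrite ler_wpM2l ?(ltW ha)//; lra.
have h2 : 0 <= (1 / 2 - lam * W n) * (- v) by rewrite mulr_ge0//; lra.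
have h3 : lam * W n * f x <= 1 * `|f x|.
  apply: (@le_trans _ _ (lam * W n * `|f x|)); first by rewrite ler_wpM2l// ler_norm.
  by rewrite ler_wpM2r//; lra.
have h4 := mulr_ge0 (ltW lam0) hS.
have := ler_norm (- ev (M b) x); rewrite normrN /v in h1 h2 *; lra.
Qed.

End not_attained.

(** * Supports of least slope of a strictly convex function *)

Section contact.
Context {R : realType} {d : nat}.
Local Notation V := 'rV[R]_d.
Variables (U : set V) (f : V -> R) (LL : V * R -> Prop).
Hypothesis openU : open U.
Hypothesis convU : forall x y t, U x -> U y -> 0 <= t <= 1 -> U (t *: x + (1 - t) *: y).
Hypothesis cvxf : cvx U f.
Hypothesis LL_minor : forall a, LL a -> minor U f a.
Hypothesis LL_sub : forall x q, U x -> sub U f x q -> LL (q, f x - dot q x).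
Variable x0 : V.
Hypothesis Ux0 : U x0.
Hypothesis minx0 : forall x, U x -> f x0 <= f x.
Hypothesis uniqx0 : forall x, U x -> f x = f x0 -> x = x0.
Variables (W W1 : R -> R).
Hypothesis smoothW : smooth1 W.
Hypothesis derW : forall t : R, is_derive t (1 : R) W (W1 t).
Hypothesis W0 : W 0 = 0.
Hypothesis W10 : W1 0 = 0.
Hypothesis W1_homo : {homo W1 : s t / s < t}.
Hypothesis W1_le : forall x i, U x ->
  d%:R * `|W1 (x ord0 i - x0 ord0 i)| * enorm (x - x0) <= f x - f x0.

Definition well (x : V) := f x0 + \sum_(i < d) W (x ord0 i - x0 ord0 i).

Let Wi (i : 'I_d) (t : R) := W (t - x0 ord0 i).
Let W1i (i : 'I_d) (t : R) := W1 (t - x0 ord0 i).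
Let derWi i (t : R) : is_derive t (1 : R) (Wi i) (W1i i t).
Proof.
have := is_derive_affine W (W1i i t) 1 (- x0 ord0 i) t; rewrite !mul1r => /(_ (derW _)).
by rewrite (_ : (fun _ => _) = Wi i)//; apply/funext => u; rewrite mul1r.
Qed.

Let W1_homo' : {homo W1 : s t / s <= t}.
Proof. by move=> u v; rewrite le_eqVlt => /predU1P[->//|/W1_homo/ltW]. Qed.

Let W_ge0 t : 0 <= W t.
Proof. by have := homo_tangent W W1 0 t derW W1_homo'; rewrite W0 W10 mul0r addr0. Qed.

Let W_le t : W t <= `|W1 t| * `|t|.
Proof.
have := homo_tangent W W1 t 0 derW W1_homo'; rewrite W0 sub0r mulrN subr_le0.
by rewrite -normrM => /le_trans; apply; exact: ler_norm.
Qed.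

Lemma smooth_well : smooth_on U well.
Proof.
apply: smooth_on_add => //; first exact: smooth_on_cst.
apply: (smooth_on_sumcoord U Wi) => // i k.
have := Ck1_affine k W 1 (- x0 ord0 i) (smoothW k).
by rewrite (_ : (fun _ => _) = Wi i)//; apply/funext => u; rewrite mul1r.
Qed.

Lemma strictly_convex_well : strictly_convex_on U well.
Proof.
move=> x y t Ux Uy xy /andP[t0 t1].
have [j xyj] : exists j, x ord0 j <> y ord0 j.
  apply: contrapT => h; apply: xy; apply/rowP => j; apply: contrapT => xyj.
  by apply: h; exists j.
have [t0' t1'] : 0 < 1 - t /\ 1 - t < 1 by lra.
have E i : ((1 - t) *: x + t *: y) ord0 i - x0 ord0 i =
   (1 - t) * (x ord0 i - x0 ord0 i) + t * (y ord0 i - x0 ord0 i).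
  by rewrite !mxE; ring.
have le1 i : W (((1 - t) *: x + t *: y) ord0 i - x0 ord0 i) <=
   (1 - t) * W (x ord0 i - x0 ord0 i) + t * W (y ord0 i - x0 ord0 i).
  rewrite E; have t01 : 0 <= 1 - t <= 1 by rewrite !ltW.
  by have := homo_convex W W1 _ _ _ derW W1_homo' t01; rewrite subKr; apply.
rewrite /well mulrDr mulrDr addrACA -mulrDl subrK mul1r ltrD2l.
rewrite (bigD1 j)//= [X in (1 - t) * X](bigD1 j)//= [X in t * X](bigD1 j)//=.
rewrite !mulrDr addrACA ltr_leD//.
  rewrite E; have t01 : 0 < 1 - t < 1 by rewrite t0'.
  have xyj' : x ord0 j - x0 ord0 j <> y ord0 j - x0 ord0 j.
    by move=> h; apply: xyj; lra.
  by have := homo_strictly_convex W W1 _ _ _ derW W1_homo xyj' t01; rewrite subKr.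
by rewrite !mulr_sumr -big_split /=; apply: ler_sum => i _; exact: le1.
Qed.

(** A support q at x satisfies f x - f x0 <= |q| |x - x0|, so [W1_le] bounds each coordinate
    derivative of the well by |q| / d; with [W t <= |W1 t| * |t|] it also puts the well below f.
    Lowering by J = e keeps affine pieces of small slope below the level [f x0]. *)
Lemma spec_well e : 0 < e ->
  family_spec U f LL True well 0 e e (fun=> 1) (fun=> (0, f x0)).
Proof.
move=> e0; have ev0 y : ev (0 : V, f x0) y = f x0 by rewrite /ev /= dot0l add0r.
have well_ge x : f x0 <= well x by rewrite lerDl sumr_ge0.
split=> //.
- exact: ltW.
- move=> x q Ux sq q0; split=> //.
  have qe : q = 0 by apply/enorm_eq0/le_anti; rewrite q0 enorm_ge0.
  have fx : f x = f x0.
    by apply/le_anti; rewrite minx0// andbT; have := sq x0 Ux0; rewrite qe dot0l addr0.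
  rewrite fx (uniqx0 x Ux fx); exact: well_ge.
- by move=> nu _; rewrite ler01 lexx.
- by move=> nu y _ Uy; rewrite mul1r ev0 minx0.
- by move=> rho r0; exists rho => // nu; rewrite enorm0 add0r mulr1.
- move=> K cK KU; have [B hB] := gap_bounded U f openU convU cvxf (0, f x0) K cK KU.
  by exists B => nu y _ Ky; rewrite mul1r hB.
- move=> lam x lam0 lam1 Ux; have n1 : 0 < enorm (x - x0) + 1 by rewrite ltr_wpDl// enorm_ge0.
  exists (e / 2 / (enorm (x - x0) + 1)), (e / 2).
  split; [by rewrite !divr_gt0|by rewrite divr_gt0|].
  move=> a [La _] ar; exists None => //=.
  apply: le_trans (well_ge x); rewrite ev_mixed mulr1 ev0.
  have pa : 0 <= e * (1 - (1 + (enorm a.1 - 0) ^+ 2)^-1).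
    by rewrite bump_ge0// ltW.
  have h1 : ev a x <= f x0 + enorm a.1 * enorm (x - x0).
    have := ev_lip a x x0; rewrite ler_norml => /andP[_].
    have := LL_minor a La x0 Ux0; lra.
  have h2 : enorm a.1 * (enorm (x - x0) + 1) <= e / 2 by rewrite -ler_pdivlMr// ltW.
  have h3 : ev a x <= f x0 + e / 2 by have := enorm_ge0 a.1; lra.
  have l1 : 0 <= 1 - lam by lra.
  have := ler_wpM2l l1 h3; have := mulr_ge0 (ltW lam0) (ltW e0); rewrite /phi; lra.
move=> _; split; first exact: smooth_well.
- move=> x y t Ux Uy /andP[]; rewrite le_eqVlt => /predU1P[<- _|t0].
    by rewrite scale0r add0r subr0 scale1r mul0r add0r mul1r.
  rewrite le_eqVlt => /predU1P[->|t1].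
    by rewrite subrr scale0r scale1r mul0r mul1r !addr0.
  have [->|/eqP xy] := eqVneq x y.
    by rewrite -scalerDl -mulrDl addrC subrK scale1r mul1r.
  have t01 : 0 < 1 - t < 1 by apply/andP; split; lra.
  by have := strictly_convex_well x y _ Ux Uy xy t01; rewrite subKr => /ltW.
- move=> x Ux; rewrite -lerBrDl.
  apply: (@le_trans _ _ (\sum_(i < d) (f x - f x0) / d%:R)).
    apply: ler_sum => i _; apply: (le_trans (W_le _)).
    have d0 : 0 < d%:R :> R by rewrite ltr0n; case: (d) i => // -[].
    rewrite ler_pdivlMr// mulrC mulrA; apply: le_trans (W1_le x i Ux).
    rewrite ler_wpM2l ?mulr_ge0//.
    by have := ler_coord_enorm (x - x0) i; rewrite !mxE.
  rewrite sumr_const card_ord -[leLHS]mulr_natl mulrCA.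
  by rewrite ler_piMr ?subr_ge0 ?minx0//; case: d => [|n]; rewrite ?mul0r// divff.
move=> x q Ux sq.
have gW : grad_le (fun y : V => \sum_(i < d) Wi i (y ord0 i)) x (d%:R * (enorm q / d%:R)).
  apply: (grad_sumcoord Wi W1i) => // i.
  have d0 : 0 < d%:R :> R by rewrite ltr0n; case: (d) i => // -[].
  rewrite ler_pdivlMr// mulrC.
  have [->|xx] := eqVneq x x0; first by rewrite /W1i subrr W10 normr0 mulr0 enorm_ge0.
  have n0 : 0 < enorm (x - x0).
    by apply: enorm_gt0; apply/eqP; rewrite subr_eq0.
  rewrite -(ler_pM2r n0); apply: (le_trans (W1_le x i Ux)).
  have := sq x0 Ux0; have := dot_enorm (- q) (x0 - x).
  by rewrite dotNl enormN (enormB x0 x); lra.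
have dW : differentiable (fun y : V => \sum_(i < d) Wi i (y ord0 i)) x.
  apply: (smooth_differentiable U) => //; apply: smooth_on_sumcoord => // i k.
  have := Ck1_affine k W 1 (- x0 ord0 i) (smoothW k).
  by rewrite (_ : (fun _ => _) = Wi i)//; apply/funext => u; rewrite mul1r.
move=> v; rewrite (_ : well = cst (f x0) + (fun y : V => \sum_(i < d) Wi i (y ord0 i)))//.
rewrite deriveD; [|exact: derivable_cst|exact: diff_derivable].
rewrite derive_cst add0r; apply: (le_trans (gW v)); rewrite ler_wpM2r ?enorm_ge0//.
by rewrite mulrCA ler_piMr ?enorm_ge0//; case: d => [|n]; rewrite ?mul0r// divff.
Qed.

End contact.

(** * Sums of series of smooth functions and flat wells *)

Section summable.
Context {R : realType}.
Implicit Types (a b : nat -> R) (S T x C : R).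

(** Convergence at a geometric rate with unspecified constant, a form closed under linear
    combinations. *)
Definition has_sum a S :=
  exists B, forall n, `|S - \sum_(k < n) a k| <= B / 2 ^+ n.

Lemma has_sum_ex a B : (forall n, `|a n| <= B / 2 ^+ n.+1) -> exists S, has_sum a S.
Proof.
move=> aB; have [T [TS TB]] := tail_series a B aB; exists (T 0%N), B => n.
rewrite (_ : T 0%N - _ = T n)//; elim: n => [|n IH]; first by rewrite big_ord0 subr0.
rewrite big_ord_recr /= opprD addrA IH (TS n); ring.
Qed.

Lemma has_sum_lin a b S T x : has_sum a S -> has_sum b T ->
  has_sum (fun n => a n + x * b n) (S + x * T).
Proof.
move=> [A hA] [B hB]; exists (A + `|x| * B) => n.
rewrite big_split /= -mulr_sumr opprD addrACA -mulrBr.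
apply: (le_trans (ler_normD _ _)); rewrite mulrDl; apply: lerD; first exact: hA.
rewrite normrM -mulrA; apply: ler_wpM2l => //; exact: hB.
Qed.

Lemma has_sum_le a S C : has_sum a S -> (forall n, \sum_(k < n) a k <= C) -> S <= C.
Proof.
move=> [B hB] aC; rewrite leNgt; apply/negP => CS.
have SC0 : 0 < S - C by rewrite subr_gt0.
have [n hn] := lt_pow2 B _ SC0.
by have := hB n; rewrite ler_norml => /andP[_]; have := aC n; lra.
Qed.

Lemma has_sum_norm a S C : has_sum a S -> (forall n, `|a n| <= C / 2 ^+ n.+1) -> `|S| <= C.
Proof.
move=> hS aC.
have C0 : 0 <= C by have := le_trans (normr_ge0 _) (aC 0%N); lra.
have bd n : `|\sum_(k < n) a k| <= C - C / 2 ^+ n.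
  elim: n => [|n IH]; first by rewrite big_ord0 normr0 expr0 divr1 subrr.
  rewrite big_ord_recr /=; apply: (le_trans (ler_normD _ _)).
  have := aC n; have := IH; rewrite pow2S; lra.
have bd' n : `|\sum_(k < n) a k| <= C.
  by apply: (le_trans (bd n)); rewrite gerBl divr_ge0// exprn_ge0.
rewrite ler_norml; apply/andP; split; last first.
  by apply: has_sum_le hS _ => n; apply: le_trans (bd' n); exact: ler_norm.
have h0 : has_sum (fun=> 0) 0.
  by exists 0 => n; rewrite big1// subrr normr0 mul0r.
have := has_sum_lin _ _ _ _ (-1) h0 hS; rewrite add0r mulN1r lerNl => hN.
apply: has_sum_le hN _ => n; rewrite (eq_bigr (fun k => - a (nat_of_ord k))); last first.
  by move=> k _; rewrite add0r mulN1r.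
by rewrite sumrN; apply: le_trans (bd' n); rewrite -normrN ler_norm.
Qed.

Lemma has_sum_ge a S n : has_sum a S -> (forall k, 0 <= a k) -> a n <= S.
Proof.
move=> hS a0; rewrite leNgt; apply/negP => Sn.
have S0 : 0 < a n - S by rewrite subr_gt0.
have [B hB] := hS; have [m hm] := lt_pow2 `|B| _ S0.
have : a n <= \sum_(k < n.+1 + m) a k.
  rewrite big_split_ord /= big_ord_recr /= -addrA addrCA lerDl.
  by rewrite addr_ge0// sumr_ge0.
have := hB (n.+1 + m)%N; rewrite ler_norml => /andP[h _].
have : B / 2 ^+ (n.+1 + m) <= `|B| / 2 ^+ m.
  apply: (@le_trans _ _ (`|B| / 2 ^+ (n.+1 + m))).
    by rewrite ler_wpM2r ?invr_ge0 ?exprn_ge0// ler_norm.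
  by rewrite ler_wpM2l// lef_pV2 ?posrE ?exprn_gt0// ler_weXn2l ?ler1n// leq_addl.
lra.
Qed.

Lemma taylor2 (F F1 F2 : R -> R) (B t h : R) :
  (forall u : R, is_derive u (1 : R) F (F1 u)) ->
  (forall u : R, is_derive u (1 : R) F1 (F2 u)) -> (forall u, `|F2 u| <= B) ->
  `|F (t + h) - F t - h * F1 t| <= B * h ^+ 2.
Proof.
move=> dF dF1 F2B.
have lip u v : `|F1 v - F1 u| <= B * `|v - u|.
  wlog uv : u v / u <= v.
    by move=> H; have [/H//|/ltW/H] := leP u v; rewrite distrC (distrC v).
  by have [w _ ->] := MVT1 _ _ _ _ dF1 uv; rewrite normrM ler_wpM2r.
have [u hu ->] : exists2 u, `|u - t| <= `|h| & F (t + h) - F t = F1 u * h.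
  have [h0|/ltW h0] := leP 0 h.
    have th : t <= t + h by rewrite lerDl.
    have [u /andP[u1 u2] e] := MVT1 _ _ _ _ dF th; exists u; last by rewrite e; ring.
    by rewrite !ger0_norm ?subr_ge0//; lra.
  have th : t + h <= t by rewrite gerDl.
  have [u /andP[u1 u2] e] := MVT1 _ _ _ _ dF th; exists u.
    by rewrite !ler0_norm ?subr_le0//; lra.
  have : F (t + h) - F t = - (F t - F (t + h)) by ring.
  by rewrite e => ->; ring.
rewrite (mulrC h) -mulrBl normrM -[h ^+ 2]ger0_norm ?sqr_ge0// normrX expr2 mulrA.
rewrite ler_wpM2r//; apply: (le_trans (lip _ _)).
by rewrite ler_wpM2l// (le_trans _ (F2B 0)).
Qed.

Lemma chi1_lt (u v : R) : u < v -> 0 < v -> chi1 u < chi1 v.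
Proof.
move=> uv v0; have [u0|u0] := leP u 0.
  rewrite chi1_le0// /chi1 /flat leNgt v0 /= !hornerE mulr_gt0 ?expR_gt0//.
  by rewrite ltr_wpDr// invr_ge0 ltW.
have [w /andP[uw wv] e] := MVT1 _ _ _ _ is_derive_chi1 (ltW uv).
by rewrite -subr_gt0 e mulr_gt0 ?subr_gt0// chi2_gt0// (lt_le_trans u0).
Qed.

(* The weights [c], which may be chosen arbitrarily small, make the well as flat
   at 0 as required. *)
Lemma flat_well_ex (c s : nat -> R) : (forall n, 0 < c n <= 1 / 2 ^+ n.+1) ->
  (forall n, 0 <= s n) -> (forall e, 0 < e -> exists n, s n < e) ->
  exists W W1 : R -> R, [/\ smooth1 W, forall t : R, is_derive t (1 : R) W (W1 t),
    W 0 = 0, W1 0 = 0 & {homo W1 : u v / u < v}] /\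
  forall t B, 0 <= B -> (forall n, s n < `|t| -> c n <= B / 2 ^+ n.+1) -> `|W1 t| <= B.
Proof.
move=> hc s0 s_small.
have c0 n : 0 < c n by case/andP: (hc n).
have c1 n : c n <= 1 / 2 ^+ n.+1 by case/andP: (hc n).
have p20 n : 0 < 2 ^+ n :> R by rewrite exprn_gt0.
(* Term n vanishes for [t <= s n], so only weights with [s n < t] matter at t. As [s] takes
   arbitrarily small values, some term is still active immediately to the right of 0. *)
pose a p t n := c n * flat p (t - s n).
have a_le p B t n : (forall t, `|flat p t| <= B) -> `|a p t n| <= B / 2 ^+ n.+1.
  move=> hB; rewrite normrM gtr0_norm// -[B]mul1r mulrAC.
  by rewrite ler_pM// ltW.
have Fex (pt : {poly R} * R) : exists S, has_sum (a pt.1 pt.2) S.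
  have [B B0 hB] := flat_bounded pt.1.
  by apply: (@has_sum_ex _ B) => n; exact: a_le.
have [F0 hF0] := choice Fex; pose F p t := F0 (p, t).
have hF p t : has_sum (a p t) (F p t) := hF0 (p, t).
(* Taking all polynomials together closes the sums under termwise differentiation: the Taylor
   remainders of the terms share one quadratic bound, and the weights sum to at most 1. *)
have dF p (t : R) : is_derive t (1 : R) (F p) (F (flat_deriv p) t).
  have [B B0 hB] := flat_bounded (flat_deriv (flat_deriv p)).
  apply: (@is_derive_of_sq R (F p) t _ B) => h.
  have := has_sum_lin _ _ _ _ (- h)
    (has_sum_lin _ _ _ _ (-1) (hF p (t + h)) (hF p t)) (hF (flat_deriv p) t).
  rewrite mulN1r mulNr => hS; apply: (has_sum_norm _ _ _ hS) => n.
  have := taylor2 _ _ _ B (t - s n) h (is_derive_flat p) (is_derive_flat _) hB.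
  rewrite /a (_ : t - s n + h = t + h - s n); last by ring.
  set X := _ - h * _ => hX.
  rewrite (_ : _ + - h * _ = c n * X); last by rewrite /X; ring.
  rewrite normrM gtr0_norm// [leRHS](_ : _ = 1 / 2 ^+ n.+1 * (B * h ^+ 2)); last by ring.
  by rewrite ler_pM// ltW.
have sF p k : Ck1 k (F p).
  elim: k p => [|k IH] p; first exact: is_derive1_continuous (dF p).
  by exists (F (flat_deriv p)).
pose G1 := F (1 + 'X).
have G1_sum t : has_sum (fun n => c n * chi1 (t - s n)) (G1 t) := hF _ t.
have G1_bd t B : 0 <= B -> (forall n, s n < t -> c n <= B / 2 ^+ n.+1) -> `|G1 t| <= B.
  move=> B0 hB; apply: (has_sum_norm _ _ _ (G1_sum t)) => n.
  have [ts|st] := leP t (s n).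
    by rewrite chi1_le0 ?subr_le0// mulr0 normr0 divr_ge0// ltW.
  rewrite normrM gtr0_norm// ger0_norm ?chi1_ge0//; apply: le_trans (hB n st).
  by rewrite ler_piMr ?chi1_le1// ltW.
have G10 t : t <= 0 -> G1 t = 0.
  move=> t0; apply/eqP; rewrite -normr_le0; apply: G1_bd => // n st.
  by have := s0 n; rewrite leNgt (lt_le_trans st).
have G1_homo u v : u <= v -> G1 u <= G1 v.
  move=> uv; have := has_sum_lin _ _ _ _ (-1) (G1_sum v) (G1_sum u).
  move=> /(@has_sum_ge _ _ 0%N) h; rewrite -subr_ge0 -mulN1r; apply: le_trans (h _).
    by rewrite mulN1r subr_ge0 ler_pM2l// chi1_homo// lerD2r.
  by move=> k; rewrite mulN1r subr_ge0 ler_pM2l// chi1_homo// lerD2r.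
have G1_lt u v : u < v -> 0 < v -> G1 u < G1 v.
  move=> uv v0; have [n sn] := s_small v v0.
  have := has_sum_lin _ _ _ _ (-1) (G1_sum v) (G1_sum u).
  move=> /(@has_sum_ge _ _ n) h; rewrite -subr_gt0 -mulN1r; apply: lt_le_trans (h _).
    rewrite mulN1r subr_gt0 ltr_pM2l// chi1_lt ?subr_gt0//.
    by rewrite ltrD2r.
  by move=> k; rewrite mulN1r subr_ge0 ler_pM2l// chi1_homo// lerD2r ltW.
have [G dG G0] := antiderivative_ex G1 (sF _ 0%N) G10.
have sG : smooth1 G.
  by case=> [|k]; [exact: is_derive1_continuous dG|exists G1 => //; exact: sF].
pose W t := G t + G (-1 * t + 0); pose W1 t := G1 t - G1 (-1 * t + 0).
have N t : -1 * t + 0 = - t by rewrite mulN1r addr0.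
exists W, W1; split; first split.
- by move=> k; apply: Ck1_add => //; exact: Ck1_affine.
- move=> t; have h := is_derive_affine G (G1 (-1 * t + 0)) (-1) 0 t (dG _).
  rewrite /W1 -(mulN1r (G1 _)); exact: is_deriveD (dG t) h.
- by rewrite /W N oppr0 G0// addr0.
- by rewrite /W1 N oppr0 subrr.
- move=> u v uv; rewrite /W1 !N.
  have [v0|v0] := ltP 0 v.
    have := G1_lt u v uv v0; have Nuv : - v <= - u by rewrite lerN2 ltW.
    by have := G1_homo _ _ Nuv; lra.
  have Nuv : - v < - u by rewrite ltrN2.
  have u0 : 0 < - u by lra.
  by have := G1_lt _ _ Nuv u0; have := G1_homo u v (ltW uv); lra.
move=> t B B0 hB; rewrite /W1 N; have [t0|/ltW t0] := leP t 0.
  rewrite G10// sub0r normrN; apply: G1_bd => // n st; apply: hB.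
  by rewrite ler0_norm.
rewrite (G10 (- t)) ?oppr_le0// subr0; apply: G1_bd => // n st; apply: hB.
by rewrite ger0_norm.
Qed.

End summable.

(** * Growth of a strictly convex function away from its supports *)

Section strict_growth.
Context {R : realType} {d : nat}.
Local Notation V := 'rV[R]_d.
Variables (U : set V).
Hypothesis openU : open U.
Hypothesis convU : forall x y t, U x -> U y -> 0 <= t <= 1 -> U (t *: x + (1 - t) *: y).

Lemma compact_sphere (x : V) (r : R) : compact [set y : V | enorm (y - x) = r].
Proof.
rewrite (_ : [set y | _] = [set y : V | enorm (y - x) <= r] `&`
  [set y : V | r <= enorm (y - x)]).
  apply: compact_closedI; first exact: compact_enorm_ball.
  rewrite (_ : [set y | _] = (fun y : V => enorm (y - x)) @^-1` [set t | r <= t])//.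
  by apply: closed_comp; [move=> y _; exact: continuous_enormB|exact: closed_ge].
apply/seteqP; split=> y /=; first by move=> ->.
by move=> [h1 h2]; apply/le_anti; rewrite h1.
Qed.

(** The minimum over a sphere exceeds the value at the centre, and convexity along rays extends this
    excess linearly outwards. An empty sphere, as for d = 0, leaves no y to consider. *)
Lemma sphere_gap (g : V -> R) x r : cvx U g -> U x -> 0 < r ->
  (forall y, enorm (y - x) <= r -> U y) -> (forall y, U y -> y <> x -> g x < g y) ->
  exists2 mu, 0 < mu & forall y, U y -> r <= enorm (y - x) ->
    mu * enorm (y - x) <= g y - g x.
Proof.
move=> cg Ux r0 rU gx; pose K := [set y : V | enorm (y - x) = r].
have [K0|K0] := pselect (K !=set0); last first.
  exists 1 => // y Uy ry; case: K0; have n0 : 0 < enorm (y - x) by exact: lt_le_trans ry.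
  exists (x + (r / enorm (y - x)) *: (y - x)).
  rewrite /K /= addrAC subrr add0r enormZ gtr0_norm ?divr_gt0// divfK//.
  by rewrite gt_eqF.
have [|c Kc cmin] := compact_min K g K0 (compact_sphere x r).
  by move=> y Ky; have Uy : U y by [apply: rU; rewrite Ky]; exact: cvx_continuous openU convU cg y Uy.
have cx : c <> x.
  by move=> cx; move: Kc; rewrite /K /= cx subrr enorm0 => r0'; move: r0; rewrite -r0' ltxx.
have gc : g x < g c by apply: gx => //; apply: rU; rewrite Kc.
exists ((g c - g x) / r); first by rewrite divr_gt0// subr_gt0.
move=> y Uy ry; have n0 : 0 < enorm (y - x) by exact: lt_le_trans ry.
pose t := r / enorm (y - x).
have t0 : 0 < t by rewrite divr_gt0.
have t1 : t <= 1 by rewrite ler_pdivrMr ?mul1r.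
have t01 : 0 <= t <= 1 by rewrite (ltW t0).
have Kz : K (t *: y + (1 - t) *: x).
  rewrite /K /= (_ : _ - x = t *: (y - x)).
    by rewrite enormZ gtr0_norm// divfK// gt_eqF.
  by apply/rowP => i; rewrite !mxE; ring.
have h1 := cmin _ Kz; have h2 := cg y x t Uy Ux t01.
have h3 : g c - g x <= t * (g y - g x) by lra.
apply: (@le_trans _ _ (t * (g y - g x) / r * enorm (y - x))).
  by rewrite ler_pM2r// ler_pM2r// invr_gt0.
rewrite le_eqVlt; apply/orP; left; apply/eqP; rewrite /t; field.
by rewrite !gt_eqF.
Qed.

Lemma strict_support (f : V -> R) x q : cvx U f -> strictly_convex_on U f -> U x ->
  sub U f x q -> exists r mu, [/\ 0 < r, 0 < mu & forall y, U y -> r <= enorm (y - x) ->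
    mu * enorm (y - x) <= f y - f x - dot q (y - x)].
Proof.
move=> cf sf Ux sq; pose g y := f y - dot q y.
have cg : cvx U g.
  move=> y z t Uy Uz t01; have := cf y z t Uy Uz t01.
  by rewrite /g dotDr !dotZr; lra.
have gx y : U y -> y <> x -> g x < g y.
  move=> Uy yx; have h2 : 0 < (1 / 2 : R) < 1 by apply/andP; split; lra.
  have := sf y x _ Uy Ux yx h2.
  have h2' : 0 <= (1 / 2 : R) <= 1 by apply/andP; split; lra.
  have := sq _ (convU x y _ Ux Uy h2').
  rewrite (addrC (_ *: x)) (_ : 1 - 1 / 2 = 1 / 2); last by field.
  rewrite (addrC (_ *: y)) (_ : _ - x = (1 / 2) *: (y - x)); last first.
    by apply/rowP => i; rewrite !mxE; field.
  by rewrite /g dotZr dotDr dotNr; lra.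
have [r0 r00 r0U] := open_norm_ball U openU x Ux.
have [mu mu0 hmu] := sphere_gap g x r0 cg Ux r00
  (fun y yr => r0U y (le_trans (ler_norm_enorm _) yr)) gx.
exists r0, mu; split=> // y Uy ry; have := hmu y Uy ry.
by rewrite /g dotDr dotNr; lra.
Qed.

(** Both [psi] and the gap of f above a support are comparable to the distance from x, up to
    additive constants collected in D. *)
Lemma strict_support_growth (f : V -> R) x q : cvx U f -> strictly_convex_on U f -> U x ->
  sub U f x q -> exists2 C, 0 < C & exists D,
  forall y, U y -> C * psi y - D <= f y - ev (q, f x - dot q x) y.
Proof.
move=> cf sf Ux sq; have [r [mu [r0 mu0 hmu]]] := strict_support f x q cf sf Ux sq.
have d1 : 0 < 2 * d%:R + 1 :> R by rewrite ltr_wpDl// mulr_ge0.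
exists (mu / (2 * d%:R + 1)); first by rewrite divr_gt0.
exists (mu * (1 + enorm x) + mu * r) => y Uy.
have h0 : f y - ev (q, f x - dot q x) y = f y - f x - dot q (y - x).
  by rewrite /ev /= dotDr dotNr; ring.
have h1 : mu * enorm (y - x) - mu * r <= f y - f x - dot q (y - x).
  have [ry|/ltW yr] := leP r (enorm (y - x)).
    by have := hmu y Uy ry; have := mulr_gt0 mu0 r0; lra.
  have : mu * enorm (y - x) <= mu * r by rewrite ler_pM2l.
  by have := sq y Uy; lra.
have h2 : psi y <= (2 * d%:R + 1) * (1 + enorm x + enorm (y - x)).
  apply: (le_trans (psi_le y)); have := ler_enormD (y - x) x; rewrite subrK => h.
  have := enorm_ge0 x; have := enorm_ge0 (y - x); have := enorm_ge0 y => e1 e2 e3.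
  have d0 : 0 <= 2 * d%:R :> R by rewrite mulr_ge0.
  have : 2 * d%:R * (1 + enorm y) <= 2 * d%:R * (1 + enorm x + enorm (y - x)).
    by rewrite ler_wpM2l//; lra.
  lra.
have h3 : mu / (2 * d%:R + 1) * psi y <= mu * (1 + enorm x + enorm (y - x)).
  by rewrite mulrAC -mulrA ler_pM2l// ler_pdivrMr// mulrC.
rewrite h0; lra.
Qed.

(* Tilting a support of positive slope decreases its slope. *)
Lemma strict_contact_slope (f : V -> R) x q : cvx U f -> strictly_convex_on U f -> U x ->
  sub U f x q -> enorm q = rmin U f -> q = 0.
Proof.
move=> cf sf Ux sq qr; have [r [mu [r0 mu0 hmu]]] := strict_support f x q cf sf Ux sq.
apply: contrapT => q0; have nq := enorm_gt0 q q0.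
pose e := Num.min 1 (mu / enorm q).
have e0 : 0 < e by rewrite lt_min ltr01 divr_gt0.
have e1 : e <= 1 by rewrite ge_min lexx.
have emu : e * enorm q <= mu by rewrite -ler_pdivlMr// ge_min lexx orbT.
have : minor U f ((1 - e) *: q, f x - (1 - e) * dot q x - e * enorm q * r).
  move=> y Uy; rewrite /ev /= dotZl.
  have h1 : - (enorm q * enorm (y - x)) <= dot q (y - x).
    by have := normr_dot_enorm q (y - x); rewrite ler_norml => /andP[].
  have h1' : - (e * enorm q * enorm (y - x)) <= e * dot q (y - x).
    by have := ler_wpM2l (ltW e0) h1; lra.
  have eq0 : 0 <= e * enorm q by rewrite mulr_ge0 ?ltW.
  have [ry|/ltW yr] := leP r (enorm (y - x)).
    have := hmu y Uy ry; have := ler_wpM2r (enorm_ge0 (y - x)) emu.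
    have := mulr_ge0 eq0 (ltW r0); rewrite dotDr dotNr in h1' *; lra.
  have := ler_wpM2l eq0 yr; have := sq y Uy; rewrite dotDr dotNr in h1' *; lra.
move=> /rmin_le; rewrite -qr /= enormZ ger0_norm ?subr_ge0//.
rewrite mulrBl mul1r; have := mulr_gt0 e0 nq; lra.
Qed.

End strict_growth.

Section contact_wells.
Context {R : realType} {d : nat}.
Local Notation V := 'rV[R]_d.
Variables (U : set V) (f : V -> R) (x0 : V).
Hypothesis openU : open U.
Hypothesis convU : forall x y t, U x -> U y -> 0 <= t <= 1 -> U (t *: x + (1 - t) *: y).
Hypothesis cvxf : cvx U f.
Hypothesis sf : strictly_convex_on U f.
Hypothesis Ux0 : U x0.
Hypothesis minx0 : forall x, U x -> x <> x0 -> f x0 < f x.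

Let W_spec (W W1 : R -> R) := [/\ smooth1 W, forall t : R, is_derive t (1 : R) W (W1 t),
    W 0 = 0, W1 0 = 0 & {homo W1 : u v / u < v}] /\
  forall x i, U x -> d%:R * `|W1 (x ord0 i - x0 ord0 i)| * enorm (x - x0) <= f x - f x0.

Let gap r : 0 < r -> exists2 mu, 0 < mu & forall y, U y -> r <= enorm (y - x0) ->
    mu * enorm (y - x0) <= f y - f x0.
Proof.
move=> r0; have [e e0 eU] := open_norm_ball U openU x0 Ux0.
have re0 : 0 < Num.min r e by rewrite lt_min r0.
have [|mu mu0 hmu] := sphere_gap U openU convU f x0 (Num.min r e) cvxf Ux0 re0 _ minx0.
  move=> y ye; apply: eU; apply: (le_trans (ler_norm_enorm _)); apply: (le_trans ye).
  by rewrite ge_min lexx orbT.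
exists mu => // y Uy ry; apply: hmu => //; apply: le_trans ry; by rewrite ge_min lexx.
Qed.

Let f_ge x : U x -> f x0 <= f x.
Proof. by move=> Ux; have [->//|/eqP/(minx0 x Ux)/ltW] := eqVneq x x0. Qed.

Lemma strict_well_ex : exists W W1, W_spec W W1.
Proof.
have p20 n : 0 < 2 ^+ n :> R by rewrite exprn_gt0.
have gapn n : exists mu, 0 < mu /\ forall y, U y -> 1 / 2 ^+ n <= enorm (y - x0) ->
    mu * enorm (y - x0) <= f y - f x0.
  by have [|mu mu0 h] := gap (1 / 2 ^+ n); [rewrite divr_gt0|exists mu].
have [mu hmu] := choice gapn.
have mu0 n : 0 < mu n by case: (hmu n).
have d1 : 0 < d%:R + 1 :> R by rewrite ltr_wpDl.
(* With [mu n] the growth rate of f outside radius 2^-n, a term active at a coordinate of x - x0 has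
   weight below the growth rate at x divided by d, as [W1_le] demands. *)
pose c n : R := Num.min 1 (mu n / (d%:R + 1)) / 2 ^+ n.+1.
have cP n : 0 < c n <= 1 / 2 ^+ n.+1.
  rewrite divr_gt0 ?lt_min ?ltr01 ?divr_gt0//=.
  by rewrite ler_pM2r ?invr_gt0// ge_min lexx.
have [|e e0|W [W1 [hW W1B]]] := flat_well_ex c (fun n => 1 / 2 ^+ n) cP.
- by move=> n; rewrite divr_ge0// ltW.
- by have [n hn] := lt_pow2 1 e e0; exists n.
exists W, W1; split=> // x i Ux.
have d0 : 0 < d%:R :> R by rewrite ltr0n; case: (d) i => // -[].
have [->|/eqP xx] := eqVneq x x0; first by rewrite !subrr enorm0 mulr0.
have n0 : 0 < enorm (x - x0) by apply: enorm_gt0 => /eqP; rewrite subr_eq0 => /eqP.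
have w0 : 0 <= f x - f x0 by rewrite subr_ge0 f_ge.
have dn0 : 0 < d%:R * enorm (x - x0) by rewrite mulr_gt0.
have := W1B (x ord0 i - x0 ord0 i) ((f x - f x0) / (d%:R * enorm (x - x0))).
have h1 : 0 <= (f x - f x0) / (d%:R * enorm (x - x0)) by rewrite divr_ge0// ltW.
move=> /(_ h1); rewrite ler_pdivlMr// mulrCA mulrA; apply.
move=> n sn; rewrite ler_pM2r ?invr_gt0//.
have snz : 1 / 2 ^+ n <= enorm (x - x0).
  apply: (le_trans (ltW sn)); have := ler_coord_enorm (x - x0) i; by rewrite !mxE.
have h2 := (hmu n).2 x Ux snz.
apply: (@le_trans _ _ (mu n / (d%:R + 1))); first by rewrite ge_min lexx orbT.
rewrite ler_pdivlMr// mulrAC ler_pdivrMr//.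
have h3 : d%:R * (mu n * enorm (x - x0)) <= d%:R * (f x - f x0) by rewrite ler_pM2l.
lra.
Qed.

(** A small multiple of [bowl] suffices: near x0 its derivative is at most linear, against the
    quadratic growth c / 2 |x - x0|^2 of f obtained at the midpoint; farther away it is bounded,
    against linear growth. *)
Lemma strong_well_ex : locally_sconvex U f ->
  exists W W1, W_spec W W1 /\ locally_sconvex U (well f x0 W).
Proof.
move=> scf; have [c [c0 [r r0 hc]]] := scf x0 Ux0.
have [e e0 eU] := open_norm_ball U openU x0 Ux0.
have [mu mu0 hmu] := gap r r0.
have [C C0 hC] := @bowl1_lin R.
have dC : 0 < d%:R * C + 1 by rewrite ltr_wpDl// mulr_ge0// ltW.
have d1 : 0 < d%:R + 1 :> R by rewrite ltr_wpDl.
pose k := Num.min (c / 2 / (d%:R * C + 1)) (mu / (d%:R + 1)).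
have k0 : 0 < k by rewrite lt_min !divr_gt0.
have kc : k * (d%:R * C + 1) <= c / 2 by rewrite -ler_pdivlMr// ge_min lexx.
have kmu : k * (d%:R + 1) <= mu by rewrite -ler_pdivlMr// ge_min lexx orbT.
pose W t := k * bowl t + - (k * bowl 0); pose W1 t := k * bowl1 t.
have dW (t : R) : is_derive t (1 : R) W (W1 t).
  have dc : is_derive t (1 : R) (cst (- (k * bowl 0)) : R -> R) 0 by exact: is_derive_cst.
  by have := is_deriveD (is_deriveZ k (is_derive_bowl t)) dc; rewrite addr0.
have b10 : bowl1 (0 : R) = 0.
  by apply/eqP; rewrite -normr_le0; have := hC 0; rewrite normr0 mulr0.
exists W, W1; split; first split; first split=> //.
- by move=> n; apply: Ck1_add; [apply: Ck1_scale; exact: smooth1_bowl|exact: Ck1_cst].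
- by rewrite /W subrr.
- by rewrite /W1 b10 mulr0.
- move=> u v uv; rewrite /W1 ltr_pM2l//.
  have [w _ h] := MVT1 _ _ _ _ is_derive_bowl1 (ltW uv).
  by rewrite -subr_gt0 h mulr_gt0 ?bowl2_gt0// subr_gt0.
- move=> x i Ux; rewrite /W1 normrM gtr0_norm//.
  set b := `|bowl1 _|; set n := enorm _.
  have b0 : 0 <= b by exact: normr_ge0.
  have n0 : 0 <= n by exact: enorm_ge0.
  have [rn|nr] := leP r n.
    apply: le_trans (hmu x Ux rn); rewrite -/n ler_wpM2r//.
    have b1 : b <= 1 by exact: bowl1_le.
    have : d%:R * k * b <= d%:R * k by rewrite ler_piMr// mulr_ge0// ltW.
    lra.
  have bn : b <= C * n.
    apply: (le_trans (hC _)); rewrite ler_pM2l//.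
    by have := ler_coord_enorm (x - x0) i; rewrite !mxE.
  have xx : eball x0 r x by exact: nr.
  have x00 : eball x0 r x0 by rewrite /eball /= subrr enorm0.
  have h2 : 0 <= (1 / 2 : R) <= 1 by apply/andP; split; lra.
  have := hc x x0 _ xx x00 h2; have := f_ge _ (convU _ _ _ Ux Ux0 h2); rewrite -/n => h3 h4.
  have h5 : c / 2 * n ^+ 2 <= f x - f x0 by lra.
  apply: le_trans h5; rewrite (_ : c / 2 * n ^+ 2 = c / 2 * n * n); last by ring.
  apply: ler_wpM2r => //.
  have h6 : d%:R * k * b <= d%:R * k * (C * n) by rewrite ler_wpM2l// mulr_ge0// ltW.
  have h7 := ler_wpM2r n0 kc; have h8 := mulr_ge0 (ltW k0) n0; lra.
have hs : locally_sconvex U (fun x : V => \sum_(i < d) W (x ord0 i - x0 ord0 i)).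
  apply: (sumcoord_sconvex (fun i t => W (t - x0 ord0 i))) => A.
  have [c' c'0 hc'] := bowl_sconvex (A + enorm x0).
  exists (k * c'); first by rewrite mulr_gt0.
  move=> i s t a sA tA a01.
  have bd u : `|u| <= A -> `|u - x0 ord0 i| <= A + enorm x0.
    by move=> uA; apply: (le_trans (ler_normB _ _)); rewrite lerD// ler_coord_enorm.
  have := hc' _ _ a (bd s sA) (bd t tA) a01.
  rewrite (_ : a * (s - _) + _ = a * s + (1 - a) * t - x0 ord0 i); last by ring.
  rewrite (_ : s - x0 ord0 i - _ = s - t); last by ring.
  move=> h; have := ler_wpM2l (ltW k0) h; rewrite /W; lra.
move=> x Ux; have [c' [c'0 [r' r'0 h]]] := hs x Ux.
exists c'; split=> //; exists r' => // y z t yr zr t01; rewrite /well.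
have := h y z t yr zr t01; lra.
Qed.

End contact_wells.

(** * Strong convexity and second derivatives *)

Section second_derivative.
Context {R : realType} {d : nat}.
Local Notation V := 'rV[R]_d.
Implicit Types (g phi : V -> R) (U : set V) (x v : V).

Lemma derive_ge_right g x v (K h0 : R) : derivable g x v -> 0 < h0 ->
  (forall h, 0 < h -> h < h0 -> K * h <= g (h *: v + x) - g x) -> K <= 'D_v g x.
Proof.
move=> dg h00 hK; rewrite leNgt; apply/negP => DK.
have e0 : 0 < (K - 'D_v g x) by rewrite subr_gt0.
have FF : Filter (0 : R)^' by typeclasses eauto.
have := (@cvgrPdist_lt _ R^o R (0 : R)^' FF
  (fun h : R => h^-1 *: (g (h *: v + x) - g x)) ('D_v g x)).1 dg _ e0.
rewrite /dnbhs near_withinE => /nbhs_normP[e /= ee0 he].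
pose h := Num.min h0 e / 2.
have h0' : 0 < h by rewrite divr_gt0// lt_min h00.
have hh0 : h < h0.
  apply: (@lt_le_trans _ _ (Num.min h0 e)); last by rewrite ge_min lexx.
  by rewrite /h ltr_pdivrMr// ltr_pMr ?ltr1n// lt_min h00.
have hhe : h < e.
  apply: (@lt_le_trans _ _ (Num.min h0 e)); last by rewrite ge_min lexx orbT.
  by rewrite /h ltr_pdivrMr// ltr_pMr ?ltr1n// lt_min h00.
have := he h; rewrite /ball_ /= sub0r normrN gtr0_norm// => /(_ hhe).
rewrite gt_eqF// => /(_ isT); rewrite ltr_norml => /andP[+ _].
rewrite /GRing.scale /= => hlt.
have : K <= h^-1 * (g (h *: v + x) - g x) by rewrite ler_pdivlMl// mulrC hK.
lra.
Qed.

Lemma deriveZ_dir g x v (a : R) : differentiable g x -> 'D_(a *: v) g x = a * 'D_v g x.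
Proof. by move=> dg; rewrite !deriveE// linearZ. Qed.

Lemma derive_coord g x v : differentiable g x ->
  'D_v g x = \sum_(j < d) v ord0 j * 'D_(delta_mx ord0 j) g x.
Proof.
move=> dg; rewrite deriveE// {1}(row_sum_delta v) linear_sum.
by apply: eq_bigr => j _; rewrite linearZ deriveE.
Qed.

(** Both sides are limits of the same difference quotients. *)
Lemma derive1_line g x v : derive1 (fun s : R => g (x + s *: v)) = (fun s => 'D_v g (x + s *: v)).
Proof.
apply/funext => s; rewrite /derive1 /derive.
have E : (fun h : R => h^-1 *: (g (x + (h + s) *: v) - g (x + s *: v))) =
    (fun h : R => h^-1 *: ((g \o shift (x + s *: v)) (h *: v) - g (x + s *: v))).
  by apply/funext => h /=; rewrite scalerDl addrCA.
by rewrite -E.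
Qed.

Lemma derive1n2_line g x v (t : R) :
  derive1n 2 (fun s : R => g (x + s *: v)) t = 'D_v ('D_v g) (x + t *: v).
Proof.
rewrite -[LHS]/(derive1 (derive1 (fun s : R => g (x + s *: v))) t) derive1_line.
exact: (congr1 (@^~ t) (derive1_line ('D_v g) x v)).
Qed.

Lemma is_derive_line g x v (t : R) : differentiable g (x + t *: v) ->
  is_derive t (1 : R) (fun s : R => g (x + s *: v)) ('D_v g (x + t *: v)).
Proof.
move=> dg; have dv : derivable g (x + t *: v) v by exact: diff_derivable.
apply: DeriveDef; last by rewrite -derive1E derive1_line.
move: dv; rewrite /derivable.
have -> : (fun h : R => h^-1 *: (((fun s : R => g (x + s *: v)) \o shift t) (h *: (1 : R)) - g (x + t *: v))) =
    (fun h : R => h^-1 *: ((g \o shift (x + t *: v)) (h *: v) - g (x + t *: v))).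
  by apply/funext => h /=; rewrite [h *: (1 : R)]mulr1 scalerDl addrCA.
exact.
Qed.

End second_derivative.

Section strong_convexity.
Context {R : realType} {d : nat}.
Local Notation V := 'rV[R]_d.
Implicit Types (f g phi : V -> R) (U : set V).

Lemma convex_setP U : convex_set U ->
  forall x y t, U x -> U y -> 0 <= t <= 1 -> U (t *: x + (1 - t) *: y).
Proof.
move=> cU x y t Ux Uy /andP[t0 t1].
have := cU x y (Itv01 t0 t1); rewrite !inE => /(_ Ux Uy).
exact.
Qed.

Lemma convex_functionP U f : convex_function U f <-> cvx U f.
Proof.
split=> [cf x y t Ux Uy /andP[t0 t1]|cf t x y]; last first.
  rewrite !inE => Ux Uy; apply: (cf x y t%:inum) => //.
  by rewrite ge0 le1.
have := cf (Itv01 t0 t1) x y; rewrite !inE => /(_ Ux Uy).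
exact.
Qed.

Lemma enorm_conv (p y z : V) t : 0 <= t <= 1 ->
  enorm (t *: y + (1 - t) *: z - p) <= t * enorm (y - p) + (1 - t) * enorm (z - p).
Proof.
move=> /andP[t0 t1]; rewrite (_ : _ - p = t *: (y - p) + (1 - t) *: (z - p)); last first.
  by apply/rowP => i; rewrite !mxE; ring.
by apply: (le_trans (ler_enormD _ _)); rewrite !enormZ !ger0_norm ?subr_ge0.
Qed.

Lemma eball_conv (p : V) r y z t : eball p r y -> eball p r z -> 0 <= t <= 1 ->
  eball p r (t *: y + (1 - t) *: z).
Proof.
rewrite /eball /= => yr zr t01; apply: (le_lt_trans (enorm_conv _ _ _ _ t01)).
have /andP[t0 t1] := t01; have := ler_wpM2l t0 (ltW yr).
have [->|tn1] := eqVneq t 1; first by rewrite subrr !mul0r !mul1r !addr0.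
have s0 : 0 < 1 - t by rewrite subr_gt0 lt_neqAle tn1.
have := zr; rewrite -(ltr_pM2l s0); lra.
Qed.

Lemma closed_eball_conv (p : V) r y z t :
  closed_eball p r y -> closed_eball p r z -> 0 <= t <= 1 ->
  closed_eball p r (t *: y + (1 - t) *: z).
Proof.
rewrite /closed_eball /= => yr zr t01; apply: (le_trans (enorm_conv _ _ _ _ t01)).
have /andP[t0 t1] := t01; have := ler_wpM2l t0 yr.
by have s0 : 0 <= 1 - t by [rewrite subr_ge0]; have := ler_wpM2l s0 zr; lra.
Qed.

Let e (j : 'I_d) : V := delta_mx ord0 j.

(** Second derivatives in all directions reduce to finitely many continuous entries, which makes
    estimates near a point uniform in v. *)
Lemma hessian_coord U phi x v : open U -> Ck_on 2 U phi -> U x ->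
  'D_v ('D_v phi) x =
  \sum_(j < d) \sum_(i < d) v ord0 j * v ord0 i * 'D_(e i) ('D_(e j) phi) x.
Proof.
move=> oU [dphi Dphi] Ux.
have nU : \forall y \near x, U y by exact: open_nbhs_nbhs.
have E : \near x, 'D_v phi x = \sum_(j < d) (v ord0 j *: 'D_(e j) phi) x.
  by apply: filterS nU => y Uy; rewrite derive_coord//; exact: dphi.
rewrite (near_eq_derive v E).
have dd j : differentiable ('D_(e j) phi) x by have [h _] := Dphi (e j); exact: h.
have dj (j : 'I_d) : is_derive x v (v ord0 j *: 'D_(e j) phi)
    (v ord0 j *: 'D_v ('D_(e j) phi) x).
  by apply: is_deriveZ; apply: derivableP; exact: diff_derivable.
have := @is_derive_sum _ _ _ _ (fun j : 'I_d => v ord0 j *: 'D_(e j) phi) x v _ dj.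
rewrite (_ : \sum_(j < d) _ = (fun y => \sum_(j < d) (v ord0 j *: 'D_(e j) phi) y)); last first.
  by apply/funext => y; rewrite fct_sumE.
move=> [_ ->]; apply: eq_bigr => j _; rewrite derive_coord// scaler_sumr.
by apply: eq_bigr => i _; rewrite /GRing.scale /= mulrA.
Qed.

(** The quadratic form has a positive minimum on the unit sphere at p; continuity of the entries
    keeps half of it nearby, and homogeneity reaches all v. *)
Lemma hessian_lower U phi p : open U -> Ck_on 2 U phi -> U p ->
  (forall v, v <> 0 -> 0 < 'D_v ('D_v phi) p) -> exists2 m, 0 < m &
  \forall y \near p, forall v, m * enorm v ^+ 2 <= 'D_v ('D_v phi) y.
Proof.
move=> oU C2 Up pos.
pose a (i j : 'I_d) (y : V) := 'D_(e i) ('D_(e j) phi) y.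
pose H (y v : V) := \sum_(j < d) \sum_(i < d) v ord0 j * v ord0 i * a i j y.
have HE y v : U y -> 'D_v ('D_v phi) y = H y v by exact: hessian_coord.
have HZ y (t : R) v : H y (t *: v) = t ^+ 2 * H y v.
  rewrite /H mulr_sumr; apply: eq_bigr => j _; rewrite mulr_sumr.
  by apply: eq_bigr => i _; rewrite !mxE; ring.
pose S := [set v : V | enorm (v - 0) = 1].
have [m m0 hm] : exists2 m, 0 < m & forall v, S v -> m <= H p v.
  have [S0|S0] := pselect (S !=set0); last by exists 1 => // v Sv; case: S0; exists v.
  have [|v Sv vmin] := compact_min S (H p) S0 (compact_sphere 0 1).
    have sH : smooth_on setT (H p).
      apply: smooth_on_sum; [exact: openT|move=> j].
      apply: smooth_on_sum; [exact: openT|move=> i].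
      have sc k : smooth_on setT (fun w : V => w ord0 k).
        by rewrite coordE; exact: smooth_on_dot.
      by do ![apply: smooth_on_mul; first exact: openT] => //; exact: smooth_on_cst.
    by move=> v _; exact: sH 0%N v I.
  exists (H p v); last by [].
  rewrite -HE//; apply: pos => v0; move: Sv; rewrite /S /= v0 subr0 enorm0.
  by move=> /esym/eqP; rewrite oner_eq0.
(* There are d^2 entries, each multiplied by coordinates of absolute value at most 1, so the form
   moves by at most m / 2. *)
pose dl := m / 2 / (d%:R * d%:R + 1).
have dd0 : 0 < d%:R * d%:R + 1 :> R by rewrite ltr_wpDl// mulr_ge0.
have dl0 : 0 < dl by rewrite !divr_gt0.
have na : \forall y \near p, forall ij : 'I_d * 'I_d, `|a ij.1 ij.2 p - a ij.1 ij.2 y| < dl.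
  apply: (@filter_forall V ('I_d * 'I_d)%type
    (fun ij => [set y | `|a ij.1 ij.2 p - a ij.1 ij.2 y| < dl]) (nbhs p)) => -[i j] /=.
  apply: near_dist_lt => //.
  by have [_ /(_ (e j))[_ /(_ (e i))]] := C2; apply.
have nU : \forall y \near p, U y by exact: open_nbhs_nbhs.
exists (m / 2); first by rewrite divr_gt0.
apply: filterS2 na nU => y na Uy v; rewrite HE//.
have [->|/eqP v0] := eqVneq v 0.
  by rewrite enorm0 expr0n mulr0 /H big1// => j _; rewrite big1// => i _; rewrite !mxE !mul0r.
have nv := enorm_gt0 v v0.
pose u := (enorm v)^-1 *: v.
have nu : enorm u = 1 by rewrite enormZ gtr0_norm ?invr_gt0// mulVf// gt_eqF.
have -> : v = enorm v *: u by rewrite /u scalerA divff ?gt_eqF// scale1r.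
rewrite HZ enormZ nu mulr1 (gtr0_norm nv) mulrC ler_wpM2l ?sqr_ge0//.
have h1 : m <= H p u by apply: hm; rewrite /S /= subr0.
have h2 : `|H p u - H y u| <= d%:R * d%:R * dl.
  rewrite /H -sumrB; apply: (le_trans (ler_norm_sum _ _ _)).
  apply: (@le_trans _ _ (\sum_(j < d) \sum_(i < d) dl)); last first.
    by rewrite !sumr_const !card_ord -mulrnA -[leLHS]mulr_natl natrM.
  apply: ler_sum => j _; rewrite -sumrB; apply: (le_trans (ler_norm_sum _ _ _)).
  apply: ler_sum => i _; rewrite -mulrBr normrM -[leRHS]mul1r.
  rewrite ler_pM//; last by have := na (i, j); exact: ltW.
  by rewrite normrM -[leRHS]mulr1 ler_pM// -nu ler_coord_enorm.
have h3 : d%:R * d%:R * dl <= m / 2.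
  apply: (@le_trans _ _ ((d%:R * d%:R + 1) * dl)); first by rewrite ler_wpM2r ?(ltW dl0)// lerDl.
  by rewrite mulrC divfK// gt_eqF.
by move: h2; rewrite ler_norml => /andP[_]; lra.
Qed.

Lemma sconvex_of_C2 U phi : open U -> strongly_convex_C2_on U phi -> locally_sconvex U phi.
Proof.
move=> oU [C2 pos] p Up.
have pos' v : v <> 0 -> 0 < 'D_v ('D_v phi) p.
  move=> v0; have := pos p v 0 v0; rewrite scale0r addr0 => /(_ Up).
  by rewrite derive1n2_line scale0r addr0.
have [m m0 hm] := hessian_lower U phi p oU C2 Up pos'.
have nU : \forall y \near p, U y by exact: open_nbhs_nbhs.
have /nbhs_normP[r /= r0 hr] : \forall y \near p, U y /\
  forall v, m * enorm v ^+ 2 <= 'D_v ('D_v phi) y by apply: filterS2 nU hm.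
have hball y : eball p r y -> U y /\ forall v, m * enorm v ^+ 2 <= 'D_v ('D_v phi) y.
  move=> yr; apply: hr; rewrite /ball_ /= distrC; exact: le_lt_trans (ler_norm_enorm _) yr.
exists (m / 2); split; first by rewrite divr_gt0.
exists r => // y z t yr zr t01; pose v := y - z.
have inB s : 0 <= s <= 1 -> eball p r (z + s *: v).
  move=> s01; have := eball_conv p r y z s yr zr s01.
  by rewrite (_ : _ + _ = z + s *: v)//; apply/rowP => i; rewrite /v !mxE; ring.
have := @sconvex1 R (fun s => phi (z + s *: v)) (fun s => 'D_v phi (z + s *: v))
  (fun s => 'D_v ('D_v phi) (z + s *: v)) (m / 2 * enorm v ^+ 2) 0 1.
have [dphi Dphi] := C2.
move=> /(_ (fun s hs => is_derive_line phi z v s (dphi _ (hball _ (inB s hs)).1))).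
move=> /(_ (fun s hs => is_derive_line ('D_v phi) z v s ((Dphi v).1 _ (hball _ (inB s hs)).1))).
have h2 s : 0 <= s <= 1 -> 2 * (m / 2 * enorm v ^+ 2) <= 'D_v ('D_v phi) (z + s *: v).
  by move=> s01; have := (hball _ (inB s s01)).2 v; lra.
have i1 : 0 <= (1 : R) <= 1 by rewrite ler01 lexx.
have i0 : 0 <= (0 : R) <= 1 by rewrite lexx ler01.
move=> /(_ h2 1 0 t i1 i0 t01).
rewrite mulr1 mulr0 addr0 scale0r scale1r addr0 subr0 expr1n mulr1.
rewrite (_ : z + v = y); last by rewrite /v addrC subrK.
rewrite (_ : z + t *: v = t *: y + (1 - t) *: z); last first.
  by apply/rowP => i; rewrite /v !mxE; ring.
by rewrite -/v; lra.
Qed.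

Lemma sconvex_of_strong U f : strongly_convex_on U f -> locally_sconvex U f.
Proof.
move=> sf p Up; have [W [oW Wp WU cW [phi C2 cvfphi]]] := sf p Up.
have [c [c0 [r r0 hc]]] := sconvex_of_C2 W phi oW C2 p Wp.
have /nbhs_normP[r' /= r'0 hr'] : nbhs p W by exact: open_nbhs_nbhs.
exists c; split=> //; exists (Num.min r r'); first by rewrite lt_min r0.
move=> y z t; rewrite /eball /= !lt_min => /andP[y1 y2] /andP[z1 z2] t01.
have inW w : enorm (w - p) < r' -> W w.
  move=> wr; apply: hr'; rewrite /ball_ /= distrC; exact: le_lt_trans (ler_norm_enorm _) wr.
have /convex_functionP cf := cvfphi.
have := cf y z t (inW y y2) (inW z z2) t01; have := hc y z t y1 z1 t01; lra.
Qed.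

(** The strengthened gradient inequality at y towards y + h v and back, added up, shows that
    ['D_v g] increases by at least c h |v|^2; hence the second derivative is at least c |v|^2. *)
Lemma strong_of_sconvex U g : open U -> smooth_on U g -> locally_sconvex U g ->
  strongly_convex_C2_on U g.
Proof.
move=> oU sg scg; split; first exact: sg.
move=> x v t v0 Uy; rewrite derive1n2_line; move: Uy; set y := x + t *: v => Uy.
have [c [c0 [r r0 hc]]] := scg y Uy.
have /nbhs_normP[r' /= r'0 hr'] : nbhs y U by exact: open_nbhs_nbhs.
have dg z : U z -> differentiable g z by exact: smooth_differentiable.
have grad z w : eball y r z -> eball y r w -> U z ->
    'D_(w - z) g z <= g w - g z - c / 2 * enorm (w - z) ^+ 2.
  move=> zr wr Uz; rewrite -lerN2 -deriveN; last exact/diff_derivable/dg.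
  have h2 : 0 < (1 / 2 : R) by rewrite divr_gt0.
  apply: (@derive_ge_right _ _ (- g) z (w - z) _ (1 / 2)) => //.
    exact/derivableN/diff_derivable/dg.
  move=> h h0 h1; have h01 : 0 <= h <= 1 by apply/andP; split; lra.
  have := hc w z h wr zr h01.
  rewrite (_ : h *: w + (1 - h) *: z = h *: (w - z) + z); last first.
    by apply/rowP => i; rewrite !mxE; ring.
  rewrite (_ : (- g) _ - (- g) z = g z - g (h *: (w - z) + z)); last first.
    by rewrite !fctE opprK addrC.
  set n := enorm _ => hh.
  (* The restriction h < 1/2 replaces 1 - h by 1/2; this is the origin of c / 2 in the gradient
     inequality. *)
  have : c * (h * (1 / 2)) * n ^+ 2 <= c * (h * (1 - h)) * n ^+ 2.
    by rewrite ler_wpM2r ?sqr_ge0// ler_pM2l// ler_pM2l//; lra.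
  lra.
have nv := enorm_gt0 v v0.
have dDg : differentiable ('D_v g) y by have [_ /(_ v)[h _]] := sg 2%N; exact: h.
apply: (@lt_le_trans _ _ (c * enorm v ^+ 2)); first by rewrite mulr_gt0// exprn_gt0.
pose h0 := Num.min r r' / enorm v.
have rr : 0 < Num.min r r' by rewrite lt_min r0.
apply: (@derive_ge_right _ _ _ y v _ h0); [exact: diff_derivable|by rewrite divr_gt0|].
move=> h hp hh0; have hv : enorm (h *: v + y - y) < Num.min r r'.
  by rewrite addrK enormZ gtr0_norm// -ltr_pdivlMr.
move: hv; rewrite lt_min => /andP[hr hr2].
have yy : eball y r y by rewrite /eball /= subrr enorm0.
have Uz : U (h *: v + y).
  by apply: hr'; rewrite /ball_ /= distrC; exact: le_lt_trans (ler_norm_enorm _) hr2.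
have := grad y _ yy hr Uy; have := grad _ y hr yy Uz.
rewrite (enormB y) addrK (_ : y - (h *: v + y) = (- h) *: v); last first.
  by rewrite opprD addrCA subrr addr0 scaleNr.
rewrite !deriveZ_dir; [|exact: dg..].
rewrite enormZ gtr0_norm// exprMn => g1 g2.
have : h * (c * enorm v ^+ 2 * h) <= h * ('D_v g (h *: v + y) - 'D_v g y) by lra.
by rewrite ler_pM2l.
Qed.

End strong_convexity.

(** * The approximation theorem *)

Section lipschitz.
Context {R : realType} {d : nat}.
Local Notation V := 'rV[R]_d.
Variables (U : set V) (f g : V -> R).
Hypothesis openU : open U.
Hypothesis dg : forall x, U x -> differentiable g x.
Hypothesis ex_sub : forall x, U x -> exists q, sub U f x q.
Hypothesis grad_g : forall x q, U x -> sub U f x q -> grad_le g x (enorm q).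

(** Moving from x by t q raises f by at least t |q|^2 over a distance t |q|; B has to be a
    neighbourhood of x for this move. *)
Lemma sub_le_lip (B : set V) x q L : U x -> sub U f x q -> (\forall y \near x, B y) ->
  (forall y z, (B `&` U) y -> (B `&` U) z -> `|f y - f z| <= L * enorm (y - z)) ->
  0 <= L -> enorm q <= L.
Proof.
move=> Ux sq nB hL L0; have [->|/eqP q0] := eqVneq q 0; first by rewrite enorm0.
have nq := enorm_gt0 q q0.
have nU : \forall y \near x, U y by exact: open_nbhs_nbhs.
have /nbhs_normP[r /= r0 hr] : \forall y \near x, B y /\ U y by apply: filterS2 nB nU.
pose t := r / 2 / enorm q.
have t0 : 0 < t by rewrite !divr_gt0.
have [By Uy] : B (x + t *: q) /\ U (x + t *: q).
  apply: hr; rewrite /ball_ /= opprD addrA subrr add0r normrN.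
  apply: (le_lt_trans (ler_norm_enorm _)); rewrite enormZ gtr0_norm// /t divfK ?gt_eqF//.
  by rewrite ltr_pdivrMr// ltr_pMr ?ltr1n.
have [Bx _] : B x /\ U x by apply: hr; rewrite /ball_ /= subrr normr0.
have := hL (x + t *: q) x (conj By Uy) (conj Bx Ux).
have := sq _ Uy; rewrite (_ : x + t *: q - x = t *: q); last by rewrite addrAC subrr add0r.
rewrite dotZr -enorm_sq enormZ (gtr0_norm t0) ler_norml => h1 /andP[_ h2].
have : (t * enorm q) * enorm q <= (t * enorm q) * L by rewrite expr2 in h1; lra.
by rewrite ler_pM2l// mulr_gt0.
Qed.

Lemma Lip_le (B B' : set V) : B `<=` U ->
  (forall y z t, B y -> B z -> 0 <= t <= 1 -> B (t *: y + (1 - t) *: z)) ->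
  (forall x, B x -> \forall y \near x, B' y) ->
  (Lip B g <= Lip (B' `&` U) f)%E.
Proof.
move=> BU cB nB; apply: le_ereal_inf => _ [L [L0 hL] <-]; exists L => //; split=> //.
have le1 x y : B x -> B y -> g x - g y <= L * enorm (x - y).
  move=> Bx By; have inB s : 0 <= s <= 1 -> B (y + s *: (x - y)).
    move=> s01; rewrite (_ : _ + _ = s *: x + (1 - s) *: y); first exact: cB.
    by apply/rowP => i; rewrite !mxE; ring.
  have [|s s01] := MVT1_in (fun s => g (y + s *: (x - y)))
    (fun s => 'D_(x - y) g (y + s *: (x - y))) 0 1 _ ler01.
    by move=> s s01; apply: is_derive_line; apply: dg; apply: BU; exact: inB.
  rewrite scale1r scale0r addr0 (addrC y) subrK subr0 mulr1 => ->.
  have Bs := inB s s01; have Us := BU _ Bs.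
  have [q sq] := ex_sub _ Us.
  apply: (le_trans (grad_g _ q Us sq _)); rewrite ler_wpM2r ?enorm_ge0//.
  exact: (sub_le_lip B' _ q L Us sq (nB _ Bs) hL L0).
move=> x y Bx By; rewrite ler_norml; have := le1 x y Bx By; have := le1 y x By Bx.
by rewrite (enormB y); move=> h1 h2; apply/andP; split; lra.
Qed.

End lipschitz.

Lemma near_eball {R : realType} {d : nat} (p x : 'rV[R]_d) r : enorm (x - p) < r ->
  \forall y \near x, eball p r y.
Proof.
move=> xr; apply: (@near_lt R d (fun y => enorm (y - p)) (cst r)) => //.
  exact: continuous_enormB.
exact: cst_continuous.
Qed.

Section main.
Context {R : realType} {d : nat}.
Local Notation V := 'rV[R]_d.
Variables (U : set V) (f : V -> R).
Hypothesis openU : open U.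
Hypothesis convU : forall x y t, U x -> U y -> 0 <= t <= 1 -> U (t *: x + (1 - t) *: y).
Hypothesis cvxf : cvx U f.
Let str := strictly_convex_on U f.

Lemma approx_ex x0 eps : U x0 -> 0 < eps -> exists g : V -> R,
  [/\ smooth_on U g, cvx U g & forall x, U x -> f x - eps <= g x <= f x] /\
  (forall x q, U x -> sub U f x q -> grad_le g x (enorm q)) /\
  (strictly_convex_on U f -> strictly_convex_on U g) /\
  (locally_sconvex U f -> locally_sconvex U g).
Proof.
move=> Ux0 eps0; pose e := eps / 3.
(* The loss in [outer_approx] is J + 2 e1, with e1 = e and J either 0 or e. *)
have e0 : 0 < e by rewrite divr_gt0.
have sc_str : locally_sconvex U f -> str by exact: strictly_convex_of_sconvex.
pose LL a := minor U f a /\ (str -> exists2 C, 0 < C & exists D,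
  forall y, U y -> C * psi y - D <= f y - ev a y).
have LLm a : LL a -> minor U f a by case.
have LLs x q : U x -> sub U f x q -> LL (q, f x - dot q x).
  move=> Ux sq; split; first exact: sub_minor.
  by move=> st; exact: (strict_support_growth U openU convU).
have finish incl s0 r0 J Um tm : J <= e -> family_spec U f LL incl s0 r0 e J Um tm ->
    (str -> incl -> strictly_convex_on U s0) ->
    (locally_sconvex U f -> incl -> locally_sconvex U s0) ->
    exists g : V -> R,
  [/\ smooth_on U g, cvx U g & forall x, U x -> f x - eps <= g x <= f x] /\
  (forall x q, U x -> sub U f x q -> grad_le g x (enorm q)) /\
  (strictly_convex_on U f -> strictly_convex_on U g) /\
  (locally_sconvex U f -> locally_sconvex U g).
  move=> Je spec s0s s0c.
  have growth : str -> forall a, okp LL incl r0 (Some a) -> exists2 C, 0 < C & exists D,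
      forall y, U y -> C * psi y - D <= f y - ev a y.
    by move=> st a [[_ h] _]; exact: h.
  have [g [[sg cg bg] [vg [stg scg]]]] :=
    outer_approx U f LL incl s0 r0 e J Um tm spec str growth x0 Ux0.
  exists g; split; first split=> //.
    move=> x Ux; have /andP[h ->] := bg x Ux; rewrite andbT; apply: le_trans h.
    by have : eps = 3 * e by [rewrite /e; field]; lra.
  split=> //; split=> [st|sc]; first exact: stg st (s0s st).
  exact: scg (sc_str sc) (s0c sc).
have [att|natt] := pselect (exists2 a, minor U f a & enorm a.1 = rmin U f); last first.
  have lt a : minor U f a -> rmin U f < enorm a.1.
    move=> ma; rewrite lt_neqAle (rmin_le U f _ ma) andbT; apply/eqP => h.
    by apply: natt; exists a.
  have [Um [tm spec]] := spec_series U f LL openU convU cvxf LLm LLs lt x0 e Ux0 e0.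
  by apply: (finish False _ _ 0 _ _ (ltW e0) spec).
have [l0 [ml0 l0r l0max]] := rmin_attained U f x0 Ux0 att.
have [[x [q [Ux sq qr]]]|nc] :=
  pselect (exists x q, [/\ U x, sub U f x q & enorm q <= rmin U f]); last first.
  have nc' x q : U x -> sub U f x q -> rmin U f < enorm q.
    by move=> Ux sq; rewrite ltNge; apply/negP => h; apply: nc; exists x, q.
  have mixL b t : LL b -> 0 < t -> t <= 1 -> LL (mix t l0 b).
    move=> [mb gb] t0 t1; split; first by apply: minor_mix => //; rewrite (ltW t0).
    move=> st; have [C C0 [D hD]] := gb st; exists (t * C); first exact: mulr_gt0.
    exists (t * D) => y Uy; rewrite ev_mix.
    have t1' : 0 <= 1 - t by rewrite subr_ge0.
    have := ler_wpM2l (ltW t0) (hD y Uy); have := ler_wpM2l t1' (ml0 y Uy); lra.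
  have spec := spec_no_contact U f LL openU convU cvxf LLm LLs l0 ml0 l0r l0max nc' mixL e e0.
  by apply: (finish False _ _ 0 _ _ (ltW e0) spec).
have [st|nst] := pselect str; last first.
  have spec := spec_affine U f LL openU convU cvxf LLm LLs l0 ml0 l0r l0max e e0.
  by apply: (finish True _ _ e _ _ (lexx _) spec) => [//|/sc_str].
have q0 : q = 0.
  apply: (strict_contact_slope U openU convU f x q) => //.
  by apply/le_anti; rewrite qr (rmin_le U f _ (sub_minor U f x q sq)).
have fmin y : U y -> f x <= f y by move=> /sq; rewrite q0 dot0l addr0.
have funiq y : U y -> f y = f x -> y = x.
  move=> Uy fyx; apply: contrapT => yx.
  have h2 : 0 < (1 / 2 : R) < 1 by apply/andP; split; lra.
  have h2' : 0 <= (1 / 2 : R) <= 1 by apply/andP; split; lra.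
  have := st x y _ Ux Uy (fun xy => yx (esym xy)) h2.
  have := fmin _ (convU y x _ Uy Ux h2'); rewrite (addrC (_ *: y)); lra.
have fmin' y : U y -> y <> x -> f x < f y.
  move=> Uy yx; rewrite lt_neqAle fmin// andbT; apply/eqP => h; apply: yx.
  by apply: funiq.
(* Two kinds of wells: f may be flatter than any quadratic at its minimum, which calls for the flat
   series; a strongly convex f needs a strongly convex well. *)
have [sc|nsc] := pselect (locally_sconvex U f).
  have [W [W1 [[[sW dW W0 W10 hW] W1_le] scW]]] :=
    strong_well_ex U f x openU convU cvxf Ux fmin' sc.
  have spec := spec_well U f LL openU convU cvxf LLm LLs x Ux fmin funiq W W1 sW dW W0 W10 hW W1_le e e0.
  apply: (finish True _ _ e _ _ (lexx _) spec) => [_ _|_ _ //].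
  exact: (strictly_convex_well U f).
have [W [W1 [[sW dW W0 W10 hW] W1_le]]] :=
  strict_well_ex U f x openU convU cvxf Ux fmin'.
have spec := spec_well U f LL openU convU cvxf LLm LLs x Ux fmin funiq W W1 sW dW W0 W10 hW W1_le e e0.
apply: (finish True _ _ e _ _ (lexx _) spec) => [_ _|//].
exact: (strictly_convex_well U f).
Qed.

End main.

Theorem corollary1 (R : realType) (d : nat) (U : set 'rV[R]_d)
    (openU : open U) (convexU : convex_set U)
    (f : 'rV[R]_d -> R) (convexf : convex_function U f)
    (eps : R) (eps0 : 0 < eps) :
  exists g : 'rV[R]_d -> R,
    smooth_on U g /\
    convex_function U g /\
    (forall x, U x -> f x - eps <= g x <= f x) /\
    (forall (x : 'rV[R]_d) (r : R), 0 < r -> eball x r `<=` U ->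
      (Lip (eball x r) g <= Lip (eball x ((1 + eps) * r) `&` U) f)%E) /\
    (forall (x : 'rV[R]_d) (r : R), 0 < r -> closed_eball x r `<=` U ->
      (Lip (closed_eball x r) g <=
         Lip (closed_eball x ((1 + eps) * r) `&` U) f)%E) /\
    (strictly_convex_on U f -> strictly_convex_on U g) /\
    (strongly_convex_on U f -> strongly_convex_C2_on U g).
Proof.
have cU := convex_setP U convexU; have /convex_functionP cf := convexf.
have [[x0 Ux0]|U0] := pselect (exists x, U x); last first.
  have Un x : ~ U x by move=> Ux; apply: U0; exists x.
  exists (cst 0); split; first exact: smooth_on_cst.
  split; first by apply/convex_functionP => x y t /Un.
  split; first by move=> x /Un.
  split.
    move=> x r r0 xU; case: (Un x); apply: xU.
    by rewrite /eball /= subrr enorm0.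
  split.
    move=> x r r0 xU; case: (Un x); apply: xU.
    by rewrite /closed_eball /= subrr enorm0 ltW.
  split; first by move=> _ x y t /Un.
  by move=> _; split; [exact: smooth_on_cst|move=> x v t _ /Un].
have [g [[sg cg bg] [vg [stg scg]]]] := approx_ex U f openU cU cf x0 eps Ux0 eps0.
have dg x : U x -> differentiable g x by exact: smooth_differentiable.
have exs x : U x -> exists q, sub U f x q by exact: subgradient_ex.
have big (r : R) : 0 < r -> r < (1 + eps) * r by move=> r0; rewrite ltr_pMl// ltrDl.
exists g; split=> //; split; first exact/convex_functionP.
split=> //; split.
  move=> x r r0 xU; apply: (Lip_le U f g) => //; first by move=> y z t; exact: eball_conv.
  by move=> y yr; apply: near_eball; apply: lt_trans (big r r0).
split.
  move=> x r r0 xU; apply: (Lip_le U f g) => //.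
    by move=> y z t; exact: closed_eball_conv.
  move=> y yr; have /near_eball : enorm (y - x) < (1 + eps) * r by exact: le_lt_trans (big r r0).
  by apply: filterS => z; exact: ltW.
split=> // sf; apply: strong_of_sconvex => //.
by apply: scg; exact: sconvex_of_strong.
Qed.
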